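(* If $G$ is a plane graph that is subcubic (every vertex has degree at most $3$) or outerplane (every vertex is incident with the outer face), then $\chi_{\mathrm{fum}}(G) \leq 4$.
   Context: All graphs are simple. A plane graph is a graph embedded in the plane without crossing edges. A coloring is an assignment of colors to the vertices; it is proper if adjacent vertices receive distinct colors. A facial unique-maximum coloring (FUM-coloring) of an embedded graph is a proper coloring of the vertices with integers such that on every face (including the outer face) the maximal color appearing on the vertices incident with that face appears on exactly one vertex incident with that face. The FUM chromatic number $\chi_{\mathrm{fum}}(G)$ is the minimum $k$ such that $G$ admits a FUM-coloring with colors from $\{1,2,\ldots,k\}$. *)

(* Defs.v *)
From HB Require Import structures.
From mathcomp Require Import all_boot all_order all_algebra.
From mathcomp Require Import all_classical all_reals all_analysis.

Set Implicit Arguments.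
Unset Strict Implicit.
Unset Printing Implicit Defensive.

Import Order.TTheory GRing.Theory Num.Theory.
Import numFieldNormedType.Exports.

Local Open Scope classical_set_scope.
Local Open Scope ring_scope.

Record simple_graph := SimpleGraph {
  vertex : finType;
  adj : rel vertex;
  adj_sym : symmetric adj;
  adj_irr : irreflexive adj }.

Definition degree (G : simple_graph) (v : vertex G) : nat := #|adj v|.

Definition subcubic (G : simple_graph) : Prop :=
  forall v : vertex G, (degree v <= 3)%N.

Definition is_arc (R : realType) (A : set (R * R)) (p q : R * R) : Prop :=
  exists f : R -> R * R,
    [/\ {within `[0, 1], continuous f},
        {in `[0, 1] &, injective f},
        f 0 = p, f 1 = q & A = f @` `[0, 1]].

(* [curve u v] is the closed arc, endpoints included, that represents the edge
   uv; it is unconstrained when u and v are not adjacent. *)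
Record plane_graph (R : realType) := PlaneGraph {
  plane_graph_graph :> simple_graph;
  pos : vertex plane_graph_graph -> R * R;
  curve : vertex plane_graph_graph -> vertex plane_graph_graph -> set (R * R);
  pos_inj : injective pos;
  curve_sym : forall u v, adj u v -> curve u v = curve v u;
  curve_arc : forall u v, adj u v -> is_arc (curve u v) (pos u) (pos v);
  curve_vertex : forall u v w,
    adj u v -> curve u v (pos w) -> w = u \/ w = v;
  curve_cross : forall u v x y p,
    adj u v -> adj x y -> curve u v p -> curve x y p ->
    [\/ u = x /\ v = y, u = y /\ v = x | range pos p] }.

Section PlaneGraphTheory.
Variables (R : realType) (G : plane_graph R).

Definition drawing : set (R * R) :=
  [set p | range (@pos R G) p \/
           exists u v : vertex G, adj u v /\ curve u v p].

Definition face (F : set (R * R)) : Prop :=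
  exists2 p, ~ drawing p & F = connected_component (~` drawing) p.

Definition outer_face (F : set (R * R)) : Prop := face F /\ ~ bounded_set F.

Definition incident (v : vertex G) (F : set (R * R)) : Prop :=
  closure F (pos v).

Definition outerplane : Prop :=
  exists F, outer_face F /\ forall v : vertex G, incident v F.

Definition proper_coloring (c : vertex G -> int) : Prop :=
  forall u v : vertex G, adj u v -> c u != c v.

Definition max_color_on (c : vertex G -> int) (F : set (R * R)) (m : int) :
    Prop :=
  (exists2 v, incident v F & c v = m) /\
  (forall v, incident v F -> c v <= m).

(* The graph without vertices has a face with no incident vertex: no maximal
   color appears on it and the condition holds vacuously there. *)
Definition fum_coloring (c : vertex G -> int) : Prop :=
  proper_coloring c /\
  forall F m, face F -> max_color_on c F m ->
    exists! v, incident v F /\ c v = m.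

Definition fum_colorable (k : nat) : Prop :=
  exists2 c : vertex G -> int, fum_coloring c & forall v, 1 <= c v <= k%:Z.

Lemma fum_colorable_card : fum_colorable #|vertex G|.
Proof.
pose c (v : vertex G) : int := (enum_rank v).+1%:Z.
have c_inj : injective c.
  by move=> u v [] /ord_inj /enum_rank_inj.
exists c; last by move=> v; rewrite /c !lez_nat ltnS leq0n /= ltn_ord.
split=> [u v uv|F m _ [[v vF cv] _]].
  by apply/eqP => /c_inj euv; rewrite euv adj_irr in uv.
by exists v; split=> // w [_ cw]; apply: c_inj; rewrite cv cw.
Qed.

Lemma fum_colorable_ex : exists k, `[< fum_colorable k >].
Proof. by exists #|vertex G|; apply/asboolP; exact: fum_colorable_card. Qed.

Definition chi_fum : nat := ex_minn fum_colorable_ex.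

End PlaneGraphTheory.

(* Main.v *)
Require Import Defs.
From mathcomp Require Import all_boot all_order all_algebra.
From mathcomp Require Import all_classical all_reals all_analysis.
From mathcomp Require Import zify lra.

(** Colours 4 and 3 do the work. A vertex v of colour 4 takes care of the faces it
touches, and deleting v merges all these faces into one, its hole. It is
therefore enough to colour the rest with 1, ..., 4 so that the hole only sees
colours up to 3 and every other face has a unique maximum ([capped],
[color_hole]).

If all vertices touch the distinguished face f0, three colours suffice
([outer_capped]). Colour 3 goes to an independent set I with exactly one vertex
on every face other than f0; then deleting I leaves a single face, so no edge
lies on a cycle and the rest is bipartite. To find I, look at a face F other
than f0: the vertices it touches span an induced cycle, and everything else is
attached to this cycle along single vertices or edges, because f0 must reach
everything. So the graph decomposes along cliques with at most two vertices
into cycles and single edges, and I can be chosen piece by piece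
([outer_extendable]).

For a subcubic graph ([subcubic_capped]), take an edge x v with x on f0 and v
off it. Give v colour 4 and delete both vertices. Since x has degree at most 3,
all faces at x except f0 contain the edge x v, so they are settled by v; and x
has only two other neighbours, so one of 1, 2, 3 is free for it. If there is no
such edge, either all vertices touch f0, or the graph is disconnected and the
part inside some face can be coloured separately ([capped_split]).

The edges are arbitrary arcs, so the facts about faces that this uses have to
be proved for arbitrary continua. All of them come from two statements: the
theorem of Janiszewski, that two compact sets with connected intersection
separate two points together only if one of them does ([janiszewski]; a variant
is [janiszewski2]), and the converse statement that a closed curve separates
([two_ends]). Both are proved with chains modulo 2 on fine square lattices: a
closed chain has two sides, and a connected set that it avoids lies on one of
them ([alexander], [side_connected]). For arcs and edges they give that a face
touching an inner point of an edge touches all of it ([arc_touch]), that an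
edge has at most two faces ([arc_two_faces]) and exactly two if it lies on a
cycle ([nonbridge]), and that two faces cannot share two edges at a vertex
which has a third edge, if the neighbours stay connected without the vertex
([two_edges]). *)

Set Implicit Arguments.
Unset Strict Implicit.
Unset Printing Implicit Defensive.

Import Order.TTheory GRing.Theory Num.Theory.
Import numFieldNormedType.Exports.

Local Open Scope classical_set_scope.
Local Open Scope ring_scope.

(** * Chains modulo 2 on the square lattice *)

Definition node : Type := (int * int)%type.

(** The edge (true, n) goes up from the node n and (false, n) goes right. The node n
also names the unit square that has it as lower left corner. *)
Definition gedge : Type := (bool * node)%type.

Definition src (e : gedge) : node := e.2.
Definition tgt (e : gedge) : node :=
  if e.1 then (e.2.1, e.2.2 + 1) else (e.2.1 + 1, e.2.2).

Definition mult_parity (l : seq gedge) (e : gedge) : bool :=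
  \big[addb/false]_(e' <- l) (e' == e).

(** The boundary of a chain modulo 2, as a functional: l goes from p to q when
end_parity l g = g p (+) g q for all g. *)
Definition end_parity (l : seq gedge) (g : node -> bool) : bool :=
  \big[addb/false]_(e <- l) (g (src e) (+) g (tgt e)).

(** Parity of the crossings of l with the ray that goes left from the centre of the
square n. For a closed chain this tells inside from outside. *)
Definition side (l : seq gedge) (n : node) : bool :=
  \big[addb/false]_(e <- l) [&& e.1, e.2.1 <= n.1 & e.2.2 == n.2].
Definition ray (n m : node) : bool := (m.1 <= n.1) && (m.2 == n.2).

Lemma mult_parity_cat l1 l2 e : mult_parity (l1 ++ l2) e = mult_parity l1 e (+) mult_parity l2 e.
Proof. by rewrite /mult_parity big_cat. Qed.
Lemma end_parity_cat l1 l2 g : end_parity (l1 ++ l2) g = end_parity l1 g (+) end_parity l2 g.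
Proof. by rewrite /end_parity big_cat. Qed.
Lemma side_cat l1 l2 n : side (l1 ++ l2) n = side l1 n (+) side l2 n.
Proof. by rewrite /side big_cat. Qed.

Lemma mult_parityP l e : mult_parity l e -> e \in l.
Proof.
rewrite /mult_parity; elim: l => [|x l IH]; first by rewrite big_nil.
rewrite big_cons inE; rewrite [e == x]eq_sym; case: (eqVneq x e) => //= _ /IH ->.
Qed.

Lemma side_left l i j : side l (i, j) (+) side l (i - 1, j) = mult_parity l (true, (i, j)).
Proof.
rewrite /side /mult_parity -big_split /=; apply: eq_bigr => -[d [a b]] _ /=.
rewrite !xpair_eqE; case: d => //=.
by case: (eqVneq b j) => _; rewrite ?andbF ?andbT //=; lia.
Qed.

(** The nodes of ray (i, j) lie between the rays of the two squares. An edge with just one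
end among them crosses one of these rays or is the edge between the squares. So the side
of a closed chain changes only across its own edges. *)
Lemma side_down l i j :
  side l (i, j) (+) side l (i, j - 1) = mult_parity l (false, (i, j)) (+) end_parity l (ray (i, j)).
Proof.
rewrite /side /mult_parity /end_parity -!big_split /=; apply: eq_bigr => -[d [a b]] _ /=.
rewrite !xpair_eqE /ray /src /tgt; case: d => //=.
  by case: (a <= i) => //=; lia.
by case: (eqVneq b j) => _; rewrite ?andbF ?andbT //=; lia.
Qed.

(** The indicator of the half-open interval between j1 and j2, in either order. As a sum of two
half lines it is additive under concatenation. *)
Definition span (j1 j2 j : int) : bool := (j < j1) (+) (j < j2).
Definition straight (d : bool) (k j1 j2 : int) : seq gedge :=
  [seq (d, if d then (k, j) else (j, k)) |
     j <- [seq Num.min j1 j2 + n%:Z | n <- iota 0 `|j1 - j2|%N]].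

Lemma straightP d k j1 j2 e : e \in straight d k j1 j2 ->
  exists2 j, span j1 j2 j & e = (d, if d then (k, j) else (j, k)).
Proof.
move=> /mapP[j /mapP[n]]; rewrite mem_iota => /andP[_ hn] -> ->.
eexists; last by []. rewrite /span; lia.
Qed.

Lemma big_addb_straight d k j1 j2 (F : gedge -> bool) (G : int -> bool) :
  (forall j, F (d, if d then (k, j) else (j, k)) = G j (+) G (j + 1)) ->
  \big[addb/false]_(e <- straight d k j1 j2) F e = G j1 (+) G j2.
Proof.
move=> FG; rewrite big_map big_map (eq_bigr _ (fun n _ => FG _)).
have aux (a : int) n : \big[addb/false]_(m <- iota 0 n)
    (G (a + m%:Z) (+) G (a + m%:Z + 1)) = G a (+) G (a + n%:Z).
  elim: n => [|n IH]; first by rewrite big_nil addr0 addbb.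
  rewrite -addn1 iotaD big_cat /= IH big_seq1 add0n.
  have -> : a + n%:Z + 1 = a + (n + 1)%N%:Z by lia.
  by case: (G a); case: (G (a + n%:Z)); case: (G _).
rewrite aux; case: (lerP j1 j2) => h.
  by congr (_ (+) G _); lia.
have -> : j2 + `|j1 - j2|%N%:Z = j1 by lia.
by rewrite addbC.
Qed.

Lemma end_parity_vseg k j1 j2 g : end_parity (straight true k j1 j2) g = g (k, j1) (+) g (k, j2).
Proof. exact: (@big_addb_straight true k j1 j2 _ (fun j => g (k, j))). Qed.
Lemma end_parity_hseg k j1 j2 g : end_parity (straight false k j1 j2) g = g (j1, k) (+) g (j2, k).
Proof. exact: (@big_addb_straight false k j1 j2 _ (fun j => g (j, k))). Qed.

Lemma side_vseg k j1 j2 n :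
  side (straight true k j1 j2) n = (k <= n.1) && span j1 j2 n.2.
Proof.
rewrite /side (@big_addb_straight _ _ _ _ _ (fun j => (k <= n.1) && (n.2 < j))).
  by rewrite /span; case: (k <= n.1).
by move=> j /=; case: (k <= n.1) => //=; lia.
Qed.

Definition square_edges (q : node) : seq gedge :=
  [:: (false, q); (false, (q.1, q.2 + 1)); (true, q); (true, (q.1 + 1, q.2))].

(** The edge e has the squares src e and other_square e on its two sides. *)
Definition other_square (e : gedge) : node :=
  if e.1 then (e.2.1 - 1, e.2.2) else (e.2.1, e.2.2 - 1).

Lemma mult_parity_square q e : mult_parity (square_edges q) e = (q == src e) (+) (q == other_square e).
Proof.
rewrite /mult_parity /square_edges !big_cons big_nil addbF; case: e => d [a b]; case: q => i j.
by rewrite /other_square /src; case: d => /=; rewrite !xpair_eqE /=; lia.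
Qed.

Lemma end_parity_square q g : end_parity (square_edges q) g = false.
Proof.
rewrite /end_parity /square_edges !big_cons big_nil addbF /src /tgt /=; case: q => i j /=.
by case: (g (i, j)); case: (g (i + 1, j)); case: (g (i, j + 1)); case: (g _).
Qed.

Lemma end_parity_squares s g : end_parity (flatten [seq square_edges q | q <- s]) g = false.
Proof.
elim: s => [|q s IH] /=; first by rewrite /end_parity big_nil.
by rewrite -[_ :: _]/(square_edges q ++ _) end_parity_cat end_parity_square IH.
Qed.

Lemma mult_parity_squares s (e : gedge) : uniq s -> mult_parity (flatten [seq square_edges q | q <- s]) e =
  (src e \in s) (+) (other_square e \in s).
Proof.
elim: s => [|q s IH] /=; first by rewrite /mult_parity big_nil.
move=> /andP[qs us]; rewrite -[_ :: _]/(square_edges q ++ _) mult_parity_cat mult_parity_square (IH us).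
rewrite !inE [src e == q]eq_sym [other_square e == q]eq_sym.
have h1 : q == src e -> (src e \in s) = false by move=> /eqP <-; exact: negPf.
have h2 : q == other_square e -> (other_square e \in s) = false by move=> /eqP <-; exact: negPf.
move: h1 h2; case: (q == src e) => [->|_] //; case: (q == other_square e) => [->|_] //=;
  by case: (_ \in _) => //; case: (_ \in _).
Qed.

(** Equal edges cancel in pairs, so a chain whose edges avoid a set modulo 2 is as good
as one whose edges all avoid it. *)
Lemma end_parity_odd l g : (forall e, mult_parity l e -> g (src e) = g (tgt e)) -> end_parity l g = false.
Proof.
move=> H; pose f e := g (src e) (+) g (tgt e).
have Hf e : mult_parity l e -> f e = false by move=> /H; rewrite /f => ->; rewrite addbb.
suff aux n : forall l, (size l <= n)%N -> (forall e, mult_parity l e -> f e = false) ->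
   \big[addb/false]_(e <- l) f e = false by exact: (aux (size l)).
elim: n => [|n IH] {H Hf} l0 hs Hf.
  by case: l0 hs {Hf} => //; rewrite big_nil.
case: l0 hs Hf => [|x l0] hs Hf; first by rewrite big_nil.
have [xl|xl] := boolP (x \in l0); last first.
  rewrite big_cons (Hf x) ?addFb.
    apply: IH => // e me; apply: Hf; rewrite /mult_parity big_cons -/(mult_parity l0 e) me.
    by case: eqVneq => // xe; move: (mult_parityP me); rewrite -xe (negPf xl).
  rewrite /mult_parity big_cons eqxx -/(mult_parity l0 x).
  by case E: (mult_parity l0 x) => //; rewrite (mult_parityP E) in xl.
have pl := perm_to_rem xl.
have mE e : mult_parity (x :: l0) e = mult_parity (rem x l0) e.
  rewrite /mult_parity big_cons (perm_big _ pl) /= big_cons addbA.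
  by case: (_ == _).
rewrite big_cons (perm_big _ pl) /= big_cons addbA addbb addFb.
apply: IH => [|e]; last by rewrite -mE; apply: Hf.
by rewrite size_rem //; move: hs; rewrite ltnS; apply: leq_trans (leq_pred _).
Qed.

Lemma int_const (f : int -> bool) (P : int -> Prop) :
  (forall i, P i -> P (i - 1) -> f i = f (i - 1)) ->
  (forall a b i, P a -> P b -> a <= i <= b -> P i) ->
  forall a b, P a -> P b -> f a = f b.
Proof.
move=> Hs Hc.
have aux n : forall a, P a -> P (a + n%:Z) -> f a = f (a + n%:Z).
  elim: n => [|n IH] a Pa Pn; first by rewrite addr0.
  have Pn' : P (a + n%:Z) by apply: Hc Pa Pn _; lia.
  rewrite (IH a Pa Pn'); have E : a + n.+1%:Z - 1 = a + n%:Z by lia.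
  by rewrite -E -Hs // E.
move=> a b Pa Pb; have [h|h] := lerP a b.
  by have E : b = a + `|b - a|%N%:Z; [lia|rewrite E; apply: aux => //; rewrite -E].
have E : a = b + `|a - b|%N%:Z by lia.
by rewrite [in LHS]E; symmetry; apply: aux => //; rewrite -E.
Qed.

Definition int_range (M : nat) : seq int := [seq n%:Z - M%:Z | n <- iota 0 (M + M + 1)].
Lemma mem_int_range M i : (i \in int_range M) = (- M%:Z <= i <= M%:Z).
Proof.
apply/mapP/idP => [[n]|h]; first by rewrite mem_iota => h ->; lia.
by exists (absz (i + M%:Z)); [rewrite mem_iota; lia|lia].
Qed.
Lemma uniq_int_range M : uniq (int_range M).
Proof. by rewrite map_inj_uniq ?iota_uniq // => a b; lia. Qed.
Definition int_box M : seq node := [seq (i, j) | i <- int_range M, j <- int_range M].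
Lemma mem_int_box M (q : node) :
  (q \in int_box M) = (- M%:Z <= q.1 <= M%:Z) && (- M%:Z <= q.2 <= M%:Z).
Proof.
rewrite -!mem_int_range; case: q => i j /=; apply/allpairsP/andP => [[[a b]]|[ha hb]].
  by case=> /= ha hb [-> ->].
by exists (i, j).
Qed.
Lemma uniq_int_box M : uniq (int_box M).
Proof. by apply: allpairs_uniq; rewrite ?uniq_int_range // => -[a b] [c d]. Qed.

(** * Points in the same component of a complement *)

Section Topology.

(** Connectedness is used throughout in this form: the points of A with P form an open
and closed part of A. *)
Lemma clopen_ind (R : realType) (T : pseudoMetricType R) (A : set T) (P : T -> Prop) :
  connected A ->
  (forall x, A x -> exists2 e, 0 < e & forall y, ball x e y -> A y -> (P x <-> P y)) ->
  forall a b, A a -> A b -> P a -> P b.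
Proof.
move=> cA loc a b Aa Ab Pa.
suff : A `&` P = A by rewrite eqEsubset => -[_ /(_ b Ab)[]].
have loc' (Q : set T) : (forall x y, (P x <-> P y) -> (Q x <-> Q y)) ->
    forall x, A x -> Q x -> interior [set y | A y -> Q y] x.
  move=> QP x Ax Qx; have [e e0 He] := loc x Ax.
  apply/(@nbhs_ballP R); exists e => //= y xy Ay.
  by apply: (QP x y (He y xy Ay)).1.
apply: cA; first by exists a.
- exists (interior [set y | A y -> P y]); first exact: open_interior.
  apply/seteqP; split=> [x [Ax Px]|x [Ax /interior_subset Px]]; split=> //.
    by apply: (loc' P) => // y z; tauto.
  exact: Px.
- exists (~` interior [set y | A y -> ~ P y]).
    by apply: open_closedC; exact: open_interior.
  apply/seteqP; split=> [x [Ax Px]|x [Ax nPx]]; split=> //.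
    by move=> /interior_subset; apply.
  apply: contrapT => Px; apply: nPx; apply: (loc' (fun y => ~ P y)) => // y z.
  by tauto.
Qed.

Variable R : realType.
Implicit Types (K : set (R * R)) (p q x y : R * R).

Lemma ballE x (e : R) y : ball x e y <-> `|x.1 - y.1| < e /\ `|x.2 - y.2| < e.
Proof. by []. Qed.

(** As a set, joined K p is the face of p; as a relation it says that K does not
separate p from q. *)
Definition joined K p q := connected_component (~` K) p q.

Lemma joined_out K p q : joined K p q -> ~ K p /\ ~ K q.
Proof.
move=> s; split; last exact: (connected_component_sub s).
by apply: contrapT => /contrapT Kp; move: s; rewrite /joined connected_component_out.
Qed.
Lemma joined_refl K p : ~ K p -> joined K p p.
Proof. exact: connected_component_refl. Qed.
Lemma joined_sym K p q : joined K p q -> joined K q p.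
Proof. exact: connected_component_sym. Qed.
Lemma joined_trans K q p r : joined K p q -> joined K q r -> joined K p r.
Proof. exact: connected_component_trans. Qed.
Lemma joined_conn K S p q : connected S -> (forall z, S z -> ~ K z) -> S p -> S q ->
  joined K p q.
Proof. by move=> cS SK Sp Sq; apply: (connected_component_max Sp SK cS). Qed.
Lemma joined_sub K K' p q : K' `<=` K -> joined K p q -> joined K' p q.
Proof.
move=> KK s; apply: (@joined_conn _ (connected_component (~` K) p)) => //.
- exact: component_connected.
- by move=> z /connected_component_sub h /KK.
- by apply: connected_component_refl; have [] := joined_out s.
Qed.

Lemma joined_line K p q :
  (forall t : R, 0 <= t <= 1 -> ~ K (p.1 + t * (q.1 - p.1), p.2 + t * (q.2 - p.2))) ->
  joined K p q.
Proof.
move=> H; pose f (t : R) := (p.1 + t * (q.1 - p.1), p.2 + t * (q.2 - p.2)).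
apply: (@joined_conn _ (f @` `[0, 1])).
- apply: connected_continuous_connected; first exact: segment_connected.
  have lin (a b t : R) : (fun t => a + t * b) @ t --> a + t * b.
    by apply: cvgD; [exact: cvg_cst|apply: cvgMr_tmp; exact: cvg_id].
  by apply: continuous_subspaceT => t; exact: (cvg_pair (lin _ _ _) (lin _ _ _)).
- by move=> _ [t /= ht <-]; apply: H; rewrite in_itv in ht.
- by exists 0; rewrite /= ?in_itv /= ?lexx ?ler01 // /f !mul0r !addr0 -surjective_pairing.
- by exists 1; rewrite /= ?in_itv /= ?lexx ?ler01 // /f !mul1r ![_ + (_ - _)]addrC !subrK -surjective_pairing.
Qed.

(** Balls for the maximum norm are squares, hence convex. *)
Lemma joined_ball K x (e : R) y z : (forall w, ball x e w -> ~ K w) ->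
  ball x e y -> ball x e z -> joined K y z.
Proof.
move=> H /ballE[y1 y2] /ballE[z1 z2]; apply: joined_line => t /andP[t0 t1]; apply: H.
have aux (A B : R) : 0 < A -> 0 < B -> 0 < A + t * (B - A) by move=> *; nra.
apply/ballE => /=; move: y1 y2 z1 z2; rewrite !ltr_norml.
move=> /andP[a1 a2] /andP[b1 b2] /andP[c1 c2] /andP[d1 d2].
have := aux (x.1 - y.1 + e) (x.1 - z.1 + e); have := aux (y.1 - x.1 + e) (z.1 - x.1 + e).
have := aux (x.2 - y.2 + e) (x.2 - z.2 + e); have := aux (y.2 - x.2 + e) (z.2 - x.2 + e).
by move=> h1 h2 h3 h4; split; apply/andP; split; lra.
Qed.

Lemma closed_ball_out K x : closed K -> ~ K x ->
  exists2 e : R, 0 < e & forall y, ball x e y -> ~ K y.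
Proof.
move=> cK Kx; have oK : open (~` K) by exact: closed_openC.
have /(@nbhs_ballP R)[e /= e0 He] : nbhs x (~` K) by exact: open_nbhs_nbhs.
by exists e.
Qed.

Lemma joined_near K x : closed K -> ~ K x ->
  exists2 e : R, 0 < e & forall y, ball x e y -> joined K x y.
Proof.
move=> cK /(closed_ball_out cK)[e e0 He]; exists e => // y xy.
by apply: (joined_ball He) => //; exact: ballxx.
Qed.

End Topology.

(** * Approximation by fine lattices *)

Section GridPlane.
Variable R : realType.
Implicit Types (K : set (R * R)) (p q x y : R * R) (h e : R) (n m : node).

Definition grid_pt h n : R * R := (h * n.1%:~R, h * n.2%:~R).
Definition grid_floor h x : node := (Num.floor (x.1 / h), Num.floor (x.2 / h)).

Lemma floor_grid h (r : R) : 0 < h ->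
  h * (Num.floor (r / h))%:~R <= r < h * (Num.floor (r / h))%:~R + h.
Proof.
move=> h0; have /andP[l u] := floor_itv (r / h).
move: l u; rewrite ler_pdivlMr // ltr_pdivrMr // intrD1 => l u.
by apply/andP; split; lra.
Qed.

Lemma grid_floorP h x : 0 < h ->
  ((grid_pt h (grid_floor h x)).1 <= x.1 < (grid_pt h (grid_floor h x)).1 + h) /\
  ((grid_pt h (grid_floor h x)).2 <= x.2 < (grid_pt h (grid_floor h x)).2 + h).
Proof. by move=> h0; split; exact: floor_grid. Qed.

Lemma grid_floor_ball h x y e : 0 < h -> ball x e y -> ball x (e + h) (grid_pt h (grid_floor h y)).
Proof.
move=> h0 /ballE[]; have [] := grid_floorP y h0; rewrite !ltr_norml.
move=> /andP[a1 a2] /andP[b1 b2] /andP[c1 c2] /andP[d1 d2].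
by apply/ballE; rewrite !ltr_norml; split; apply/andP; split; lra.
Qed.

(** The margin e keeps the side of l constant on a square of fixed size around each point
of K, however small the mesh h is. *)
Definition avoids h e K (l : seq gedge) :=
  forall u, u \in l -> forall x, K x -> ~ ball x e (grid_pt h (src u)).

Lemma avoids_cat h e K l1 l2 : avoids h e K l1 -> avoids h e K l2 -> avoids h e K (l1 ++ l2).
Proof. by move=> c1 c2 u; rewrite mem_cat => /orP[/c1|/c2]. Qed.
Lemma avoids_le h e e' K l : e' <= e -> avoids h e K l -> avoids h e' K l.
Proof. by move=> ee c u ul x Kx /(le_ball ee); exact: c. Qed.
Lemma avoids_sub h e K K' l : K' `<=` K -> avoids h e K l -> avoids h e K' l.
Proof. by move=> KK c u ul x /KK; exact: c. Qed.

(** The chains for different meshes are unrelated; only the margin is uniform. *)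
Definition linked K p q := exists2 e, 0 < e & exists2 h0, 0 < h0 &
  forall h, 0 < h < h0 -> exists2 l, avoids h e K l &
    forall g, end_parity l g = g (grid_floor h p) (+) g (grid_floor h q).

Lemma linked_sym K p q : linked K p q -> linked K q p.
Proof.
move=> [e e0 [h0 h00 H]]; exists e => //; exists h0 => // h /H[l cl bl].
by exists l => // g; rewrite bl addbC.
Qed.
Lemma linked_trans K p q r : linked K p q -> linked K q r -> linked K p r.
Proof.
move=> [e e0 [h0 h00 H]] [e' e'0 [h0' h00' H']].
exists (Num.min e e'); first by rewrite lt_min e0.
exists (Num.min h0 h0'); first by rewrite lt_min h00.
move=> h /andP[hh]; rewrite lt_min => /andP[hh1 hh2].
have [|l cl bl] := H h; first by rewrite hh.
have [|l' cl' bl'] := H' h; first by rewrite hh.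
exists (l ++ l') => [|g]; last by rewrite end_parity_cat bl bl' addbA addbK.
by apply: avoids_cat; [apply: avoids_le cl|apply: avoids_le cl']; rewrite ge_min lexx ?orbT.
Qed.

Lemma grid_le h (a b : int) : 0 < h -> a <= b -> h * a%:~R <= h * b%:~R.
Proof. by move=> h0 ab; rewrite ler_pM2l // ler_int. Qed.
Lemma grid_leE h (a b : int) : 0 < h -> (h * a%:~R <= h * b%:~R) = (a <= b).
Proof. by move=> h0; rewrite ler_pM2l // ler_int. Qed.

Lemma span_ball h (c e : R) (j1 j2 j : int) : 0 < h -> span j1 j2 j ->
  `|c - h * j1%:~R| < e -> `|c - h * j2%:~R| < e -> `|c - h * j%:~R| < e.
Proof.
move=> h0 s; rewrite !ltr_norml => /andP[a1 a2] /andP[b1 b2].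
have [[u v]|[u v]] : (j1 <= j /\ j <= j2) \/ (j2 <= j /\ j <= j1).
  by move: s; rewrite /span; lia.
all: have {}u := grid_le h0 u; have {}v := grid_le h0 v.
all: by apply/andP; split; lra.
Qed.

Lemma ball_avoids K x e1 e : (forall y, ball x e1 y -> ~ K y) ->
  forall z, ball x (e1 - e) z -> forall k, K k -> ~ ball k e z.
Proof.
move=> H z xz k Kk kz; apply: (H k) => //.
by rewrite -(subrK e e1); apply: ball_triangle xz _; exact: ball_sym.
Qed.

Lemma avoids_vseg K x e1 e h (k j1 j2 : int) : 0 < h -> (forall y, ball x e1 y -> ~ K y) ->
  ball x (e1 - e) (grid_pt h (k, j1)) -> ball x (e1 - e) (grid_pt h (k, j2)) ->
  avoids h e K (straight true k j1 j2).
Proof.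
move=> h0 H /ballE[a1 a2] /ballE[b1 b2] u /straightP[j s ->] z Kz.
apply: (ball_avoids H) => //; apply/ballE; split => //=.
exact: span_ball s a2 b2.
Qed.

Lemma avoids_hseg K x e1 e h (k j1 j2 : int) : 0 < h -> (forall y, ball x e1 y -> ~ K y) ->
  ball x (e1 - e) (grid_pt h (j1, k)) -> ball x (e1 - e) (grid_pt h (j2, k)) ->
  avoids h e K (straight false k j1 j2).
Proof.
move=> h0 H /ballE[a1 a2] /ballE[b1 b2] u /straightP[j s ->] z Kz.
apply: (ball_avoids H) => //; apply/ballE; split => //=.
exact: span_ball s a1 b1.
Qed.

(** The chain is L-shaped and stays close to x. *)
Lemma linked_near K x : closed K -> ~ K x ->
  exists2 e : R, 0 < e & forall y, ball x e y -> linked K x y.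
Proof.
move=> cK /(closed_ball_out cK)[e e0 He]; exists (e / 4) => [|y xy]; first by lra.
exists (e / 4); first by lra.
exists (e / 4) => [|h /andP[h0 hlt]]; first by lra.
exists (straight false (grid_floor h x).2 (grid_floor h x).1 (grid_floor h y).1 ++
        straight true (grid_floor h y).1 (grid_floor h x).2 (grid_floor h y).2); last first.
  by move=> g; rewrite end_parity_cat end_parity_vseg end_parity_hseg -!surjective_pairing addbA addbK.
have bx : ball x (e - e / 4) (grid_pt h (grid_floor h x)).
  by apply: (@le_ball _ _ _ (e/4 + h)); [lra|apply: grid_floor_ball => //; apply: ballxx; lra].
have bY : ball x (e - e / 4) (grid_pt h (grid_floor h y)).
  by apply: (@le_ball _ _ _ (e/4 + h)); [lra|exact: grid_floor_ball].
move/ballE: (bx) => [bx1 bx2]; move/ballE: (bY) => [by1 by2].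
apply: avoids_cat.
- by apply: (avoids_hseg h0 He) => //.
- by apply: (avoids_vseg h0 He).
Qed.

Lemma joined_linked K p q : closed K -> joined K p q -> linked K p q.
Proof.
move=> cK s; have [Kp Kq] := joined_out s.
apply: (@clopen_ind R _ (connected_component (~` K) p) (linked K p) _ _ p q) => //.
- exact: component_connected.
- move=> x /connected_component_sub Kx; have [e e0 He] := linked_near cK Kx.
  exists e => // y /He xy _; split => h; apply: linked_trans h _ => //.
  exact: linked_sym.
- exact: connected_component_refl.
- by have [e e0 He] := linked_near cK Kp; apply: He; exact: ballxx.
Qed.

(** All squares near x are reached from each other by steps across edges that do not
belong to l. *)
Lemma side_const h l x e : 0 < h ->
  (forall u, u \in l -> ~ ball x e (grid_pt h (src u))) ->
  (forall i j : int, `|x.2 - h * j%:~R| < e -> end_parity l (ray (i, j)) = false) ->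
  forall n m, ball x e (grid_pt h n) -> ball x e (grid_pt h m) -> side l n = side l m.
Proof.
move=> h0 Hl Hr [n1 n2] [m1 m2] /ballE[/= a1 a2] /ballE[/= b1 b2].
have conv (c : R) (a b i : int) : `|c - h * a%:~R| < e -> `|c - h * b%:~R| < e ->
    a <= i <= b -> `|c - h * i%:~R| < e.
  move=> ha hb /andP[/(grid_le h0) + /(grid_le h0)]; move: ha hb; rewrite !ltr_norml => /andP[? ?] /andP[? ?] ? ?.
  by apply/andP; split; lra.
transitivity (side l (m1, n2)).
  apply: (@int_const (fun i => side l (i, n2)) (fun i => `|x.1 - h * i%:~R| < e)) => //.
  - move=> i Pi _; have := side_left l i n2; case: (boolP (mult_parity _ _)) => [/mult_parityP|_].
      by move=> /Hl[]; apply/ballE.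
    by case: (side _ _); case: (side _ _).
  - exact: conv.
apply: (@int_const (fun j => side l (m1, j)) (fun i => `|x.2 - h * i%:~R| < e)) => //.
- move=> j Pj _; have := side_down l m1 j; rewrite (Hr _ _ Pj) addbF.
  case: (boolP (mult_parity _ _)) => [/mult_parityP|_]; first by move=> /Hl[]; apply/ballE.
  by case: (side _ _); case: (side _ _).
- exact: conv.
Qed.

Definition meets h K n := exists2 x, K x &
  (h * n.1%:~R <= x.1 <= h * n.1%:~R + h) /\ (h * n.2%:~R <= x.2 <= h * n.2%:~R + h).

(** Alexander's lemma. The closed chain k1 ++ k2 is the boundary of the squares on one
of its sides. Adding to k1 the boundary of those among them that do not meet K1 keeps it
off K1, and modulo 2 turns it into k2 up to boundaries of squares that meet K1. *)
Lemma alexander K1 K2 h e p q k1 k2 (B : R) b : 0 < h -> h < e ->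
  (forall x, (K1 `|` K2) x -> `|x.1| <= B /\ `|x.2| <= B) ->
  avoids h e K1 k1 -> avoids h e K2 k2 ->
  (forall g, end_parity k1 g = g (grid_floor h p) (+) g (grid_floor h q)) ->
  ~ (K1 `|` K2) (grid_pt h (grid_floor h p)) ->
  (forall n, meets h K1 n -> meets h K2 n -> side (k1 ++ k2) n = b) ->
  (forall g, end_parity k2 g = g (grid_floor h p) (+) g (grid_floor h q)) ->
  joined (K1 `|` K2) (grid_pt h (grid_floor h p)) (grid_pt h (grid_floor h q)).
Proof.
move=> h0 he KB c1 c2 b1 outp Hb b2; set K := K1 `|` K2.
have kE (u : gedge) : side (k1 ++ k2) (src u) (+) side (k1 ++ k2) (other_square u) =
    mult_parity k1 u (+) mult_parity k2 u.
  rewrite -mult_parity_cat; case: u => -[] [i j]; rewrite /src /other_square /=.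
    exact: side_left.
  by rewrite side_down end_parity_cat b1 b2 addbb addbF.
(* The squares meeting K1 all have the label b, so no boundary edge of A meets K1. Where A
   and the side differ, a square meets K1 and has a side other than b, so it misses K2. *)
pose A n := if `[< meets h K1 n >] then b else side (k1 ++ k2) n.
(* All squares meeting K lie in the box of size M, so cutting A down to this box does not
   matter for the edges that meet K. *)
pose M := (Num.truncn ((B + h) / h)).+2.
have MP (r : R) (i : int) : `|r| <= B -> h * i%:~R <= r <= h * i%:~R + h ->
    - M%:Z <= i <= M%:Z.
  move=> rB /andP[i1 i2].
  have hM : B + h < h * (M%:Z - 1)%:~R.
    have -> : M%:Z - 1 = (Num.truncn ((B + h) / h)).+1%:Z by rewrite /M; lia.
    have /truncn_itv/andP[_] : 0 <= (B + h) / h.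
      by apply: divr_ge0; [have := normr_ge0 r; lra|exact: ltW].
    by rewrite ltr_pdivrMr // mulrC.
  move: rB hM; rewrite ler_norml intrB mulrBr mulr1 => /andP[r1 r2] hM.
  by apply/andP; split; rewrite -(grid_leE _ _ h0) ?intrN; lra.
pose S := [seq n <- int_box M | A n].
pose L := k1 ++ flatten [seq square_edges n | n <- S].
have uS : uniq S by rewrite filter_uniq // uniq_int_box.
have mS n : meets h K n -> (n \in S) = A n.
  move=> [x Kx [x1 x2]]; rewrite mem_filter mem_int_box.
  by have [B1 B2] := KB x Kx; rewrite (MP _ _ B1 x1) (MP _ _ B2 x2) !andbT.
pose on u x := if u.1 then x.1 = h * u.2.1%:~R /\ h * u.2.2%:~R <= x.2 <= h * u.2.2%:~R + h
   else x.2 = h * u.2.2%:~R /\ h * u.2.1%:~R <= x.1 <= h * u.2.1%:~R + h.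
have on_src (u : gedge) K' x : K' x -> on u x -> meets h K' (src u).
  move=> Kx ox; exists x => //; case: u ox => -[] [i j]; rewrite /on /src /= => -[-> H];
  by split=> //; apply/andP; split; lra.
have on_bef (u : gedge) K' x : K' x -> on u x -> meets h K' (other_square u).
  move=> Kx ox; exists x => //; case: u ox => -[] [i j]; rewrite /on /other_square /= => -[-> H];
  by split=> //; rewrite intrB mulrBr mulr1; apply/andP; split; lra.
have on_out (u : gedge) K' k x : avoids h e K' k -> K' x -> on u x -> mult_parity k u = false.
  move=> cl Kx ox; apply/negP => /mult_parityP /cl /(_ x Kx); apply.
  apply/ballE; rewrite !ltr_norml.
  by case: u ox => -[] [i j]; rewrite /on /src /= => -[-> /andP[? ?]]; split; apply/andP; split; lra.
have odd_out u x : mult_parity L u -> on u x -> ~ K x.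
  move=> mLu ox Kx; move: mLu; rewrite mult_parity_cat mult_parity_squares //.
  rewrite (mS _ (on_src _ _ _ Kx ox)) (mS _ (on_bef _ _ _ Kx ox)).
  case: Kx => Kx.
    rewrite (on_out _ _ _ _ c1 Kx ox) /A.
    have /asboolP -> := on_src _ _ _ Kx ox.
    by have /asboolP -> := on_bef _ _ _ Kx ox; rewrite addbb.
  have AE n : meets h K2 n -> A n = side (k1 ++ k2) n.
    by rewrite /A; case: asboolP => // m1 m2; rewrite Hb.
  rewrite (AE _ (on_src _ _ _ Kx ox)) (AE _ (on_bef _ _ _ Kx ox)) kE.
  by rewrite (on_out _ _ _ _ c2 Kx ox) addbF addbb.
pose g n := `[< joined K (grid_pt h (grid_floor h p)) (grid_pt h n) >].
have gL : end_parity L g = false.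
  apply: end_parity_odd => u mu.
  have s : joined K (grid_pt h (src u)) (grid_pt h (tgt u)).
    apply: joined_line => t /andP[t0 t1]; apply: odd_out mu _.
    case: u => -[] [i j]; rewrite /on /src /tgt /= intrD !mulrDr mulr1; split; try lra.
      by apply/andP; split; nra.
    by apply/andP; split; nra.
  by apply/asboolP/asboolP => s'; apply: joined_trans s' _ => //; exact: joined_sym.
move: gL; rewrite end_parity_cat end_parity_squares addbF b1 /g.
rewrite (asboolT (joined_refl outp)) /= => /negbFE; exact: asboolW.
Qed.
End GridPlane.

(** * Janiszewski's theorem *)

Section Janiszewski.
Variable R : realType.
Implicit Types (K : set (R * R)) (p q x y : R * R) (h e : R) (n m : node).

Lemma compact_bound K : compact K -> exists B : R, forall x, K x -> `|x.1| <= B /\ `|x.2| <= B.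
Proof.
move=> /compact_bounded[M [_ HM]]; exists (M + 1) => x Kx.
have /(_ x Kx) := HM (M + 1) (ltr_pwDr ltr01 (lexx _)).
by rewrite /= {1}/Num.norm /= ge_max => /andP.
Qed.

Lemma ball0R (r h : R) : ball (0 : R) r h <-> `|h| < r.
Proof. by rewrite -ball_normE /ball_ /= sub0r normrN. Qed.

(** Near a point of K1 that is not in K2, small squares miss K2; compactness of K1 makes
this uniform. *)
Lemma fine_squares K1 K2 e : compact K1 -> closed K2 -> 0 < e ->
  exists2 h1, 0 < h1 & forall h, 0 < h < h1 -> forall n, meets h K1 n -> meets h K2 n ->
    exists2 x, K1 x /\ K2 x & ball x e (grid_pt h n).
Proof.
move=> cK1 cK2 e0.
pose P h (x : R * R) := 0 < h -> forall n,
  (h * n.1%:~R <= x.1 <= h * n.1%:~R + h) /\ (h * n.2%:~R <= x.2 <= h * n.2%:~R + h) ->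
  meets h K2 n -> exists2 x, K1 x /\ K2 x & ball x e (grid_pt h n).
have /compact_near_coveringP NC := cK1.
have [|r /= r0 Hr] := (nbhs_ballP _ _).1 (NC R (nbhs (0 : R)) P _ _).
  move=> x K1x; have [K2x|K2x] := pselect (K2 x).
    exists (ball x (e / 2), ball (0 : R) (e / 2)).
      by split; apply: nbhsx_ballx; lra.
    move=> [y h] /= [/ballE[/= y1 y2] /= hh] h0 n [/andP[? ?] /andP[? ?]] _; exists x => //.
    move: hh => /ball0R /ltr_normlW hh.
    by move: y1 y2; rewrite !ltr_norml => /andP[? ?] /andP[? ?]; apply/ballE;
      rewrite !ltr_norml; split; apply/andP; split => /=; lra.
  have [r r0 Hr] := closed_ball_out cK2 K2x.
  exists (ball x (r / 2), ball (0 : R) (r / 2)).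
    by split; apply: nbhsx_ballx; lra.
  move=> [y h] /= [/ballE[/= y1 y2] /= hh] h0 n [/andP[? ?] /andP[? ?]] [z K2z [/andP[? ?] /andP[? ?]]].
  exfalso; apply: (Hr z) => //.
  move: hh => /ball0R /ltr_normlW hh.
  by move: y1 y2; rewrite !ltr_norml => /andP[? ?] /andP[? ?]; apply/ballE;
    rewrite !ltr_norml; split; apply/andP; split => /=; lra.
exists r => // h /andP[h0 hr] n [x K1x xn] m2.
have : K1 `<=` P h.
  by apply: Hr; apply/ball0R; rewrite gtr0_norm.
by move=> /(_ x K1x h0 n xn m2).
Qed.

(** For a small mesh the nodes next to p and q lie in the faces of p and q. *)
Lemma fine_alexander K1 K2 p q e : compact K1 -> compact K2 -> 0 < e ->
  ~ (K1 `|` K2) p -> ~ (K1 `|` K2) q ->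
  exists2 h1, 0 < h1 & forall h, 0 < h < h1 -> forall k1 k2 b,
    avoids h e K1 k1 -> avoids h e K2 k2 ->
    (forall g, end_parity k1 g = g (grid_floor h p) (+) g (grid_floor h q)) ->
    (forall g, end_parity k2 g = g (grid_floor h p) (+) g (grid_floor h q)) ->
    (forall x, K1 x -> K2 x -> side (k1 ++ k2) (grid_floor h x) = b) ->
    joined (K1 `|` K2) p q.
Proof.
move=> cK1 cK2 e0 Kp Kq; set K := K1 `|` K2.
have cK : compact K by exact: compactU.
have clK : closed K by apply: compact_closed => //; exact: norm_hausdorff.
have clK2 : closed K2 by apply: compact_closed => //; exact: norm_hausdorff.
have [B HB] := compact_bound cK.
have [ep ep0 Hp] := joined_near clK Kp; have [eq eq0 Hq] := joined_near clK Kq.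
have [h1 h10 Hh] := fine_squares cK1 clK2 e0.
exists (Num.min (Num.min h1 e) (Num.min ep eq)); first by rewrite !lt_min h10 e0 ep0.
move=> h /andP[h0]; rewrite !lt_min => /andP[/andP[hh1 he] /andP[hep heq]].
have nb r x : h < r -> ball x r (grid_pt h (grid_floor h x)).
  move=> hr; have := @grid_floor_ball R h x x (r - h) h0; rewrite subrK; apply.
  by apply: ballxx; lra.
move=> k1 k2 b c1 c2 b1 b2 Hb.
apply: joined_trans (Hp _ (nb _ _ hep)) _.
apply: joined_trans _ (joined_sym (Hq _ (nb _ _ heq))).
apply: (alexander (b := b) h0 he HB c1 c2) => //.
  by have [] := joined_out (Hp _ (nb _ _ hep)).
move=> n m1 m2; have [|x [K1x K2x] xn] := Hh h _ n m1 m2; first by rewrite h0.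
rewrite -(Hb x K1x K2x); apply: (@side_const _ h _ x e) => //; last exact: nb.
- by move=> u; rewrite mem_cat => /orP[/c1|/c2]; exact.
- by move=> i j _; rewrite end_parity_cat b1 b2 addbb.
Qed.

(** An open chain is admitted if its ends are on rows that do not come near K. *)
Lemma side_connected K l e h a b : connected K -> 0 < h -> h < e -> avoids h e K l ->
  (forall x, K x -> forall i j : int, `|x.2 - h * j%:~R| < e -> end_parity l (ray (i, j)) = false) ->
  K a -> K b -> side l (grid_floor h a) = side l (grid_floor h b).
Proof.
move=> cK h0 he cl Hr Ka Kb.
suff -> : side l (grid_floor h b) = side l (grid_floor h a) by [].
apply: (@clopen_ind R _ K (fun x => side l (grid_floor h x) = side l (grid_floor h a)) cK _ a b) => //.
move=> x Kx; exists (e - h) => [|y xy _]; first by lra.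
suff -> : side l (grid_floor h y) = side l (grid_floor h x) by [].
apply: (@side_const _ h _ x e) => //.
- by move=> u ul; exact: cl.
- exact: Hr.
- by have := grid_floor_ball h0 xy; rewrite subrK.
- have := @grid_floor_ball R h x x (e - h) h0; rewrite subrK; apply.
  by apply: ballxx; lra.
Qed.

(** The common part is connected and avoided by the closed chain made of a connection off
K1 and one off K2, so it lies on one side and Alexander's lemma applies. *)
Lemma janiszewski K1 K2 p q : compact K1 -> compact K2 -> connected (K1 `&` K2) ->
  joined K1 p q -> joined K2 p q -> joined (K1 `|` K2) p q.
Proof.
move=> cK1 cK2 cN s1 s2.
have [p1 q1] := joined_out s1; have [p2 q2] := joined_out s2.
have Kp : ~ (K1 `|` K2) p by case.
have Kq : ~ (K1 `|` K2) q by case.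
have cl K : compact K -> closed K by apply: compact_closed; exact: norm_hausdorff.
have [e1 e10 [h1 h10 H1]] := joined_linked (cl _ cK1) s1.
have [e2 e20 [h2 h20 H2]] := joined_linked (cl _ cK2) s2.
pose e := Num.min e1 e2.
have e0 : 0 < e by rewrite lt_min e10.
have [h3 h30 H3] := fine_alexander cK1 cK2 e0 Kp Kq.
pose h := Num.min (Num.min h1 h2) (Num.min h3 e) / 2.
have M0 : 0 < Num.min (Num.min h1 h2) (Num.min h3 e) by rewrite !lt_min h10 h20 h30 e10 e20.
have h0 : 0 < h by rewrite /h; lra.
have : h < Num.min (Num.min h1 h2) (Num.min h3 e) by rewrite /h; lra.
rewrite !lt_min => /andP[/andP[hh1 hh2] /andP[hh3 hee]].
have he : h < e by rewrite lt_min.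
have [|k1 c1 b1] := H1 h; first by rewrite h0.
have [|k2 c2 b2] := H2 h; first by rewrite h0.
have c1' : avoids h e K1 k1 by apply: avoids_le c1; rewrite ge_min lexx.
have c2' : avoids h e K2 k2 by apply: avoids_le c2; rewrite ge_min lexx orbT.
have [[x0 [N1 N2]]|N0] := pselect (exists x, (K1 `&` K2) x); last first.
  apply: (H3 h _ k1 k2 false) => //; first by rewrite h0.
  by move=> x K1x K2x; exfalso; apply: N0; exists x.
apply: (H3 h _ k1 k2 (side (k1 ++ k2) (grid_floor h x0))) => //; first by rewrite h0.
move=> x K1x K2x; apply: (side_connected cN h0 he) => //.
- by apply: avoids_cat; [apply: avoids_sub c1' => ? []|apply: avoids_sub c2' => ? []].
- by move=> _ _ i j _; rewrite end_parity_cat b1 b2 addbb.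
Qed.

(** Now the closed chain for two of the points may separate a from b. But modulo 2 the
chain for p1, p3 is the sum of those for p1, p2 and p2, p3, so at least one of the three
does not. *)
Lemma janiszewski2 K1 K2 a b p1 p2 p3 : compact K1 -> compact K2 ->
  (forall x, K1 x -> K2 x -> x = a \/ x = b) ->
  joined K1 p1 p2 -> joined K1 p2 p3 -> joined K2 p1 p2 -> joined K2 p2 p3 ->
  [\/ joined (K1 `|` K2) p1 p2, joined (K1 `|` K2) p2 p3 | joined (K1 `|` K2) p1 p3].
Proof.
move=> cK1 cK2 N s12 s23 t12 t23.
have [p11 p12] := joined_out s12; have [p21 p22] := joined_out t12.
have [_ p13] := joined_out s23; have [_ p23] := joined_out t23.
have K1p : ~ (K1 `|` K2) p1 by case.
have K2p : ~ (K1 `|` K2) p2 by case.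
have K3p : ~ (K1 `|` K2) p3 by case.
have cl K : compact K -> closed K by apply: compact_closed; exact: norm_hausdorff.
have [e1 e10 [h1 h10 H1]] := joined_linked (cl _ cK1) s12.
have [e2 e20 [h2 h20 H2]] := joined_linked (cl _ cK1) s23.
have [e3 e30 [h3 h30 H3]] := joined_linked (cl _ cK2) t12.
have [e4 e40 [h4 h40 H4]] := joined_linked (cl _ cK2) t23.
pose e := Num.min (Num.min e1 e2) (Num.min e3 e4).
have e0 : 0 < e by rewrite !lt_min e10 e20 e30 e40.
have [h5 h50 H5] := fine_alexander cK1 cK2 e0 K1p K2p.
have [h6 h60 H6] := fine_alexander cK1 cK2 e0 K2p K3p.
have [h7 h70 H7] := fine_alexander cK1 cK2 e0 K1p K3p.
pose M := Num.min (Num.min (Num.min h1 h2) (Num.min h3 h4)) (Num.min h5 (Num.min h6 h7)).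
have M0 : 0 < M by rewrite !lt_min h10 h20 h30 h40 h50 h60 h70.
pose h := M / 2.
have h0 : 0 < h by rewrite /h; lra.
have : h < M by rewrite /h; lra.
rewrite !lt_min => /andP[/andP[/andP[hh1 hh2] /andP[hh3 hh4]] /andP[hh5 /andP[hh6 hh7]]].
have [|k1 c1 b1] := H1 h; first by rewrite h0.
have [|k2 c2 b2] := H2 h; first by rewrite h0.
have [|k3 c3 b3] := H3 h; first by rewrite h0.
have [|k4 c4 b4] := H4 h; first by rewrite h0.
have c1' : avoids h e K1 k1 by apply: avoids_le c1; rewrite !ge_min lexx.
have c2' : avoids h e K1 k2 by apply: avoids_le c2; rewrite !ge_min lexx ?orbT.
have c3' : avoids h e K2 k3 by apply: avoids_le c3; rewrite !ge_min lexx ?orbT.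
have c4' : avoids h e K2 k4 by apply: avoids_le c4; rewrite !ge_min lexx ?orbT.
have lab l : side l (grid_floor h a) = side l (grid_floor h b) ->
    forall x, K1 x -> K2 x -> side l (grid_floor h x) = side l (grid_floor h a).
  by move=> E x K1x K2x; have [->|->] := N x K1x K2x.
have [E1|E1] := eqVneq (side (k1 ++ k3) (grid_floor h a)) (side (k1 ++ k3) (grid_floor h b)).
  by apply: Or31; apply: (H5 h _ k1 k3 _ _ _ _ _ (lab _ E1)) => //; rewrite h0.
have [E2|E2] := eqVneq (side (k2 ++ k4) (grid_floor h a)) (side (k2 ++ k4) (grid_floor h b)).
  by apply: Or32; apply: (H6 h _ k2 k4 _ _ _ _ _ (lab _ E2)) => //; rewrite h0.
apply: Or33; apply: (H7 h _ (k1 ++ k2) (k3 ++ k4) _ _ _ _ _ (lab _ _)) => //.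
- by rewrite h0.
- exact: avoids_cat.
- exact: avoids_cat.
- by move=> g; rewrite end_parity_cat b1 b2 addbA addbK.
- by move=> g; rewrite end_parity_cat b3 b4 addbA addbK.
- move: E1 E2; rewrite !side_cat.
  by do 8! [case: (side _ _)].
Qed.
End Janiszewski.

(** * Closed curves separate *)

Section TwoEnds.
Variable R : realType.
Implicit Types (K : set (R * R)) (p q x y : R * R) (h e : R) (n m : node).

Lemma compact_closedR K : compact K -> closed K.
Proof. by apply: compact_closed; exact: norm_hausdorff. Qed.

(** Suppose that A separates only points that B separates already. Walk up the line
x = c and record the stretches that avoid A in one chain, those that avoid B in another.
The gaps of the first chain can then be bridged off both sets. *)
Section Line.
Variables (A B : set (R * R)) (c t0 : R).
Hypotheses (cA : compact A) (cB : compact B).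

Let P (t : R) : R * R := (c, t).

(** The chains add up to the segment of the line between P t0 and P t: the first avoids A
and ends in s, the second avoids B and starts there. *)
Definition split_line (s : R * R) (t : R) := exists2 e, 0 < e & exists2 h0, 0 < h0 &
  forall h, 0 < h < h0 -> exists l : seq gedge * seq gedge,
    [/\ avoids h e A l.1, avoids h e B l.2,
        forall g, end_parity l.1 g = g (grid_floor h (P t0)) (+) g (grid_floor h s),
        forall g, end_parity l.2 g = g (grid_floor h s) (+) g (grid_floor h (P t)) &
        forall n, side (l.1 ++ l.2) n =
          (Num.floor (c / h) <= n.1) && span (Num.floor (t0 / h)) (Num.floor (t / h)) n.2].

(** The current stretch avoids A, and the chain avoiding B is closed. *)
Definition reach_A t := ~ A (P t) /\ split_line (P t) t.

(** The current stretch avoids B and started near s, where the chain avoiding A stopped. *)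
Definition reach_B t := ~ B (P t) /\
  exists s, [/\ ~ A s, ~ B s, joined B s (P t) & split_line s t].

Hypothesis HAB : forall p q, ~ (A `|` B) p -> ~ (A `|` B) q -> joined B p q ->
  joined (A `|` B) p q.

(** By assumption s and P t can be joined off both sets; such a chain is added to both
records, which does not change their sum. *)
Lemma reach_AB t : ~ A (P t) -> ~ B (P t) -> reach_A t <-> reach_B t.
Proof.
move=> At Bt; split => [[_ sl]|[_ [s [As Bs sB sl]]]].
  by split=> //; exists (P t); split => //; exact: joined_refl.
split=> //; have sAB : joined (A `|` B) s (P t) by apply: HAB => //; case.
have [e' e'0 [h1 h10 H1]] := joined_linked (compact_closedR (compactU cA cB)) sAB.
have [e e0 [h0 h00 H]] := sl.
exists (Num.min e e'); first by rewrite lt_min e0.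
exists (Num.min h0 h1); first by rewrite lt_min h00.
move=> h /andP[hp]; rewrite lt_min => /andP[hh0 hh1].
have [|[l1 l2] /= [c1 c2 b1 b2 sd]] := H h; first by rewrite hp.
have [|k ck bk] := H1 h; first by rewrite hp.
exists (l1 ++ k, l2 ++ k); split => /=.
- apply: avoids_cat; first by apply: avoids_le c1; rewrite ge_min lexx.
  by apply: avoids_sub (avoids_le _ ck); [exact: subsetUl|rewrite ge_min lexx orbT].
- apply: avoids_cat; first by apply: avoids_le c2; rewrite ge_min lexx.
  by apply: avoids_sub (avoids_le _ ck); [exact: subsetUr|rewrite ge_min lexx orbT].
- by move=> g; rewrite end_parity_cat b1 bk addbA addbK.
- by move=> g; rewrite end_parity_cat b2 bk addbb addbb.
- by move=> n; rewrite -sd !side_cat; do 3! case: (side _ _).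
Qed.

Lemma line_avoids K t t' e h : 0 < h -> h < e -> `|t - t'| < e ->
  (forall y, ball (P t) (e * 4) y -> ~ K y) ->
  avoids h e K (straight true (Num.floor (c / h)) (Num.floor (t / h)) (Num.floor (t' / h))).
Proof.
move=> h0 he tt' H; have e0 : 0 < e by lra.
apply: (avoids_vseg h0 H).
  apply: (@le_ball _ _ _ (e + h)); first by lra.
  by have := @grid_floor_ball R h (P t) (P t) e h0; apply; exact: ballxx.
apply: (@le_ball _ _ _ (e + h)); first by lra.
have := @grid_floor_ball R h (P t) (P t') e h0; apply.
by apply/ballE; rewrite /= subrr normr0.
Qed.

Lemma span_trans j1 j2 j3 j : span j1 j2 j (+) span j2 j3 j = span j1 j3 j.
Proof. by rewrite /span; case: (j < j2); case: (j < j1); case: (j < j3). Qed.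

Lemma reach_A_step t t' e : 0 < e -> `|t - t'| < e ->
  (forall y, ball (P t) (e * 4) y -> ~ A y) -> reach_A t -> reach_A t'.
Proof.
move=> e0 tt' H [_ [e1 e10 [h0 h00 Hl]]]; split.
  apply: H; apply/ballE => /=; rewrite subrr normr0; split; first by lra.
  by apply: lt_trans tt' _; lra.
exists (Num.min e1 e); first by rewrite lt_min e10.
exists (Num.min h0 e); first by rewrite lt_min h00.
move=> h /andP[hp]; rewrite lt_min => /andP[hh0 he].
have [|[l1 l2] /= [c1 c2 b1 b2 sd]] := Hl h; first by rewrite hp.
pose k := straight true (Num.floor (c / h)) (Num.floor (t / h)) (Num.floor (t' / h)).
exists (l1 ++ k, l2); split => /=.
- apply: avoids_cat; first by apply: avoids_le c1; rewrite ge_min lexx.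
  by apply: avoids_le (line_avoids hp he tt' H); rewrite ge_min lexx orbT.
- by apply: avoids_le c2; rewrite ge_min lexx.
- by move=> g; rewrite end_parity_cat b1 end_parity_vseg addbA addbK.
- by move=> g; rewrite b2 addbb addbb.
- move=> n; rewrite -(span_trans _ (Num.floor (t / h))) andb_addr -sd !side_cat side_vseg.
  by rewrite -addbA [_ (+) side l2 n]addbC addbA.
Qed.

Lemma reach_B_step t t' e : 0 < e -> `|t - t'| < e ->
  (forall y, ball (P t) (e * 4) y -> ~ B y) -> reach_B t -> reach_B t'.
Proof.
move=> e0 tt' H [_ [s [As Bs sB [e1 e10 [h0 h00 Hl]]]]].
have bt' : ball (P t) (e * 4) (P t').
  apply/ballE => /=; rewrite subrr normr0; split; first by lra.
  by apply: lt_trans tt' _; lra.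
split; first exact: H.
exists s; split => //.
  by apply: joined_trans sB _; apply: (joined_ball H) => //; apply: ballxx; lra.
exists (Num.min e1 e); first by rewrite lt_min e10.
exists (Num.min h0 e); first by rewrite lt_min h00.
move=> h /andP[hp]; rewrite lt_min => /andP[hh0 he].
have [|[l1 l2] /= [c1 c2 b1 b2 sd]] := Hl h; first by rewrite hp.
pose k := straight true (Num.floor (c / h)) (Num.floor (t / h)) (Num.floor (t' / h)).
exists (l1, l2 ++ k); split => /=.
- by apply: avoids_le c1; rewrite ge_min lexx.
- apply: avoids_cat; first by apply: avoids_le c2; rewrite ge_min lexx.
  by apply: avoids_le (line_avoids hp he tt' H); rewrite ge_min lexx orbT.
- by move=> g; rewrite b1.
- by move=> g; rewrite end_parity_cat b2 end_parity_vseg addbA addbK.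
- move=> n; rewrite -(span_trans _ (Num.floor (t / h))) andb_addr -sd !side_cat side_vseg.
  by rewrite addbA.
Qed.

Lemma reach_step t t' e : 0 < e -> `|t - t'| < e ->
  (forall y, ball (P t) (e * 4) y -> ~ A y) \/ (forall y, ball (P t) (e * 4) y -> ~ B y) ->
  (reach_A t \/ reach_B t) -> (reach_A t' \/ reach_B t').
Proof.
move=> e0 tt' [H|H] r.
  have At : ~ A (P t) by apply: H; apply: ballxx; lra.
  left; apply: (reach_A_step e0 tt' H); case: r => // rB.
  by apply/reach_AB => //; case: rB.
have Bt : ~ B (P t) by apply: H; apply: ballxx; lra.
right; apply: (reach_B_step e0 tt' H); case: r => // rA.
by apply/reach_AB => //; case: rA.
Qed.

Hypothesis line_out : forall t, ~ (A (P t) /\ B (P t)).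

Lemma reach_all t1 : t0 <= t1 -> ~ A (P t0) -> ~ A (P t1) -> ~ B (P t1) ->
  split_line (P t1) t1.
Proof.
move=> t01 A0 A1 B1.
suff : reach_A t1 \/ reach_B t1 by case=> [[]|/(reach_AB A1 B1)[]].
apply: (@clopen_ind R R `[t0, t1]%classic (fun t => reach_A t \/ reach_B t) _ _ t0 t1).
- exact: segment_connected.
- move=> t _.
  have [e e0 He] : exists2 e, 0 < e &
     (forall y, ball (P t) (e * 4) y -> ~ A y) \/ (forall y, ball (P t) (e * 4) y -> ~ B y).
    have [At|At] := pselect (A (P t)).
      have Bt : ~ B (P t) by move=> Bt; exact: (line_out (conj At Bt)).
      have [e e0 He] := closed_ball_out (compact_closedR cB) Bt.
      by exists (e / 4); [lra|right; rewrite divfK].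
    have [e e0 He] := closed_ball_out (compact_closedR cA) At.
    by exists (e / 4); [lra|left; rewrite divfK].
  exists (e / 2) => [|t']; first by lra.
  rewrite -ball_normE /ball_ /= => tt' _; split.
    by apply: (reach_step e0) => //; lra.
  apply: (@reach_step _ _ (e / 2)); first by lra.
    by rewrite distrC.
  have sub y : ball (P t') (e / 2 * 4) y -> ball (P t) (e * 4) y.
    move=> /ballE[/= y1 y2]; apply/ballE; split => /=; first by lra.
    have := ler_normD (t - t') (t' - y.2); rewrite addrA subrK => /le_lt_trans; apply; lra.
  by case: He => H; [left|right] => y /sub; exact: H.
- by rewrite /= in_itv /= lexx t01.
- by rewrite /= in_itv /= lexx t01.
- left; split => //; exists 1; first exact: ltr01.
  exists 1; first exact: ltr01.
  move=> h _; exists ([::], [::]); split => //=.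
  + by move=> g; rewrite /end_parity big_nil addbb.
  + by move=> g; rewrite /end_parity big_nil addbb.
  + by move=> n; rewrite /side big_nil /span addbb andbF.
Qed.
End Line.

(** The line halfway between a and b is the sum of a chain avoiding A and one avoiding B,
each with its ends far away. The connected set A0 sees a and b on the same side of the
first, B0 on the same side of the second, whereas the line separates them. *)
Lemma two_ends_ordered A B A0 B0 a b : compact A -> compact B ->
  A0 `<=` A -> B0 `<=` B -> connected A0 -> connected B0 ->
  (forall x, A x -> B x -> x = a \/ x = b) ->
  A0 a -> A0 b -> B0 a -> B0 b -> a.1 < b.1 ->
  ~ (forall p q, ~ (A `|` B) p -> ~ (A `|` B) q -> joined B p q -> joined (A `|` B) p q).
Proof.
move=> cA cB AA BB cA0 cB0 N Aa Ab Ba Bb ab HAB.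
pose c := (a.1 + b.1) / 2.
have line t : ~ (A (c, t) /\ B (c, t)).
  by case=> At Bt; have [/(congr1 fst) E|/(congr1 fst) E] := N _ At Bt;
    move: E; rewrite /c /=; lra.
have [M0 HM0] := compact_bound (compactU cA cB).
pose M := M0 + 1.
have M0p : 0 <= M0 by have [+ _] := HM0 a (or_introl (AA _ Aa)); apply: le_trans.
have out t : M0 < `|t| -> ~ (A `|` B) (c, t).
  by move=> lt /HM0[_ /=]; lra.
have oM : ~ (A `|` B) (c, M) by apply: out; rewrite ger0_norm /M; lra.
have oM' : ~ (A `|` B) (c, - M) by apply: out; rewrite normrN ger0_norm /M; lra.
have [||||e' e'0 [h0 h00 H]] := reach_all (t0 := - M) (t1 := M) cA cB HAB line.
- by rewrite /M; lra.
- by move=> ?; apply: oM'; left.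
- by move=> ?; apply: oM; left.
- by move=> ?; apply: oM; right.
pose e := Num.min e' (1 / 2).
have e0 : 0 < e by rewrite lt_min e'0; lra.
have e2 : e <= 1 / 2 by rewrite ge_min lexx orbT.
pose m := Num.min (Num.min h0 e) (c - a.1).
have m0 : 0 < m by rewrite lt_min (lt_min _ h0) h00 e0 /c; lra.
pose h := m / 2.
have hp : 0 < h by rewrite /h; lra.
have hm : h < m by rewrite /h; lra.
have hh0 : h < h0 by apply: lt_le_trans hm _; rewrite ge_min ge_min lexx.
have he : h < e by apply: lt_le_trans hm _; rewrite ge_min (ge_min _ h0) lexx orbT.
have hc : h < c - a.1 by apply: lt_le_trans hm _; rewrite ge_min lexx orbT.
have [|[l1 l2] /= [c1 c2 b1 b2 sd]] := H h; first by rewrite hp.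
have le_e : e <= e' by rewrite ge_min lexx.
have {}c1 := avoids_le le_e c1; have {}c2 := avoids_le le_e c2.
have rows x j : (A `|` B) x -> `|x.2 - h * j%:~R| < e ->
    (j == Num.floor (M / h)) = false /\ (j == Num.floor (- M / h)) = false.
  move=> /HM0[_]; rewrite ler_norml ltr_norml => /andP[x1 x2] /andP[x3 x4].
  have /andP[f1 f2] := floor_grid M hp; have /andP[f3 f4] := floor_grid (- M) hp.
  by split; apply/eqP => E; move: f1 f2 f3 f4; rewrite -E /M; lra.
have nb x i j : (A `|` B) x -> `|x.2 - h * j%:~R| < e ->
    ray (i, j) (grid_floor h (c, M)) = false /\ ray (i, j) (grid_floor h (c, - M)) = false.
  move=> Kx /(rows _ _ Kx)[r1 r2]; rewrite /ray /grid_floor /=.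
  by rewrite [_ == j]eq_sym r1 [_ == j]eq_sym r2 !andbF.
have sA : side l1 (grid_floor h a) = side l1 (grid_floor h b).
  apply: (side_connected cA0 hp he) => //; first exact: avoids_sub c1.
  by move=> x A0x i j xj; have [|E1 E2] := nb x i j _ xj; [left; exact: AA|rewrite b1 E1 E2].
have sB : side l2 (grid_floor h a) = side l2 (grid_floor h b).
  apply: (side_connected cB0 hp he) => //; first exact: avoids_sub c2.
  by move=> x B0x i j xj; have [|E1 E2] := nb x i j _ xj; [right; exact: BB|rewrite b2 E1].
have := sd (grid_floor h a); have := sd (grid_floor h b); rewrite !side_cat sA sB => ->.
have /andP[fc1 fc2] := floor_grid c hp.
have /andP[fa1 fa2] := floor_grid a.1 hp.
have -> : (Num.floor (c / h) <= (grid_floor h a).1) = false.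
  by apply/negP; rewrite -(grid_leE _ _ hp) /=; lra.
have -> : Num.floor (c / h) <= (grid_floor h b).1.
  by apply: le_floor; rewrite ler_pM2r ?invr_gt0 // /c; lra.
have /HM0[_] := or_introl (AA _ Ab) : (A `|` B) b; rewrite ler_norml => /andP[bl bu].
have /andP[f1 f2] := floor_grid M hp; have /andP[f3 f4] := floor_grid (- M) hp.
have /andP[f5 f6] := floor_grid b.2 hp.
rewrite /span /= ltNge.
have -> : Num.floor (- M / h) <= Num.floor (b.2 / h).
  by rewrite -(grid_leE _ _ hp); move: bl bu; rewrite /M in f1 f2 f3 f4 *; lra.
rewrite ltNge; have -> : (Num.floor (M / h) <= Num.floor (b.2 / h)) = false.
  by apply/negP; rewrite -(grid_leE _ _ hp); move: bl bu; rewrite /M in f1 f2 f3 f4 *; lra.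
by [].
Qed.

Definition flip (x : R * R) : R * R := (x.2, x.1).
Lemma flip_cont : continuous flip.
Proof. move=> x; exact: (cvg_pair cvg_snd cvg_fst). Qed.
Lemma flipK : involutive flip. Proof. by case. Qed.
Lemma flip_compact K : compact K -> compact (flip @` K).
Proof. by move=> cK; apply: continuous_compact => //; apply: continuous_subspaceT => x; exact: flip_cont. Qed.
Lemma flip_connected K : connected K -> connected (flip @` K).
Proof. by move=> cK; apply: connected_continuous_connected => //; apply: continuous_subspaceT => x; exact: flip_cont. Qed.
Lemma flipE K x : (flip @` K) x <-> K (flip x).
Proof.
split=> [[y Ky <-]|Kx]; first by rewrite flipK.
by exists (flip x); rewrite ?flipK.
Qed.
Lemma flip_joined K p q : joined K p q -> joined (flip @` K) (flip p) (flip q).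
Proof.
move=> s; apply: (@joined_conn _ _ (flip @` (connected_component (~` K) p))).
- by apply: flip_connected; exact: component_connected.
- by move=> z /flipE/connected_component_sub h /flipE.
- by apply/flipE; rewrite flipK; apply: connected_component_refl; have [] := joined_out s.
- by apply/flipE; rewrite flipK.
Qed.

(** The separation part of the Jordan curve theorem: if a and b are already connected
within B, a second connection A cuts a face of B. If a and b have equal first
coordinates, the plane is reflected in the diagonal. *)
Lemma two_ends A B A0 B0 a b : compact A -> compact B ->
  A0 `<=` A -> B0 `<=` B -> connected A0 -> connected B0 ->
  (forall x, A x -> B x -> x = a \/ x = b) ->
  A0 a -> A0 b -> B0 a -> B0 b -> a <> b ->
  exists p q, [/\ ~ (A `|` B) p, ~ (A `|` B) q, joined B p q & ~ joined (A `|` B) p q].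
Proof.
move=> cA cB AA BB cA0 cB0 N Aa Ab Ba Bb ab.
apply: contrapT => nE.
have HAB p q : ~ (A `|` B) p -> ~ (A `|` B) q -> joined B p q -> joined (A `|` B) p q.
  by move=> op oq s; apply: contrapT => ns; apply: nE; exists p, q.
have [E1|] := eqVneq a.1 b.1; last first.
  rewrite neq_lt => /orP[lt|lt].
    exact: (two_ends_ordered cA cB AA BB cA0 cB0 N Aa Ab Ba Bb lt HAB).
  apply: (two_ends_ordered cA cB AA BB cA0 cB0 _ Ab Aa Bb Ba lt HAB) => x Ax Bx.
  by case: (N x Ax Bx); [right|left].
have fA : flip @` A0 `<=` flip @` A by move=> x /flipE/AA/flipE.
have fB : flip @` B0 `<=` flip @` B by move=> x /flipE/BB/flipE.
have mem K x : K x -> (flip @` K) (flip x) by move=> Kx; apply/flipE; rewrite flipK.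
have fN x : (flip @` A) x -> (flip @` B) x -> x = flip a \/ x = flip b.
  by move=> /flipE Ax /flipE Bx; have [E|E] := N _ Ax Bx; [left|right]; rewrite -E flipK.
have UE : flip @` A `|` flip @` B = flip @` (A `|` B) by rewrite image_setU.
have fH p q : ~ (flip @` A `|` flip @` B) p -> ~ (flip @` A `|` flip @` B) q ->
    joined (flip @` B) p q -> joined (flip @` A `|` flip @` B) p q.
  rewrite UE => op oq s; have := @flip_joined (A `|` B) (flip p) (flip q); rewrite !flipK.
  apply; apply: HAB.
  - by move=> ?; apply: op; apply/flipE.
  - by move=> ?; apply: oq; apply/flipE.
  - have := flip_joined s; congr (joined _ _ _); apply/seteqP; split=> x.
      by move=> /flipE/flipE; rewrite flipK.
    by move=> Bx; apply/flipE/flipE; rewrite flipK.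
have [lt|lt|E2] := ltgtP a.2 b.2.
- by apply: (two_ends_ordered _ _ fA fB _ _ fN _ _ _ _ _ fH) => //;
    do ?[exact: flip_compact|exact: flip_connected|exact: mem].
- apply: (two_ends_ordered (a := flip b) (b := flip a) _ _ fA fB _ _ _ _ _ _ _ _ fH) => //;
    do ?[exact: flip_compact|exact: flip_connected|exact: mem].
  by move=> x Ax Bx; case: (fN x Ax Bx); [right|left].
- by apply: ab; rewrite [a]surjective_pairing E1 E2 -surjective_pairing.
Qed.
End TwoEnds.

(** * Faces and arcs *)

Section Faces.
Variable R : realType.
Implicit Types (K A F : set (R * R)) (p q x y : R * R).

Lemma joined_outr K p q : joined K p q -> ~ K q.
Proof. exact: connected_component_sub. Qed.

Definition face_of K F := exists2 p, ~ K p & F = joined K p.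

Lemma closureE F x : closure F x <-> forall e : R, 0 < e -> exists2 y, F y & ball x e y.
Proof.
split=> [cF e e0|H B].
  by have [y [Fy xy]] := cF _ (nbhsx_ballx x e e0); exists y.
move=> /(@nbhs_ballP R)[e /= e0 He]; have [y Fy /He By] := H e e0.
by exists y.
Qed.

Lemma face_in K F x : face_of K F -> F x -> ~ K x.
Proof. by move=> [p _ ->]; exact: joined_outr. Qed.
Lemma face_eq K F x : face_of K F -> F x -> F = joined K x.
Proof. by move=> [p Kp ->] px; exact: same_connected_component. Qed.
Lemma face_pt K F : face_of K F -> exists2 p, F p & ~ K p.
Proof. by move=> [p Kp ->]; exists p => //; exact: joined_refl. Qed.
Lemma joined_face K x : ~ K x -> face_of K (joined K x).
Proof. by move=> Kx; exists x. Qed.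
Lemma face_meet K F1 F2 x : face_of K F1 -> face_of K F2 -> F1 x -> F2 x -> F1 = F2.
Proof. by move=> f1 f2 /(face_eq f1) -> /(face_eq f2) ->. Qed.
Lemma face_joined K F1 F2 p q : face_of K F1 -> face_of K F2 -> F1 p -> F2 q ->
  joined K p q -> F1 = F2.
Proof.
move=> f1 f2 /(face_eq f1) -> F2q s; rewrite (face_eq f2 F2q).
exact: same_connected_component.
Qed.
Lemma face_connected K F : face_of K F -> connected F.
Proof. by move=> [p _ ->]; exact: component_connected. Qed.
Lemma face_open K F x : closed K -> face_of K F -> F x ->
  exists2 e : R, 0 < e & forall y, ball x e y -> F y.
Proof.
move=> cK fF Fx; have [e e0 He] := joined_near cK (face_in fF Fx).
by exists e => // y xy; rewrite (face_eq fF Fx); exact: He.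
Qed.
Lemma face_frontier K F x : closed K -> face_of K F -> closure F x -> ~ F x -> K x.
Proof.
move=> cK fF cF nF; apply: contrapT => Kx.
have [e e0 He] := joined_near cK Kx; have [y Fy xy] := (closureE F x).1 cF e e0.
by apply: nF; rewrite (face_eq fF Fy); apply: joined_sym; exact: He.
Qed.

(** A face can only be left through its frontier. *)
Lemma face_fill K F (C : set (R * R)) x y : closed K -> face_of K F -> connected C ->
  (forall z, C z -> closure F z -> F z) -> C x -> F x -> C y -> F y.
Proof.
move=> cK fF cC H Cx Fx Cy; apply: (clopen_ind cC _ Cx Cy Fx) => z Cz.
have [Fz|nFz] := pselect (F z).
  have [e e0 He] := face_open cK fF Fz; exists e => // w zw _.
  by have := He w zw; split.
have : ~ closure F z by move=> /(H z Cz).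
rewrite closureE => /existsNP[e /not_implyP[e0 He]]; exists e => // w zw _.
by split=> // Fw; exfalso; apply: He; exists w.
Qed.
Lemma touch_sub K K' F x : closed K' -> K' `<=` K -> face_of K F -> closure F x ->
  ~ K' x -> F `<=` joined K' x.
Proof.
move=> cK' KK fF cF K'x; have [e e0 He] := joined_near cK' K'x.
have [y Fy xy] := (closureE F x).1 cF e e0 => z.
rewrite (face_eq fF Fy) => s; apply: joined_trans (He y xy) _.
exact: joined_sub KK s.
Qed.

(** The frontier of F is untouched by the removal, and a face is determined by its
frontier and one of its points. *)
Lemma face_keep K K' F : closed K -> closed K' -> K' `<=` K -> face_of K F ->
  (forall x, closure F x -> K x -> K' x) -> face_of K' F.
Proof.
move=> cK cK' KK fF H; have [p Fp Kp] := face_pt fF; exists p; first by move=> /KK.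
apply/seteqP; split=> [x|x s].
  by rewrite (face_eq fF Fp); exact: joined_sub.
apply: (face_fill cK fF (@component_connected _ (~` K') p) _ _ Fp) => //.
  move=> z /joined_outr K'z cz; apply: contrapT => nFz; apply: K'z; apply: H => //.
  exact: face_frontier nFz.
by apply: joined_refl => /KK.
Qed.

Lemma joined_attach K A x p q : compact K -> compact A ->
  (forall y, K y -> A y -> y = x) -> joined A p q -> joined K p q -> joined (K `|` A) p q.
Proof.
move=> cK cA N sA sK; apply: janiszewski => //.
have : K `&` A `<=` [set x] by move=> y [] /N h /h.
by move=> /subset_set1[->|->]; [exact: connected0|exact: connected1].
Qed.

(** The attached set A separates nothing, and by Janiszewski's theorem neither does it
together with K unless K does; but K leaves x in a single face. *)
Lemma attach_face_unique K A x0 x F1 F2 : compact K -> compact A ->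
  (forall p q, ~ A p -> ~ A q -> joined A p q) -> (forall y, K y -> A y -> y = x0) ->
  ~ K x -> face_of (K `|` A) F1 -> face_of (K `|` A) F2 -> closure F1 x -> closure F2 x ->
  F1 = F2.
Proof.
move=> cK cA nA N Kx f1 f2 t1 t2; have clK := compact_closedR cK.
have [p1 F1p o1] := face_pt f1; have [p2 F2p o2] := face_pt f2.
apply: (face_joined f1 f2 F1p F2p); apply: (joined_attach cK cA N).
  by apply: nA => ?; [apply: o1|apply: o2]; right.
have s1 := touch_sub clK (@subsetUl _ K A) f1 t1 Kx F1p.
have s2 := touch_sub clK (@subsetUl _ K A) f2 t2 Kx F2p.
exact: joined_trans (joined_sym s1) s2.
Qed.

(** K1 does not separate F1 from F2, as both reach x2; nor does K2, as both reach x1. *)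
Lemma cut_face K1 K2 x1 x2 F1 F2 : compact K1 -> compact K2 -> connected (K1 `&` K2) ->
  face_of (K1 `|` K2) F1 -> face_of (K1 `|` K2) F2 -> ~ K2 x1 -> ~ K1 x2 ->
  closure F1 x1 -> closure F2 x1 -> closure F1 x2 -> closure F2 x2 -> F1 = F2.
Proof.
move=> cK1 cK2 cN f1 f2 o1 o2 t11 t21 t12 t22.
have [p1 F1p _] := face_pt f1; have [p2 F2p _] := face_pt f2.
apply: (face_joined f1 f2 F1p F2p); apply: janiszewski => //.
  have s1 := touch_sub (compact_closedR cK1) (@subsetUl _ K1 K2) f1 t12 o2 F1p.
  have s2 := touch_sub (compact_closedR cK1) (@subsetUl _ K1 K2) f2 t22 o2 F2p.
  exact: joined_trans (joined_sym s1) s2.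
have s1 := touch_sub (compact_closedR cK2) (@subsetUr _ K1 K2) f1 t11 o1 F1p.
have s2 := touch_sub (compact_closedR cK2) (@subsetUr _ K1 K2) f2 t21 o1 F2p.
exact: joined_trans (joined_sym s1) s2.
Qed.

(** Near z the two drawings agree, so what X sees there is seen by the faces into which
the larger drawing cuts X. *)
Lemma refine_face K K' X z e : closed K -> closed K' -> K' `<=` K -> 0 < e ->
  (forall y, ball z e y -> K y -> K' y) -> K z -> face_of K' X -> closure X z ->
  exists F, [/\ face_of K F, F `<=` X & exists2 y, closure F y & ball z e y /\ K y].
Proof.
move=> cK cK' KK e0 He Kz fX tX; have [r Xr zr] := (closureE X z).1 tX e e0.
have Kr : ~ K r by move=> /(He r zr); exact: face_in fX Xr.
exists (joined K r); split; first exact: joined_face.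
  by move=> y; rewrite (face_eq fX Xr); exact: joined_sub.
apply: contrapT => nE.
have sz w : ball z e w -> joined (~` ball z e) z w.
  by move=> zw; apply: (joined_ball _ (ballxx z e0) zw) => v ? /=; exact.
suff : joined K r z by move=> /joined_outr.
apply: (@face_fill K (joined K r) (joined (~` ball z e) z) r) => //.
- exact: joined_face.
- exact: component_connected.
- move=> w /joined_outr/contrapT zw cw; apply: contrapT => nw; apply: nE.
  by exists w => //; split=> //; exact: (face_frontier cK (joined_face Kr) cw nw).
- exact: sz.
- exact: joined_refl.
- by apply: sz; exact: ballxx.
Qed.

(** Outside a square, every point can be joined to the upper right corner through half
planes. *)
Lemma small_joined K x (r : R) p q : 0 < r -> (forall y, K y -> ball x r y) ->
  ~ ball x r p -> ~ ball x r q -> joined K p q.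
Proof.
move=> r0 Kx.
have half (u v : R * R) : [\/ x.1 + r <= u.1 /\ x.1 + r <= v.1,
    u.1 <= x.1 - r /\ v.1 <= x.1 - r, x.2 + r <= u.2 /\ x.2 + r <= v.2 |
    u.2 <= x.2 - r /\ v.2 <= x.2 - r] -> joined K u v.
  move=> H; apply: joined_line => t /andP[t1 t2] /Kx/ballE[/=].
  rewrite !ltr_norml => /andP[a1 a2] /andP[b1 b2].
  have aux (a b : R) : 0 <= a -> 0 <= b -> 0 <= a + t * (b - a) by move=> *; nra.
  case: H => -[h1 h2].
  - by have := aux (u.1 - x.1 - r) (v.1 - x.1 - r); lra.
  - by have := aux (x.1 - r - u.1) (x.1 - r - v.1); lra.
  - by have := aux (u.2 - x.2 - r) (v.2 - x.2 - r); lra.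
  - by have := aux (x.2 - r - u.2) (x.2 - r - v.2); lra.
have corner u : ~ ball x r u -> joined K u (x.1 + r, x.2 + r).
  rewrite ballE !ltr_norml => /not_andP nb.
  have : [\/ x.1 + r <= u.1, u.1 <= x.1 - r, x.2 + r <= u.2 | u.2 <= x.2 - r].
    case: nb => /negP; rewrite negb_and -!leNgt => /orP[h|h].
    - by apply: Or41; lra.
    - by apply: Or42; lra.
    - by apply: Or43; lra.
    - by apply: Or44; lra.
  case=> h.
  - by apply: half; apply: Or41 => /=.
  - apply: (joined_trans (q := (x.1 - r, x.2 + r))); apply: half; first by apply: Or42.
    by apply: Or43.
  - by apply: half; apply: Or43.
  - apply: (joined_trans (q := (x.1 + r, x.2 - r))); apply: half; first by apply: Or44.
    by apply: Or41.
by move=> /corner sp /corner sq; apply: joined_trans sp (joined_sym sq).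
Qed.

Lemma sep_pt (x p : R * R) : x <> p -> exists2 e : R, 0 < e & ~ ball x e p.
Proof.
move=> xp; have [e e0 He] : exists2 e : R, 0 < e & forall y, ball p e y -> ~ [set x] y.
  apply: closed_ball_out; last by move=> /= px; apply: xp.
  by apply: compact_closedR; exact: compact_set1.
by exists e => // xp'; apply: (He x) => //; exact: ball_sym.
Qed.

Lemma point_joined x p q : p <> x -> q <> x -> joined [set x] p q.
Proof.
move=> px qx; have [|e e0 He] := @sep_pt x p; first by move=> E; apply: px.
have [|e' e'0 He'] := @sep_pt x q; first by move=> E; apply: qx.
have m0 : 0 < Num.min e e' by rewrite lt_min e0.
apply: (@small_joined _ x (Num.min e e')) => //.
- by move=> y ->; exact: ballxx.
- by move=> b; apply: He; apply: le_ball b; rewrite ge_min lexx.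
- by move=> b; apply: He'; apply: le_ball b; rewrite ge_min lexx orbT.
Qed.

Section Arc.
Variable f : R -> R * R.
Hypotheses (fc : {within `[0, 1], continuous f}) (fi : {in `[0, 1] &, injective f}).
Definition sub_arc (a b : R) := f @` `[a, b].

Lemma sub_arcP a b t : a <= t -> t <= b -> sub_arc a b (f t).
Proof. by move=> at_ tb; exists t => //; rewrite /= in_itv /= at_ tb. Qed.

Lemma sub_arc_cont a b : 0 <= a -> b <= 1 -> {within `[a, b], continuous f}.
Proof.
move=> a0 b1; apply: continuous_subspaceW fc => t /=.
by rewrite !in_itv /= => /andP[? ?]; apply/andP; split; lra.
Qed.
Lemma sub_arc_compact a b : 0 <= a -> b <= 1 -> compact (sub_arc a b).
Proof.
by move=> a0 b1; apply: continuous_compact; [exact: sub_arc_cont|exact: segment_compact].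
Qed.
Lemma sub_arc_connected a b : 0 <= a -> b <= 1 -> connected (sub_arc a b).
Proof.
by move=> a0 b1; apply: connected_continuous_connected;
  [exact: segment_connected|exact: sub_arc_cont].
Qed.
Lemma arc_inj s t : 0 <= s <= 1 -> 0 <= t <= 1 -> f s = f t -> s = t.
Proof. by move=> hs ht; apply: fi; rewrite in_itv. Qed.

Lemma arc_near t (e : R) : 0 <= t <= 1 -> 0 < e -> exists2 d, 0 < d &
  forall s, 0 <= s <= 1 -> `|t - s| < d -> ball (f t) e (f s).
Proof.
move=> ht e0; have /subspace_continuousP/(_ t) := fc.
rewrite /= in_itv /= => /(_ ht) /(_ (ball (f t) e) (nbhsx_ballx _ _ e0)).
rewrite /nbhs /= /within /= => /nbhs_ballP[d /= d0 Hd]; exists d => // s hs ts.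
by apply: (Hd s ts); rewrite /= in_itv.
Qed.

Lemma arc_near_interior t (e : R) : 0 <= t <= 1 -> 0 < e ->
  exists2 t', 0 < t' < 1 & ball (f t) e (f t').
Proof.
move=> ht e0; have [d d0 Hd] := arc_near ht e0; have /andP[ht0 ht1] := ht.
pose m := Num.min d 1.
have m0 : 0 < m by rewrite lt_min d0 ltr01.
have [m1 m2] : m <= d /\ m <= 1 by rewrite !ge_min !lexx orbT.
clearbody m.
have [t' h1 h2] : exists2 t', 0 < t' < 1 & `|t - t'| < d.
  have [h|h] := lerP t (1 / 2).
    by exists (t + m / 3); rewrite ?ltr_norml; apply/andP; split; lra.
  by exists (t - m / 3); rewrite ?ltr_norml; apply/andP; split; lra.
by exists t' => //; apply: Hd => //; case/andP: h1 => ? ?; apply/andP; split; lra.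
Qed.

(** Arcs do not separate the plane. Growing the arc by a tiny piece adds a set that does
not separate p from q and meets the previous part in one point. *)
Lemma sub_arc_joined a b p q : 0 <= a -> a <= b -> b <= 1 ->
  ~ sub_arc a b p -> ~ sub_arc a b q -> joined (sub_arc a b) p q.
Proof.
move=> a0 ab b1 op oq.
have small t : a <= t <= b -> exists2 d, 0 < d & forall lo hi,
    a <= lo -> hi <= b -> `|t - lo| < d -> `|t - hi| < d -> joined (sub_arc lo hi) p q.
  move=> /andP[at_ tb].
  have [e1 e10 H1] : exists2 e : R, 0 < e & ~ ball (f t) e p.
    by apply: sep_pt => E; apply: op; rewrite -E; exact: sub_arcP.
  have [e2 e20 H2] : exists2 e : R, 0 < e & ~ ball (f t) e q.
    by apply: sep_pt => E; apply: oq; rewrite -E; exact: sub_arcP.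
  have m0 : 0 < Num.min e1 e2 by rewrite lt_min e10.
  have [|d d0 Hd] := @arc_near t _ _ m0; first by apply/andP; split; lra.
  exists d => // lo hi alo hib; rewrite !ltr_norml => /andP[l1 l2] /andP[h1 h2].
  apply: (@small_joined _ (f t) (Num.min e1 e2)) => //.
  - move=> _ [s /= + <-]; rewrite in_itv /= => /andP[s1 s2]; apply: Hd.
      by apply/andP; split; lra.
    by rewrite ltr_norml; apply/andP; split; lra.
  - by move=> h; apply: H1; apply: le_ball h; rewrite ge_min lexx.
  - by move=> h; apply: H2; apply: le_ball h; rewrite ge_min lexx orbT.
apply: (@clopen_ind R R `[a, b]%classic (fun t => joined (sub_arc a t) p q) _ _ a b).
- exact: segment_connected.
- move=> t /=; rewrite in_itv /= => /[dup] /andP[at_ tb] /small[d d0 Hd].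
  exists d => // t'; rewrite -ball_normE /ball_ /= => tt'.
  rewrite in_itv /= => /andP[at' t'b].
  have mono lo hi : lo <= hi -> joined (sub_arc a hi) p q -> joined (sub_arc a lo) p q.
    move=> lh; apply: joined_sub => _ [s /= + <-]; rewrite in_itv /= => /andP[s1 s2].
    by apply: sub_arcP => //; exact: le_trans lh.
  have up lo hi : a <= lo -> lo <= hi -> hi <= b -> joined (sub_arc lo hi) p q ->
      joined (sub_arc a lo) p q -> joined (sub_arc a hi) p q.
    move=> alo lh hib s1 s2.
    have : joined (sub_arc a lo `|` sub_arc lo hi) p q.
      apply: (@joined_attach _ _ (f lo)) => //; do ?by apply: sub_arc_compact; lra.
      move=> _ [s /= + <-] [s' /= + E]; rewrite !in_itv /= => /andP[? ?] /andP[? ?].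
      have ss : s' = s by apply: arc_inj E; apply/andP; split; lra.
      by congr f; lra.
    apply: joined_sub => _ [s /= + <-]; rewrite in_itv /= => /andP[s1' s2'].
    have [h|h] := lerP s lo; first by left; exact: sub_arcP.
    by right; apply: sub_arcP => //; exact: ltW.
  have zt : `|t - t| < d by rewrite subrr normr0.
  have [h|h] := lerP t t'.
    split; last exact: mono.
    by apply: up => //; apply: Hd => //; lra.
  have {}h := ltW h; split; first exact: mono.
  by apply: up => //; apply: Hd => //; lra.
- by rewrite /= in_itv /= lexx ab.
- by rewrite /= in_itv /= lexx ab.
- have [|d d0 Hd] := small a; first by rewrite lexx.
  by apply: Hd => //; rewrite subrr normr0.
Qed.

Variable K : set (R * R).
Hypotheses (cK : compact K)
  (Kf : forall t, 0 <= t <= 1 -> K (f t) -> t = 0 \/ t = 1).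
Let A := f @` `[0, 1].

Lemma arc_compact : compact A. Proof. by apply: sub_arc_compact. Qed.

Lemma arc_interior_joined s t : 0 < s < 1 -> 0 < t < 1 -> joined K (f s) (f t).
Proof.
wlog st : s t / s <= t => [H hs ht|].
  have [h|/ltW h] := lerP s t; first exact: H.
  by apply: joined_sym; exact: H.
move=> /andP[s0 s1] /andP[t0' t1].
apply: (@joined_conn _ _ (sub_arc s t)).
- by apply: sub_arc_connected; lra.
- move=> _ [u /= + <-]; rewrite in_itv /= => /andP[u1 u2] Ku.
  by have [|E|E] := Kf _ Ku; [apply/andP; split|..]; lra.
- by apply: sub_arcP.
- by apply: sub_arcP.
Qed.

Lemma arc_interior_out t : 0 < t < 1 -> ~ K (f t).
Proof.
move=> /andP[t0 t1] Kt; have [|E|E] := Kf _ Kt; last by lra.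
  by apply/andP; split; lra.
by lra.
Qed.

Lemma cut_arc_joined a b p t : 0 <= a -> a < t -> t < b -> b <= 1 -> ~ A p ->
  joined K p (f t) -> joined (K `|` sub_arc 0 a `|` sub_arc b 1) p (f t).
Proof.
move=> a0 at_ tb b1 Ap s.
have subA c d : 0 <= c -> d <= 1 -> sub_arc c d `<=` A.
  move=> c0 d1 _ [u /= + <-]; rewrite in_itv /= => /andP[? ?].
  by apply: sub_arcP; lra.
have out c d : 0 <= c -> d <= 1 -> (t < c \/ d < t) -> ~ sub_arc c d (f t).
  move=> c0 d1 h [u /= + E]; rewrite in_itv /= => /andP[? ?].
  have ut : u = t by apply: arc_inj E; apply/andP; split; lra.
  by case: h; lra.
apply: (@joined_attach _ _ (f 1)).
- by apply: compactU => //; apply: sub_arc_compact; lra.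
- by apply: sub_arc_compact; lra.
- move=> y Ky [u /= + E]; rewrite in_itv /= -E => /andP[? ?]; move: Ky; rewrite -E => -[Ku|].
    by have [|e|e] := Kf _ Ku; [apply/andP; split; lra|exfalso; lra|rewrite e].
  move=> [v /= + E']; rewrite in_itv /= => /andP[? ?].
  have uv : v = u by apply: arc_inj E'; apply/andP; split; lra.
  by exfalso; lra.
- apply: sub_arc_joined; try lra; last by apply: out; lra.
  by move=> h; apply: Ap; apply: subA h; lra.
apply: (@joined_attach _ _ (f 0)) => //.
- by apply: sub_arc_compact; lra.
- move=> y Ky [u /= + E]; rewrite in_itv /= -E => /andP[? ?]; move: Ky; rewrite -E => Ku.
  by have [|e|e] := Kf _ Ku; [apply/andP; split; lra|rewrite e|exfalso; lra].
- apply: sub_arc_joined; try lra; last by apply: out; lra.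
  by move=> h; apply: Ap; apply: subA h; lra.
Qed.

(** Suppose that F stays away from an inner point f t. Without a short piece around f t,
the two rest pieces of the arc dangle from K and separate nothing, so F and f t are in one
face. But F can be left only through the short piece, where it does not come. *)
Lemma arc_touch F s : face_of (K `|` A) F -> 0 < s < 1 -> closure F (f s) ->
  A `<=` closure F.
Proof.
move=> fF hs ts; have clK := compact_closedR cK.
have clKA : closed (K `|` A) by apply: compact_closedR; apply: compactU => //; exact: arc_compact.
have [p Fp op] := face_pt fF.
have inner t : 0 < t < 1 -> closure F (f t).
  move=> ht; apply: contrapT; rewrite closureE => /existsNP[e /not_implyP[e0 He]].
  have e20 : 0 < e / 2 by lra.
  have /andP[ht0 ht1] := ht.
  have [|d d0 Hd] := @arc_near t _ _ e20; first by apply/andP; split; lra.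
  pose d' := Num.min d (Num.min t (1 - t)) / 2.
  have m0 : 0 < Num.min d (Num.min t (1 - t)) by rewrite !lt_min d0; apply/andP; split; lra.
  have : d' < Num.min d (Num.min t (1 - t)) by rewrite /d'; lra.
  have d'0 : 0 < d' by rewrite /d'; lra.
  rewrite !lt_min => /andP[dd /andP[dt dt1]].
  pose a := t - d'; pose b := t + d'.
  have s1 : joined K p (f t).
    apply: joined_trans (joined_sym (touch_sub clK (@subsetUl _ K A) fF ts (arc_interior_out hs) Fp)) _.
    exact: arc_interior_joined.
  have s2 : joined (K `|` sub_arc 0 a `|` sub_arc b 1) p (f t).
    by apply: cut_arc_joined => //; rewrite /a /b; try lra; move=> ?; apply: op; right.
  have : F (f t); last by move=> /(face_in fF); apply; right; apply: sub_arcP; lra.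
  apply: (face_fill clKA fF (@component_connected _ (~` (K `|` sub_arc 0 a `|` sub_arc b 1)) p) _ _ Fp s2).
    move=> z /joined_outr oz cz; apply: contrapT => nFz.
    have [Kz|[u /= + E]] := face_frontier clKA fF cz nFz; first by apply: oz; left; left.
    rewrite in_itv /= => /andP[u0 u1].
    have [ua|au] := lerP u a.
      by apply: oz; left; right; rewrite -E; exact: sub_arcP.
    have [bu|ub] := lerP b u.
      by apply: oz; right; rewrite -E; exact: sub_arcP.
    have [y Fy zy] := (closureE F z).1 cz _ e20.
    apply: He; exists y => //; rewrite [e]splitr; apply: ball_triangle zy; rewrite -E.
    apply: Hd; first by apply/andP.
    by rewrite ltr_norml; move: au ub; rewrite /a /b => *; apply/andP; split; lra.
  by apply: joined_refl; have [] := joined_out s2.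
move=> _ [t /= + <-]; rewrite in_itv /= => ht.
apply/closureE => e e0; have e20 : 0 < e / 2 by lra.
have [t' h1 tt'] := arc_near_interior ht e20.
have [y Fy ty] := (closureE F (f t')).1 (inner t' h1) _ e20.
by exists y => //; rewrite [e]splitr; exact: ball_triangle ty.
Qed.

(** Cut the arc in the middle. The first half attached to K separates none of the three
faces, the second half separates nothing at all, and the two compact sets meet in at most
two points. *)
Lemma arc_two_faces F1 F2 F3 : face_of (K `|` A) F1 -> face_of (K `|` A) F2 ->
  face_of (K `|` A) F3 -> A `<=` closure F1 -> A `<=` closure F2 -> A `<=` closure F3 ->
  [\/ F1 = F2, F2 = F3 | F1 = F3].
Proof.
move=> f1 f2 f3 t1 t2 t3; have clK := compact_closedR cK.
have [p1 F1p o1] := face_pt f1; have [p2 F2p o2] := face_pt f2.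
have [p3 F3p o3] := face_pt f3.
have hm : 0 < (1 / 2 : R) < 1 by apply/andP; split; lra.
have m0 : A (f (1 / 2)) by apply: sub_arcP; lra.
have s1 := touch_sub clK (@subsetUl _ K A) f1 (t1 _ m0) (arc_interior_out hm) F1p.
have s2 := touch_sub clK (@subsetUl _ K A) f2 (t2 _ m0) (arc_interior_out hm) F2p.
have s3 := touch_sub clK (@subsetUl _ K A) f3 (t3 _ m0) (arc_interior_out hm) F3p.
have subA c d : 0 <= c -> d <= 1 -> sub_arc c d `<=` A.
  move=> c0 d1 _ [u /= + <-]; rewrite in_itv /= => /andP[? ?].
  by apply: sub_arcP; lra.
have sarc c d p q : 0 <= c -> c <= d -> d <= 1 -> ~ (K `|` A) p -> ~ (K `|` A) q ->
    joined (sub_arc c d) p q.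
  move=> c0 cd d1 op oq; apply: sub_arc_joined => //.
    by move=> /(subA _ _ c0 d1) h; apply: op; right.
  by move=> /(subA _ _ c0 d1) h; apply: oq; right.
have sK p q : joined K (f (1 / 2)) p -> joined K (f (1 / 2)) q -> ~ (K `|` A) p ->
    ~ (K `|` A) q -> joined (K `|` sub_arc 0 (1 / 2)) p q.
  move=> sp sq op oq; apply: (@joined_attach _ _ (f 0)) => //.
  - by apply: sub_arc_compact; lra.
  - move=> y Ky [u /= + E]; rewrite in_itv /= => /andP[? ?]; move: Ky; rewrite -E => Ku.
    by have [|e|e] := Kf _ Ku; [apply/andP; split; lra|rewrite e|exfalso; lra].
  - by apply: sarc => //; lra.
  - exact: joined_trans (joined_sym sp) sq.
have E : K `|` A = K `|` sub_arc 0 (1 / 2) `|` sub_arc (1 / 2) 1.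
  apply/seteqP; split=> [x [Kx|[u /= + <-]]|x [[Kx|h]|h]]; try by [left; left|left].
  - rewrite in_itv /= => /andP[u0 u1]; have [h|/ltW h] := lerP u (1 / 2).
      by left; right; exact: sub_arcP.
    by right; exact: sub_arcP.
  - by right; apply: subA h; lra.
  - by right; apply: subA h; lra.
have [|||||||s|s|s] := @janiszewski2 R (K `|` sub_arc 0 (1 / 2)) (sub_arc (1 / 2) 1)
   (f (1 / 2)) (f 1) p1 p2 p3.
- by apply: compactU => //; apply: sub_arc_compact; lra.
- by apply: sub_arc_compact; lra.
- move=> y Ky [u /= + E']; rewrite in_itv /= => /andP[? ?]; move: Ky; rewrite -E' => -[Ku|].
    by have [|e|e] := Kf _ Ku; [apply/andP; split; lra|exfalso; lra|right; rewrite e].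
  move=> [v /= + E'']; rewrite in_itv /= => /andP[? ?].
  have uv : v = u by apply: arc_inj E''; apply/andP; split; lra.
  by left; congr f; lra.
- exact: sK.
- exact: sK.
- by apply: sarc => //; lra.
- by apply: sarc => //; lra.
- by apply: Or31; apply: (face_joined f1 f2 F1p F2p); rewrite E.
- by apply: Or32; apply: (face_joined f2 f3 F2p F3p); rewrite E.
- by apply: Or33; apply: (face_joined f1 f3 F1p F3p); rewrite E.
Qed.
End Arc.
End Faces.

(** * Faces of drawings of subgraphs *)

Section Drawings.
Variables (R : realType) (G : plane_graph R).
Notation V := (vertex G).
Implicit Types (u v w x y : V) (W : {set V}) (E : {set {set V}}) (F : set (R * R)).
Local Notation pos := (@pos R G).
Local Notation curve := (@curve R G).

(** Edges without orientation, so that a set of edges is a symmetric relation. *)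
Definition edge u v : {set V} := [set u; v]%SET.
Definition sadj W E u v := [&& adj u v, u \in W, v \in W & edge u v \in E].
Definition draw W E : set (R * R) := [set p | (exists2 v, v \in W & p = pos v) \/
  exists u v, sadj W E u v /\ curve u v p].

Lemma edgeC u v : edge u v = edge v u. Proof. exact: finset.setUC. Qed.
Lemma edge_eq a b c d : edge a b = edge c d -> (a = c /\ b = d) \/ (a = d /\ b = c).
Proof.
move=> E; have : a \in edge c d by rewrite -E !inE eqxx.
have : b \in edge c d by rewrite -E !inE eqxx orbT.
have : c \in edge a b by rewrite E !inE eqxx.
have : d \in edge a b by rewrite E !inE eqxx orbT.
by rewrite !inE => /orP[/eqP ->|/eqP ->] /orP[/eqP ->|/eqP ->] /orP[/eqP h1|/eqP h1]
  /orP[/eqP h2|/eqP h2]; subst; auto.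
Qed.

Lemma sadj_sym W E : symmetric (sadj W E).
Proof.
by move=> u v; rewrite /sadj adj_sym edgeC; case: (adj v u); case: (u \in W); case: (v \in W).
Qed.
Lemma sadj_adj W E u v : sadj W E u v -> adj u v. Proof. by case/and4P. Qed.
Lemma sadj_l W E u v : sadj W E u v -> u \in W. Proof. by case/and4P. Qed.
Lemma sadj_r W E u v : sadj W E u v -> v \in W. Proof. by case/and4P. Qed.
Lemma sadj_E W E u v : sadj W E u v -> edge u v \in E. Proof. by case/and4P. Qed.
Lemma sadj_neq W E u v : sadj W E u v -> u != v.
Proof. by move=> /sadj_adj; apply: contraTneq => ->; rewrite adj_irr. Qed.
Lemma sadj_mono W W' E E' u v : W' \subset W -> E' \subset E -> sadj W' E' u v -> sadj W E u v.
Proof. by move=> /fintype.subsetP WW /fintype.subsetP EE /and4P[? ? ? ?]; apply/and4P; split; auto. Qed.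

Lemma pos_curve_l u v : adj u v -> curve u v (pos u).
Proof.
move=> /curve_arc[f [_ _ <- _ ->]]; exists 0 => //.
by rewrite /= in_itv /= lexx ler01.
Qed.
Lemma pos_curve_r u v : adj u v -> curve u v (pos v).
Proof. by rewrite adj_sym => uv; rewrite -curve_sym //; exact: pos_curve_l. Qed.

Lemma draw_pos W E v : v \in W -> draw W E (pos v). Proof. by move=> vW; left; exists v. Qed.
Lemma draw_curve W E u v p : sadj W E u v -> curve u v p -> draw W E p.
Proof. by move=> s c; right; exists u, v. Qed.
Lemma draw_mono W W' E E' : W' \subset W -> E' \subset E -> draw W' E' `<=` draw W E.
Proof.
move=> WW EE p [[v vW ->]|[u [v [s c]]]]; first by apply: draw_pos; exact: (fintype.subsetP WW).
exact: draw_curve (sadj_mono WW EE s) c.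
Qed.
Lemma draw_posE W E v : draw W E (pos v) -> v \in W.
Proof.
move=> [[w wW /(@pos_inj _ G) ->]|[a [b [s /curve_vertex]]]] //.
by move=> /(_ (sadj_adj s))[->|->]; [exact: sadj_l s|exact: sadj_r s].
Qed.

Lemma fin_compact (I : finType) (P : pred I) (F : I -> set (R * R)) :
  (forall i, P i -> compact (F i)) -> compact [set x | exists2 i, P i & F i x].
Proof.
move=> H.
suff aux (s : seq I) : compact [set x | exists2 i, (i \in s) && P i & F i x].
  have := aux (enum I); congr compact; apply/seteqP.
  by split=> x [i Pi Fi]; exists i => //; move: Pi; rewrite mem_enum.
elim: s => [|i s IH].
  have -> : [set x | exists2 i, (i \in [::]) && P i & F i x] = set0.
    by rewrite -subset0 => x [].
  exact: compact0.
have -> : [set x | exists2 j, (j \in i :: s) && P j & F j x] =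
   [set x | P i /\ F i x] `|` [set x | exists2 j, (j \in s) && P j & F j x].
  apply/seteqP; split=> x.
    move=> [j]; rewrite inE => /andP[/orP[/eqP ->|js] Pj] Fj; first by left.
    by right; exists j => //; rewrite js.
  case=> [[Pi Fi]|[j /andP[js Pj] Fj]]; first by exists i => //; rewrite inE eqxx.
  by exists j => //; rewrite inE js orbT.
apply: compactU => //; have [Pi|nPi] := boolP (P i).
  by have := H i Pi; congr compact; apply/seteqP; split=> x //; case.
have -> : [set x | false /\ F i x] = set0 by rewrite -subset0 => x [].
exact: compact0.
Qed.

Lemma curve_compact u v : adj u v -> compact (curve u v).
Proof. by move=> /curve_arc[f [fc fi _ _ ->]]; exact: arc_compact. Qed.

Lemma draw_compact W E : compact (draw W E).
Proof.
have := @compactU _ _ _ (@fin_compact V (mem W) (fun v => [set pos v]) _)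
  (@fin_compact (V * V)%type (fun e => sadj W E e.1 e.2) (fun e => curve e.1 e.2) _).
move=> /(_ (fun _ _ => @compact_set1 _ _)) /(_ (fun e s => curve_compact (sadj_adj s))).
congr compact; apply/seteqP; split=> p.
  by case=> [[v vW ->]|[[u v] /= s c]]; [left; exists v|right; exists u, v].
by case=> [[v vW ->]|[u [v [s c]]]]; [left; exists v|right; exists (u, v)].
Qed.
Arguments draw_compact : clear implicits.
Lemma draw_closed W E : closed (draw W E).
Proof. by apply: compact_closedR; exact: draw_compact. Qed.

Arguments draw_closed : clear implicits.

Lemma curve_sep W E u v p : adj u v -> ~~ sadj W E u v -> curve u v p -> draw W E p ->
  p = pos u \/ p = pos v.
Proof.
move=> uv ns c; have vert w : p = pos w -> p = pos u \/ p = pos v.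
  by move=> E'; move: c; rewrite E' => /(curve_vertex uv)[->|->]; auto.
case=> [[w wW]|[a [b [s c']]]]; first exact: vert.
case: (curve_cross uv (sadj_adj s) c c') => [[e1 e2]|[e1 e2]|[w _ /esym]].
- by move: ns; rewrite e1 e2 s.
- by move: ns; rewrite e1 e2 sadj_sym s.
- exact: vert.
Qed.

Lemma curve_param W E u v : adj u v -> ~~ sadj W E u v -> exists f : R -> R * R,
  [/\ {within `[0, 1], continuous f}, {in `[0, 1] &, injective f}, f 0 = pos u, f 1 = pos v &
   curve u v = f @` `[0, 1]] /\ (forall t, 0 <= t <= 1 -> draw W E (f t) -> t = 0 \/ t = 1).
Proof.
move=> uv ns; have [f [fc fi f0 f1 cE]] := curve_arc uv; exists f; split => // t ht Kt.
have ct : curve u v (f t) by rewrite cE; exists t => //; rewrite /= in_itv.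
by case: (curve_sep uv ns ct Kt); rewrite -?f0 -?f1 => /(arc_inj fi) e; [left|right];
  apply: e => //; rewrite ?lexx ?ler01.
Qed.

Lemma sadj_del W E u v : sadj W (E :\ edge u v)%SET u v = false.
Proof. by rewrite /sadj !inE eqxx /= !andbF. Qed.

Lemma sadj_delE W E u v a b : sadj W E a b ->
  [\/ sadj W (E :\ edge u v)%SET a b, a = u /\ b = v | a = v /\ b = u].
Proof.
move=> /and4P[h1 h2 h3 h4]; have [/edge_eq[]|ne] := eqVneq (edge a b) (edge u v).
- by constructor 2.
- by constructor 3.
- by constructor 1; rewrite /sadj h1 h2 h3 !inE ne h4.
Qed.

Lemma draw_del W E u v : sadj W E u v -> draw W E = draw W (E :\ edge u v)%SET `|` curve u v.
Proof.
move=> s; apply/seteqP; split=> p.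
  case=> [[w wW ->]|[a [b [sab c]]]]; first by left; exact: draw_pos.
  have [s'|[e1 e2]|[e1 e2]] := sadj_delE u v sab.
  - by left; exact: draw_curve s' c.
  - by right; rewrite -e1 -e2.
  - by right; rewrite -e1 -e2 -curve_sym // (sadj_adj sab).
case=> [|c]; last exact: draw_curve s c.
by apply: draw_mono => //; exact: finset.subsetDl.
Qed.

Definition touch F v := closure F (pos v).
Definition etouch F u v := curve u v `<=` closure F.

Lemma etouch_l F u v : adj u v -> etouch F u v -> touch F u.
Proof. by move=> uv; apply; exact: pos_curve_l. Qed.
Lemma etouch_r F u v : adj u v -> etouch F u v -> touch F v.
Proof. by move=> uv; apply; exact: pos_curve_r. Qed.
Lemma etouch_sym F u v : adj u v -> etouch F u v -> etouch F v u.
Proof. by move=> uv; rewrite /etouch curve_sym. Qed.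

Lemma edge_touch W E F u v p : face_of (draw W E) F -> sadj W E u v -> curve u v p ->
  p <> pos u -> p <> pos v -> closure F p -> etouch F u v.
Proof.
move=> fF s c pu pv cF.
have [f [[fc fi f0 f1 cE] Kf]] := curve_param (sadj_adj s) (negbT (sadj_del W E u v)).
move: (c); rewrite cE => -[t /=]; rewrite in_itv /= => /andP[t0 t1] ft.
rewrite /etouch cE; refine (arc_touch fc fi (draw_compact _ _) Kf (s := t) _ _ _).
- by rewrite -cE -draw_del.
- rewrite !lt_neqAle t0 t1 !andbT; apply/andP; split; apply/eqP => e.
    by apply: pu; rewrite -ft -e.
  by apply: pv; rewrite -ft e.
- by rewrite ft.
Qed.

Lemma edge_two_faces W E F1 F2 F3 u v : sadj W E u v -> face_of (draw W E) F1 ->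
  face_of (draw W E) F2 -> face_of (draw W E) F3 -> etouch F1 u v -> etouch F2 u v ->
  etouch F3 u v -> [\/ F1 = F2, F2 = F3 | F1 = F3].
Proof.
move=> s f1 f2 f3; rewrite /etouch.
have [f [[fc fi f0 f1' cE] Kf]] := curve_param (sadj_adj s) (negbT (sadj_del W E u v)).
rewrite cE => t1 t2 t3; rewrite (draw_del s) cE in f1 f2 f3.
exact: (arc_two_faces fc fi (draw_compact _ _) Kf).
Qed.

(** By [edge_touch] the frontier of F is made of the vertices and edges that F touches, and
all of these are kept. *)
Lemma face_mono W W' E E' F : W' \subset W -> E' \subset E -> face_of (draw W E) F ->
  (forall v, v \in W -> v \notin W' -> ~ touch F v) ->
  (forall u v, sadj W E u v -> u \in W' -> v \in W' -> ~~ sadj W' E' u v -> ~ etouch F u v) ->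
  face_of (draw W' E') F.
Proof.
move=> WW EE fF HV HE; apply: face_keep (fF) _ => //; try exact: draw_closed.
  exact: draw_mono.
have vert v (z : R * R) : v \in W -> closure F z -> z = pos v -> draw W' E' z.
  move=> vW cx ex; apply: contrapT => nK; apply: (HV v vW); last by rewrite /touch -ex.
  by apply/negP => vW'; apply: nK; rewrite ex; exact: draw_pos.
move=> x cx [[v vW ex]|[u [v [s c]]]]; first exact: vert ex.
have [ex|pu] := pselect (x = pos u); first exact: (vert u _ (sadj_l s)).
have [ex|pv] := pselect (x = pos v); first exact: (vert v _ (sadj_r s)).
have et := edge_touch fF s c pu pv cx.
have uW : u \in W'.
  by apply/negPn/negP => uW; apply: (HV u (sadj_l s) uW); exact: etouch_l (sadj_adj s) et.
have vW : v \in W'.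
  by apply/negPn/negP => vW; apply: (HV v (sadj_r s) vW); exact: etouch_r (sadj_adj s) et.
have [s'|ns] := boolP (sadj W' E' u v); first exact: draw_curve s' c.
by case: (HE u v s uW vW ns).
Qed.

Lemma face_delV W E F u : face_of (draw W E) F -> ~ touch F u -> face_of (draw (W :\ u)%SET E) F.
Proof.
move=> fF tu; apply: (face_mono _ _ fF); [exact: finset.subsetDl|exact: subxx| |].
  by move=> v vW; rewrite !inE vW andbT negbK => /eqP ->.
by move=> a b /and4P[h1 h2 h3 h4] ha hb; rewrite /sadj h1 ha hb h4.
Qed.

Lemma face_delE W E F u v : face_of (draw W E) F -> ~ etouch F u v ->
  face_of (draw W (E :\ edge u v)%SET) F.
Proof.
move=> fF tu; apply: face_mono (fF) _ _ => //; first exact: finset.subsetDl.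
  by move=> w ->.
move=> a b s _ _ ns; have [s'|[-> ->]|[e1 e2]] := sadj_delE u v s => //.
  by rewrite s' in ns.
move=> t; apply: tu; rewrite -e1 -e2; apply: etouch_sym t; exact: sadj_adj s.
Qed.

Lemma face_up K0 K1 F : K1 `<=` K0 -> face_of K0 F -> exists2 F', face_of K1 F' & F `<=` F'.
Proof.
move=> KK fF; have [p Fp K0p] := face_pt fF; exists (joined K1 p).
  by apply: joined_face => /KK.
by move=> x; rewrite (face_eq fF Fp); exact: joined_sub.
Qed.
Lemma touch_mono F F' v : F `<=` F' -> touch F v -> touch F' v.
Proof. by move=> FF; exact: closure_subset. Qed.
Lemma etouch_mono F F' u v : F `<=` F' -> etouch F u v -> etouch F' u v.
Proof. by move=> FF t p /t; exact: closure_subset. Qed.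

(** An edge that is not drawn runs, without its ends, through a single face. *)
Lemma edge_face W E u v : adj u v -> ~~ sadj W E u v -> exists2 p,
  [/\ curve u v p, p <> pos u & p <> pos v] &
  ~ draw W E p /\ (touch (joined (draw W E) p) u /\ touch (joined (draw W E) p) v).
Proof.
move=> uv ns; have [f [[fc fi f0 f1 cE] Kf]] := curve_param uv ns.
have h : (0 < 1 / 2 :> R) /\ (1 / 2 < 1 :> R) by split; lra.
have hm : 0 < (1 / 2 : R) < 1 by case: h => -> ->.
have ne t : 0 <= t <= 1 -> f (1 / 2) = f t -> t = 1 / 2.
  by move=> ht /(arc_inj fi) e; rewrite e //; apply/andP; split; lra.
exists (f (1 / 2)).
  split; first by rewrite cE; apply: sub_arcP; lra.
    by rewrite -f0 => /ne; rewrite lexx ler01 => /(_ isT); lra.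
  by rewrite -f1 => /ne; rewrite lexx ler01 => /(_ isT); lra.
split; first exact: arc_interior_out Kf _ hm.
have app t : 0 <= t <= 1 -> closure (joined (draw W E) (f (1 / 2))) (f t).
  move=> ht; apply/closureE => e e0; have [t' h1 h2] := arc_near_interior fc ht e0.
  by exists (f t') => //; exact: arc_interior_joined Kf _ _ hm h1.
by split; rewrite /touch -?f0 -?f1; apply: app; rewrite lexx ler01.
Qed.

Lemma half_edge W E u v p : adj u v -> u \notin W -> curve u v p -> p <> pos v ->
  joined (draw W E) (pos u) p.
Proof.
move=> uv uW c pv.
have ns : ~~ sadj W E u v by rewrite /sadj (negPf uW) andbF.
have [f [[fc fi f0 f1 cE] Kf]] := curve_param uv ns.
move: c; rewrite cE => -[t /=]; rewrite in_itv /= => /andP[t0 t1] ft.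
have t1' : t < 1.
  by rewrite lt_neqAle t1 andbT; apply/eqP => e; apply: pv; rewrite -ft e.
apply: (@joined_conn _ _ (sub_arc f 0 t)).
- by apply: (sub_arc_connected fc); lra.
- move=> _ [s /= + <-]; rewrite in_itv /= => /andP[s0 st] Ks.
  have [|e|e] := Kf s _ Ks; [by apply/andP; split; lra| |by move: t1'; rewrite ltNge -e st].
  by move: Ks; rewrite e f0 => /draw_posE; apply/negP.
- by rewrite -f0; apply: sub_arcP => //; lra.
- by rewrite -ft; apply: sub_arcP => //; lra.
Qed.

Lemma draw_out W E u : u \notin W -> ~ draw W E (pos u).
Proof. by move=> uW /draw_posE; apply/negP. Qed.

Lemma curve_joined u v p q : adj u v -> ~ curve u v p -> ~ curve u v q ->
  joined (curve u v) p q.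
Proof. by move=> /curve_arc[f [fc fi _ _ ->]] op oq; apply: (sub_arc_joined fc fi) => //; lra. Qed.

(** An isolated vertex or a pendant edge separates nothing. *)
Lemma face_at_leaf W E x F1 F2 : x \in W -> (forall y z, sadj W E x y -> sadj W E x z -> y = z) ->
  face_of (draw W E) F1 -> face_of (draw W E) F2 -> touch F1 x -> touch F2 x -> F1 = F2.
Proof.
move=> xW H f1 f2 t1 t2; have ox : x \notin (W :\ x)%SET by rewrite !inE eqxx.
have [[y s]|nE] := pselect (exists y, sadj W E x y); last first.
  have KE : draw W E = draw (W :\ x)%SET E `|` [set pos x].
    apply/seteqP; split=> p.
      case=> [[w wW ->]|[a [b [s c]]]].
        by have [->|ne] := eqVneq w x; [right|left; apply: draw_pos; rewrite !inE ne].
      left; right; exists a, b; split=> //; have /and4P[h1 h2 h3 h4] := s.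
      rewrite /sadj !inE h1 h2 h3 h4 !andbT /=; apply/andP; split; apply/eqP => e.
        by apply: nE; exists b; rewrite -e.
      by apply: nE; exists a; rewrite -e sadj_sym.
    case=> [|->]; last exact: draw_pos.
    by apply: draw_mono => //; exact: finset.subsetDl.
  rewrite KE in f1 f2; apply: (attach_face_unique (x0 := pos x) _ _ _ _ _ f1 f2 t1 t2).
  - exact: draw_compact.
  - exact: compact_set1.
  - by move=> p q np nq; apply: point_joined.
  - by [].
  - exact: draw_out.
have xy := sadj_adj s.
have KE : draw W E = draw (W :\ x)%SET E `|` curve x y.
  apply/seteqP; split=> p.
    case=> [[w wW ->]|[a [b [s' c]]]].
      have [->|ne] := eqVneq w x; first by right; exact: pos_curve_l.
      by left; apply: draw_pos; rewrite !inE ne.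
    have [e|ne] := eqVneq a x.
      by right; rewrite e in s' c; rewrite (H _ _ s s').
    have [e|ne'] := eqVneq b x.
      right; rewrite e in s' c; rewrite sadj_sym in s'.
      by rewrite (H _ _ s s') curve_sym // (sadj_adj s').
    left; right; exists a, b; split=> //; have /and4P[h1 h2 h3 h4] := s'.
    by rewrite /sadj !inE h1 h2 h3 h4 ne ne'.
  case=> [|c]; last exact: draw_curve s c.
  by apply: draw_mono => //; exact: finset.subsetDl.
rewrite KE in f1 f2; apply: (attach_face_unique (x0 := pos y) _ _ _ _ _ f1 f2 t1 t2).
- exact: draw_compact.
- exact: curve_compact.
- by move=> p q; exact: curve_joined.
- move=> p Kp c; have [|e|//] := curve_sep xy _ c Kp.
    by rewrite /sadj !inE eqxx /= andbF.
  by move: Kp; rewrite e => /(draw_out ox).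
- exact: draw_out.
Qed.

(** Otherwise delete all edges at w except w y0. Then F is still a face, and the deleted
edge w y runs through another face at w, although w has degree at most 1. *)
Lemma second_edge W E F w y0 y : face_of (draw W E) F -> touch F w -> sadj W E w y -> y != y0 ->
  exists y', [/\ sadj W E w y', y' != y0 & etouch F w y'].
Proof.
move=> fF tw s yy0; apply: contrapT => nE.
pose E' := [set e in E | (w \notin e) || (e == edge w y0)]%SET.
have EE : E' \subset E by apply/fintype.subsetP => e; rewrite inE => /andP[].
have f' : face_of (draw W E') F.
  apply: face_mono (fF) _ _ => //; first by move=> v ->.
  move=> a b sab _ _ ns et; apply: nE; have /and4P[h1 h2 h3 h4] := sab.
  have : ~~ ((w \notin edge a b) || (edge a b == edge w y0)).
    by move: ns; rewrite /sadj h1 h2 h3 !inE h4.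
  rewrite negb_or negbK !inE => /andP[/orP[/eqP e|/eqP e] ne]; subst w.
    by exists b; split=> //; apply: contra ne => /eqP ->.
  exists a; split; [by rewrite sadj_sym| |exact: etouch_sym et].
  by apply: contra ne => /eqP ->; rewrite edgeC.
have ns : ~~ sadj W E' w y.
  have /and4P[h1 h2 h3 h4] := s; rewrite /sadj h1 h2 h3 !inE h4 /=.
  rewrite negb_or negbK eqxx /=; apply: contra yy0 => /eqP/edge_eq[[_ ->]|[e1 e2]] //.
  by rewrite e2 -e1.
have [p [c pw py] [Kp [tp _]]] := edge_face (sadj_adj s) ns.
have FE : F = joined (draw W E') p.
  apply: (face_at_leaf (sadj_l s) _ f' (joined_face Kp) tw tp) => a b.
  have aux z : sadj W E' w z -> z = y0.
    move=> sz; have := sadj_E sz; rewrite !inE eqxx /= => /andP[_ /eqP /edge_eq].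
    by case=> [[]|[e1 e2]] //; rewrite e2.
  by move=> /aux -> /aux ->.
apply: (@face_in _ (draw W E) F p fF); last exact: draw_curve s c.
by rewrite FE; exact: joined_refl.
Qed.

Lemma some_edge W E F w y : face_of (draw W E) F -> touch F w -> sadj W E w y ->
  exists2 y', sadj W E w y' & etouch F w y'.
Proof.
move=> fF tw s; have yw : y != w by rewrite eq_sym; exact: sadj_neq s.
by have [y' [s' _ t]] := second_edge fF tw s yw; exists y'.
Qed.

(** Each of the faces runs along both edges, and an edge has only two sides. *)
Lemma faces_at_deg2 W E x y1 y2 F1 F2 F3 : x \in W -> (forall y, sadj W E x y -> y = y1 \/ y = y2) ->
  face_of (draw W E) F1 -> face_of (draw W E) F2 -> face_of (draw W E) F3 ->
  touch F1 x -> touch F2 x -> touch F3 x -> [\/ F1 = F2, F2 = F3 | F1 = F3].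
Proof.
move=> xW H f1 f2 f3 t1 t2 t3.
have [s1|n1] := boolP (sadj W E x y1); last first.
  constructor 1; apply: face_at_leaf f1 f2 t1 t2 => // y z.
  have aux a : sadj W E x a -> a = y2.
    by move=> /[dup] sa /H[e|//]; rewrite -e sa in n1.
  by move=> /aux -> /aux ->.
have [e|ne] := eqVneq y1 y2.
  by constructor 1; apply: face_at_leaf f1 f2 t1 t2 => // y z /H + /H; rewrite e => -[->|->] [->|->].
have aux1 F : face_of (draw W E) F -> touch F x -> etouch F x y1.
  move=> fF tF; have [y' [s' n' t']] := second_edge fF tF s1 ne.
  by have [<-//|e] := H y' s'; rewrite e eqxx in n'.
by apply: (edge_two_faces s1) => //; exact: aux1.
Qed.

(** Delete the edge x v. The faces F1 and F2 persist, the deleted edge runs through a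
third face at x, and x has degree 2 now. *)
Lemma faces_at_deg3 W E x v y1 y2 F1 F2 : sadj W E x v ->
  (forall y, sadj W E x y -> [\/ y = v, y = y1 | y = y2]) ->
  face_of (draw W E) F1 -> face_of (draw W E) F2 -> touch F1 x -> touch F2 x ->
  ~ touch F1 v -> ~ touch F2 v -> F1 = F2.
Proof.
move=> s H f1 f2 t1 t2 n1 n2; have xv := sadj_adj s.
have g1 : face_of (draw W (E :\ edge x v)%SET) F1.
  by apply: (face_delE f1) => et; apply: n1; exact: etouch_r xv et.
have g2 : face_of (draw W (E :\ edge x v)%SET) F2.
  by apply: (face_delE f2) => et; apply: n2; exact: etouch_r xv et.
have [p [c px pv] [Kp [tp _]]] := edge_face xv (negbT (sadj_del W E x v)).
have out F : face_of (draw W E) F -> F <> joined (draw W (E :\ edge x v)%SET) p.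
  move=> fF FE; apply: (@face_in _ (draw W E) F p fF); last exact: draw_curve s c.
  by rewrite FE; exact: joined_refl.
have H' y : sadj W (E :\ edge x v)%SET x y -> y = y1 \/ y = y2.
  move=> sy; have ss : sadj W E x y by apply: sadj_mono sy; rewrite ?finset.subsetDl ?subxx.
  by have [e|->|->] := H y ss; [move: sy; rewrite e sadj_del|left|right].
have [e|e|e] := faces_at_deg2 (sadj_l s) H' g1 g2 (joined_face Kp) t1 t2 tp; first exact: e.
  by case: (out _ f2 e).
by case: (out _ f1 e).
Qed.
End Drawings.
Arguments draw_compact {R G} W E.
Arguments draw_closed {R G} W E.

(** * Cycles, bridges and separations *)

Section SharedEdges.
Variables (R : realType) (G : plane_graph R).
Notation V := (vertex G).
Implicit Types (u v w x y : V) (W : {set V}) (E : {set {set V}}) (F : set (R * R)).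
Local Notation pos := (@pos R G).
Local Notation curve := (@curve R G).

Lemma curve_connected u v : adj u v -> connected (curve u v).
Proof. by move=> /curve_arc[f [fc fi _ _ ->]]; exact: (sub_arc_connected fc). Qed.

Lemma connect_joined W E u v : u \in W -> connect (sadj W E) u v ->
  connected_component (draw W E) (pos u) (pos v).
Proof.
move=> uW /connectP[p + ->]; elim: p u uW => [|y p IH] u uW /=.
  by move=> _; apply: connected_component_refl; exact: draw_pos.
move=> /andP[s /(IH _ (sadj_r s)) h]; apply: connected_component_trans h.
apply: (@connected_component_max _ _ (curve u y)).
- exact: pos_curve_l (sadj_adj s).
- by move=> z; exact: draw_curve s.
- exact: curve_connected (sadj_adj s).
- exact: pos_curve_r (sadj_adj s).
Qed.

(** The edge closes a cycle, so it separates points that the other edges do not. A face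
that does not touch the edge is a face without it, so both points are in faces touching
it. *)
Lemma nonbridge W E u v : sadj W E u v -> connect (sadj W (E :\ edge u v)%SET) u v ->
  exists F1 F2, [/\ face_of (draw W E) F1, face_of (draw W E) F2, F1 <> F2, etouch F1 u v &
    etouch F2 u v].
Proof.
move=> s c; set E' := (E :\ edge u v)%SET in c *; have uv := sadj_adj s.
have KE : draw W E = curve u v `|` draw W E' by rewrite setUC; exact: draw_del.
have pp : pos u <> pos v by move=> /pos_inj e; have := sadj_neq s; rewrite e eqxx.
have [|||||||||||p [q [op oq spq npq]]] := @two_ends R (curve u v) (draw W E') (curve u v)
  (connected_component (draw W E') (pos u)) (pos u) (pos v) _ _ _ _ _ _ _ _ _ _ _ pp.
- exact: curve_compact.
- exact: draw_compact.
- by [].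
- exact: connected_component_sub.
- exact: curve_connected.
- exact: component_connected.
- by move=> x c' Kx; apply: curve_sep uv _ c' Kx; rewrite sadj_del.
- exact: pos_curve_l.
- exact: pos_curve_r.
- by apply: connected_component_refl; apply: draw_pos; exact: sadj_l s.
- exact: connect_joined (sadj_l s) c.
rewrite -KE in op oq npq.
have aux a b : ~ draw W E a -> ~ draw W E b -> joined (draw W E') a b -> ~ joined (draw W E) a b ->
    etouch (joined (draw W E) a) u v.
  move=> oa ob sab nab; apply: contrapT => nt.
  have f' := face_delE (joined_face oa) nt.
  by apply: nab; rewrite (face_eq f' (joined_refl oa)).
exists (joined (draw W E) p), (joined (draw W E) q); split.
- exact: joined_face.
- exact: joined_face.
- by move=> e; apply: npq; rewrite e; exact: joined_refl.
- exact: aux spq npq.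
- by apply: aux (joined_sym spq) _ => // /joined_sym.
Qed.

Lemma refine_edge W E E' X u v : E' \subset E -> sadj W E' u v -> face_of (draw W E') X ->
  etouch X u v -> exists F, [/\ face_of (draw W E) F, F `<=` X & etouch F u v].
Proof.
move=> EE s fX tX; have sE : sadj W E u v by exact: sadj_mono s.
have [p [c pu pv] [Kp _]] := edge_face (sadj_adj s) (negbT (sadj_del W E u v)).
have [e e0 He] := closed_ball_out (draw_closed _ _) Kp.
have [||F [fF FX [y cF [py Ky]]]] := refine_face (draw_closed W E) (draw_closed W E') _ e0 _
    (draw_curve sE c) fX (tX _ c).
- exact: draw_mono.
- by move=> y /He n; rewrite (draw_del sE) => -[/n|] //; exact: draw_curve s.
exists F; split=> //; apply: (edge_touch fF sE _ _ _ cF).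
- by move: Ky; rewrite (draw_del sE) => -[/(He y py)|].
- by move=> ey; apply: (He y py); rewrite ey; apply: draw_pos; exact: sadj_l sE.
- by move=> ey; apply: (He y py); rewrite ey; apply: draw_pos; exact: sadj_r sE.
Qed.

Lemma connect_mono W W' E E' u v : W' \subset W -> E' \subset E ->
  connect (sadj W' E') u v -> connect (sadj W E) u v.
Proof.
move=> WW EE; apply: connect_sub => a b s; apply: connect1; exact: sadj_mono s.
Qed.
Lemma connect_subC W E u v : connect (sadj W E) u v -> connect (sadj W E) v u.
Proof. by rewrite (sym_connect_sym (@sadj_sym _ _ W E)). Qed.

Lemma connect_off W E v w a b : connect (sadj (W :\ v)%SET E) a b ->
  connect (sadj W (E :\ edge v w)%SET) a b.
Proof.
apply: connect_sub => c d /and4P[h1]; rewrite !inE => /andP[cv cW] /andP[dv dW] h4.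
apply: connect1; rewrite /sadj h1 cW dW !inE h4 andbT /=.
by apply/eqP => /edge_eq[[e _]|[_ e]]; [rewrite e eqxx in cv|rewrite e eqxx in dv].
Qed.

(** If F1 and F2 were different, deleting v y2 would merge them. Then v y1 would have the
same face on both sides, although it still lies on a cycle through y3. *)
Lemma two_edges W E v y1 y2 y3 F1 F2 : sadj W E v y1 -> sadj W E v y2 -> sadj W E v y3 ->
  y1 != y2 -> y1 != y3 -> y2 != y3 -> connect (sadj (W :\ v)%SET E) y3 y1 ->
  face_of (draw W E) F1 -> face_of (draw W E) F2 ->
  etouch F1 v y1 -> etouch F1 v y2 -> etouch F2 v y1 -> etouch F2 v y2 -> F1 = F2.
Proof.
move=> s1 s2 s3 n12 n13 n23 c31 f1 f2 t11 t12 t21 t22; apply: contrapT => nF.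
set E' := (E :\ edge v y2)%SET.
have keep y : sadj W E v y -> y != y2 -> sadj W E' v y.
  move=> sy ny; have [|[_ e]|[e1 e2]] := sadj_delE v y2 sy => //.
    by rewrite e eqxx in ny.
  by rewrite e2 e1 eqxx in ny.
have s1' := keep _ s1 n12.
have s3' : sadj W E' v y3 by apply: keep => //; rewrite eq_sym.
have c : connect (sadj W (E' :\ edge v y1)%SET) v y1.
  apply: (@connect_trans _ _ y3).
    apply: connect1; have [|[_ e]|[e1 e2]] := sadj_delE v y1 s3' => //.
      by rewrite e eqxx in n13.
    by rewrite e2 e1 eqxx in n13.
  apply: connect_off; apply: connect_sub c31 => a b /and4P[h1 ha hb h4].
  apply: connect1; rewrite /sadj h1 ha hb !inE h4 andbT /=.
  by apply/eqP => /edge_eq[[e _]|[_ e]]; [move: ha|move: hb]; rewrite !inE e eqxx.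
have [X1 [X2 [g1 g2 nX u1 u2]]] := nonbridge s1' c.
have [p [cp pv py] [Kp _]] := edge_face (sadj_adj s2) (negbT (sadj_del W E v y2)).
have sup F : face_of (draw W E) F -> etouch F v y2 -> F `<=` joined (draw W E') p.
  move=> fF tF; apply: (touch_sub (draw_closed _ _) _ fF (tF _ cp) Kp).
  by apply: draw_mono => //; exact: finset.subsetDl.
have XE X : face_of (draw W E') X -> etouch X v y1 -> X = joined (draw W E') p.
  move=> fX tX; have [F [fF FX tF]] := refine_edge (@finset.subsetDl _ _ _) s1' fX tX.
  have [q Fq _] := face_pt fF.
  apply: (face_meet fX (joined_face Kp) (FX _ Fq)).
  have [e|e|e] := edge_two_faces s1 f1 f2 fF t11 t21 tF => //.
  - by apply: (sup _ f2 t22); rewrite e.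
  - by apply: (sup _ f1 t12); rewrite e.
by apply: nX; rewrite (XE _ g1 u1) (XE _ g2 u2).
Qed.

Lemma draw_sepU W E (A B : {set V}) : W = (A :|: B)%SET ->
  (forall a b, sadj W E a b -> (a \in A) && (b \in A) || (a \in B) && (b \in B)) ->
  draw W E = draw A E `|` draw B E.
Proof.
move=> WE H; apply/seteqP; split=> p.
  case=> [[v + ->]|[u [v [s c]]]].
    by rewrite WE inE => /orP[]; [left|right]; exact: draw_pos.
  have /and4P[h1 _ _ h4] := s.
  by have /orP[/andP[ha hb]|/andP[ha hb]] := H _ _ s; [left|right]; apply: draw_curve c;
    rewrite /sadj h1 ha hb h4.
by case; apply: draw_mono => //; rewrite WE; [exact: finset.subsetUl|exact: finset.subsetUr].
Qed.

(** Edges meet only in vertices. *)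
Lemma draw_sepI E (A B : {set V}) p : draw A E p -> draw B E p -> draw (A :&: B)%SET E p.
Proof.
have vert w (C D : {set V}) : w \in C -> draw D E (pos w) -> draw (C :&: D)%SET E (pos w).
  by move=> wC /draw_posE wD; apply: draw_pos; rewrite inE wC.
case=> [[v vA ->]|[a [b [s c]]]]; first exact: vert.
case=> [[v vB e]|[a' [b' [s' c']]]].
  by rewrite finset.setIC e; apply: vert => //; rewrite -e; exact: draw_curve s c.
have /and4P[h1 h2 h3 h4] := s; have /and4P[h1' h2' h3' h4'] := s'.
case: (curve_cross h1 h1' c c') => [[e1 e2]|[e1 e2]|[w _ e]].
- apply: (@draw_curve _ _ _ _ a b) => //; rewrite /sadj h1 !inE h2 h3 h4.
  by rewrite e1 e2 h2' h3'.
- apply: (@draw_curve _ _ _ _ a b) => //; rewrite /sadj h1 !inE h2 h3 h4.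
  by rewrite e1 e2 h2' h3'.
- rewrite -e; apply: vert.
    by apply: (@draw_posE _ _ A E); rewrite e; exact: draw_curve s c.
  by rewrite e; exact: draw_curve s' c'.
Qed.

Lemma separation W E (A B : {set V}) x1 x2 F1 F2 : W = (A :|: B)%SET ->
  (forall a b, sadj W E a b -> (a \in A) && (b \in A) || (a \in B) && (b \in B)) ->
  connected (draw (A :&: B)%SET E) ->
  face_of (draw W E) F1 -> face_of (draw W E) F2 -> x1 \notin B -> x2 \notin A ->
  touch F1 x1 -> touch F2 x1 -> touch F1 x2 -> touch F2 x2 -> F1 = F2.
Proof.
move=> WE H cAB f1 f2 n1 n2 t11 t21 t12 t22; rewrite (draw_sepU WE H) in f1 f2.
apply: (cut_face (draw_compact A E) (draw_compact B E) _ f1 f2 (draw_out n1) (draw_out n2)) => //.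
suff -> : draw A E `&` draw B E = draw (A :&: B)%SET E by [].
apply/seteqP; split=> p; first by case; exact: draw_sepI.
by move=> h; split; apply: draw_mono h => //; [exact: finset.subsetIl|exact: finset.subsetIr].
Qed.

Lemma draw_set0_connected E : connected (draw (finset.set0 : {set V}) E).
Proof.
suff -> : draw finset.set0 E = set0 by exact: connected0.
rewrite -subset0 => p [[v]|[u [v [/sadj_l]]]]; rewrite !inE //.
Qed.
Lemma draw_set1_connected E v : connected (draw [set v]%SET E).
Proof.
suff -> : draw [set v]%SET E = [set pos v] by exact: connected1.
apply/seteqP; split=> [p|p ->]; last by apply: draw_pos; rewrite inE.
case=> [[w]|[a [b [s _]]]]; first by rewrite inE => /eqP -> ->.
have := sadj_l s; have := sadj_r s; rewrite !inE => /eqP eb /eqP ea.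
by have := sadj_neq s; rewrite ea eb eqxx.
Qed.
Lemma draw_edge_connected E u v : adj u v -> edge u v \in E -> connected (draw (edge u v) E).
Proof.
move=> uv uvE; have s : sadj (edge u v) E u v by rewrite /sadj uv !inE !eqxx orbT.
suff -> : draw (edge u v) E = curve u v by exact: curve_connected.
apply/seteqP; split=> [p|p]; last exact: draw_curve.
case=> [[w]|[a [b [s' c]]]].
  by rewrite !inE => /orP[/eqP ->|/eqP ->] ->; [exact: pos_curve_l|exact: pos_curve_r].
have := sadj_l s'; have := sadj_r s'; have := sadj_neq s'; rewrite !inE.
move=> + /orP[/eqP eb|/eqP eb] /orP[/eqP ea|/eqP ea]; subst; rewrite ?eqxx // => _.
by rewrite curve_sym.
Qed.

(** Otherwise b, or nothing, separates x1 from x2 in the graph; see [cut_face]. *)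
Lemma cut_vertex W E b x1 x2 F1 F2 : face_of (draw W E) F1 -> face_of (draw W E) F2 -> F1 <> F2 ->
  x1 \in W -> x2 \in W -> x1 != b -> x2 != b ->
  touch F1 x1 -> touch F2 x1 -> touch F1 x2 -> touch F2 x2 ->
  connect (sadj (W :\ b)%SET E) x1 x2.
Proof.
move=> f1 f2 nF x1W x2W x1b x2b t11 t21 t12 t22; apply: contrapT => /negP nc; apply: nF.
pose A0 := [set w in W | connect (sadj (W :\ b)%SET E) x1 w]%SET.
pose A := (A0 :|: (W :&: [set b]))%SET; pose B := (W :\: A0)%SET.
have A0W : A0 \subset W by apply/fintype.subsetP => w; rewrite inE => /andP[].
have A0P w : (w \in A0) = (w \in W) && connect (sadj (W :\ b)%SET E) x1 w by rewrite inE.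
have memA w : (w \in A) = (w \in A0) || (w \in W) && (w == b).
  by rewrite finset.in_setU finset.in_setI finset.in_set1.
have nbA : b \notin A0.
  rewrite A0P negb_and; apply/orP; right; apply/negP => /connectP[p].
  case/lastP: p => [_ e|p z]; first by rewrite e eqxx in x1b.
  rewrite rcons_path last_rcons => /andP[_ s] e.
  by have := sadj_r s; rewrite -e !inE eqxx.
have ABI : (A :&: B \subset [set b])%SET.
  apply/fintype.subsetP => w; rewrite !inE -A0P.
  by case: (w \in A0) => //=; rewrite andbC => /andP[_ /andP[]].
apply: (@separation W E A B x1 x2) => //.
- apply/setP => w; rewrite /A /B !inE.
  by case: (w \in W); rewrite ?andbF //=; case: (connect _ _ _); rewrite ?orbT.
- move=> c d s; have [cW dW] := (sadj_l s, sadj_r s).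
  have key e f : sadj W E e f -> e \in A0 -> (f \in A0) || (f == b).
    move=> s' eA; have [//|nf] := eqVneq f b; first by rewrite orbT.
    rewrite orbF; move: eA; rewrite !A0P => /andP[eW ce]; rewrite (sadj_r s') /=.
    apply: connect_trans (ce) _; apply: connect1; have /and4P[h1 h2 h3 h4] := s'.
    rewrite /sadj h1 !inE h2 h3 h4 nf !andbT /=.
    by apply: contra nbA => /eqP <-; rewrite A0P eW ce.
  have [cA|cA] := boolP (c \in A0).
    apply/orP; left; rewrite !memA cA /=.
    have /orP[->//|/eqP db] := key _ _ s cA.
    by rewrite db eqxx -db dW orbT.
  have [dA|dA] := boolP (d \in A0).
    apply/orP; left; rewrite !memA dA /= andbT.
    rewrite sadj_sym in s; have /orP[h|/eqP cb] := key _ _ s dA.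
      by rewrite h in cA.
    by rewrite cb eqxx -cb cW orbT.
  by apply/orP; right; rewrite !finset.in_setD cA dA cW dW.
- have [e|[w wAB]] := set_0Vmem (A :&: B)%SET.
    by rewrite e; exact: draw_set0_connected.
  have -> : (A :&: B)%SET = [set b]%SET; last exact: draw_set1_connected.
  apply/eqP; rewrite finset.eqEsubset ABI finset.sub1set.
  by have := fintype.subsetP ABI w wAB; rewrite inE => /eqP <-.
- by rewrite !inE x1W connect0.
- by rewrite !inE (negPf nc) (negPf x2b) !andbF.
Qed.

(** The missing part of the larger drawing hangs on the deleted vertices. *)
Lemma face_down W W' E F : W' \subset W -> face_of (draw W' E) F ->
  (forall u, u \in W -> u \notin W' -> ~ F (pos u)) ->
  face_of (draw W E) F /\ (forall u, u \in W -> u \notin W' -> ~ touch F u).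
Proof.
move=> WW fF H.
have FK (x : R * R) : F x -> ~ draw W E x.
  move=> Fx; case=> [[v vW ex]|[a [b [s c]]]].
    have [vW'|vW'] := boolP (v \in W').
      by apply: (face_in fF Fx); rewrite ex; exact: draw_pos.
    by apply: (H v vW vW'); rewrite -ex.
  have K'x := face_in fF Fx.
  have [aW|aW] := boolP (a \in W'); last first.
    apply: (H a (sadj_l s) aW); rewrite (face_eq fF Fx); apply: joined_sym.
    have [eb|nb] := pselect (x = pos b); last exact: half_edge (sadj_adj s) aW c nb.
    have [bW|bW] := boolP (b \in W').
      by case: K'x; rewrite eb; exact: draw_pos.
    by case: (H b (sadj_r s) bW); rewrite -eb.
  have [bW|bW] := boolP (b \in W').
    by apply: K'x; have /and4P[h1 _ _ h4] := s; apply: draw_curve c; rewrite /sadj h1 aW bW h4.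
  apply: (H b (sadj_r s) bW); rewrite (face_eq fF Fx); apply: joined_sym.
  apply: (@half_edge _ _ _ _ b a) => //; first by rewrite adj_sym (sadj_adj s).
    by rewrite curve_sym // adj_sym (sadj_adj s).
  by move=> ea; apply: K'x; rewrite ea; exact: draw_pos.
split; last first.
  move=> u uW uW' tu; apply: (H u uW uW'); apply: contrapT => nF.
  by apply: (draw_out uW'); exact: face_frontier (draw_closed _ _) fF tu nF.
have [p Fp K'p] := face_pt fF; exists p; first exact: FK.
apply/seteqP; split=> x.
  by move=> Fx; apply: joined_conn (face_connected fF) FK Fp Fx.
by rewrite (face_eq fF Fp); apply: joined_sub; exact: draw_mono.
Qed.

Lemma face_vertex W E F w : w \in W -> face_of (draw W E) F -> exists2 v, v \in W & touch F v.
Proof.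
move=> wW fF; apply: contrapT => nE.
have f' : face_of (draw finset.set0 E) F.
  apply: (face_mono _ _ fF); [exact: finset.sub0set|exact: subxx| |].
    by move=> v vW _ tv; apply: nE; exists v.
  by move=> u v _; rewrite inE.
have [p Fp _] := face_pt fF.
apply: (@face_in _ (draw W E) F (pos w) fF); last exact: draw_pos.
rewrite (face_eq f' Fp); apply: joined_line => t _.
by move=> [[v]|[u [v [/sadj_l]]]]; rewrite inE.
Qed.
End SharedEdges.

(** * Inner faces of outerplane graphs *)

Section Outerplane.
Variables (R : realType) (G : plane_graph R).
Notation V := (vertex G).
Implicit Types (u v w x y : V) (W : {set V}) (E : {set {set V}}) (F : set (R * R)).
(* With all pairs allowed as edges, draw W T is the drawing of the subgraph induced by W. *)
Local Notation T := (@finset.setTfor {set V}).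

Lemma sadjT W u v : sadj W T u v = [&& adj u v, u \in W & v \in W].
Proof. by rewrite /sadj finset.in_setT andbT. Qed.

Section InnerFace.
Variables (W : {set V}) (f0 F : set (R * R)).
Hypotheses (ff0 : face_of (draw W T) f0) (out : forall v, v \in W -> touch f0 v).
Hypotheses (fF : face_of (draw W T) F) (nF : F <> f0).

(** The vertices of a face F other than f0. They turn out to span an induced cycle. *)
Definition rim : {set V} := [set v in W | `[< touch F v >]]%SET.
Local Notation C := rim.

Lemma rimP v : reflect (v \in W /\ touch F v) (v \in C).
Proof.
by rewrite inE; apply: (iffP andP) => -[h /asboolP t]; split=> //; apply/asboolP.
Qed.
Lemma rimW v : v \in C -> v \in W. Proof. by case/rimP. Qed.
Lemma rimF v : v \in C -> touch F v. Proof. by case/rimP. Qed.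

(** Both F and f0 reach x1 and x2, so no single vertex can separate them. *)
Lemma rim_connected b x1 x2 : x1 \in C -> x2 \in C -> x1 != b -> x2 != b ->
  connect (sadj (W :\ b)%SET T) x1 x2.
Proof.
move=> /rimP[x1W t1] /rimP[x2W t2] n1 n2.
exact: (cut_vertex fF ff0 nF x1W x2W n1 n2 t1 (out x1W) t2 (out x2W)).
Qed.

(** Keep only these three edges at v. The face on the other side of v y1 runs along a
second edge at v, which F touches too; this contradicts [two_edges]. *)
Lemma three_edges v y1 y2 y3 : v \in C -> sadj W T v y1 -> sadj W T v y2 -> sadj W T v y3 ->
  etouch F v y1 -> etouch F v y2 -> etouch F v y3 ->
  y1 != y2 -> y1 != y3 -> y2 != y3 -> False.
Proof.
move=> vC s1 s2 s3 t1 t2 t3 n12 n13 n23.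
pose E := [set e : {set V} | (v \notin e) || (e \in [set edge v y1; edge v y2; edge v y3])]%SET.
have sE y : y \in [:: y1; y2; y3] -> sadj W E v y.
  rewrite !inE => h; have sy : sadj W T v y by case/or3P: h => /eqP ->.
  have /and4P[h1 h2 h3 _] := sy; rewrite /sadj h1 h2 h3 !inE /=.
  by case/or3P: h => /eqP ->; rewrite !eqxx ?orbT.
have s1E : sadj W E v y1 by apply: sE; rewrite !inE eqxx.
have s2E : sadj W E v y2 by apply: sE; rewrite !inE eqxx orbT.
have s3E : sadj W E v y3 by apply: sE; rewrite !inE eqxx !orbT.
have Es y : sadj W E v y -> y \in [:: y1; y2; y3].
  move=> /sadj_E; rewrite !inE eqxx /= => /orP[/orP[]|] /eqP /edge_eq[[_ ->]|[e1 e2]];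
  by rewrite ?eqxx ?orbT // e2 e1 eqxx ?orbT.
have [F' fF' FF] := face_up (draw_mono (subxx W) (finset.subsetT E)) fF.
have u1 := etouch_mono FF t1; have u2 := etouch_mono FF t2.
have u3 := etouch_mono FF t3.
have off a b : connect (sadj (W :\ v)%SET T) a b -> connect (sadj (W :\ v)%SET E) a b.
  apply: connect_sub => c d /and4P[h1 h2 h3 _]; apply: connect1.
  rewrite /sadj h1 h2 h3 !inE /=; move: h2 h3; rewrite !inE => /andP[h2 _] /andP[h3 _].
  by rewrite eq_sym (negPf h2) eq_sym (negPf h3).
have cE a b : a \in [:: y1; y2; y3] -> b \in [:: y1; y2; y3] ->
    connect (sadj (W :\ v)%SET E) a b.
  have aux z : z \in [:: y1; y2; y3] -> z \in C /\ z != v.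
    move=> hz; have sz := sE z hz; split; last by rewrite eq_sym (sadj_neq sz).
    apply/rimP; split; first exact: sadj_r sz.
    have tz : etouch F v z.
      by move: hz; rewrite !inE => /or3P[] /eqP -> //.
    exact: etouch_r (sadj_adj sz) tz.
  by move=> /aux[aC av] /aux[bC bv]; apply: off; exact: rim_connected.
have c1 : connect (sadj W (E :\ edge v y1)%SET) v y1.
  apply: (@connect_trans _ _ y2).
    apply: connect1; have [//|[_ e]|[e1 e2]] := sadj_delE v y1 s2E.
    - by rewrite e eqxx in n12.
    - by rewrite e2 e1 eqxx in n12.
  by apply: connect_off; apply: cE; rewrite !inE eqxx ?orbT.
have [g [fg ng tg]] : exists g, [/\ face_of (draw W E) g, F' <> g & etouch g v y1].
  have [g1 [g2 [fg1 fg2 ng tg1 tg2]]] := nonbridge s1E c1.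
  have [e|ne] := pselect (F' = g1); last by exists g1.
  by exists g2; split=> //; rewrite e.
have [y' [s' n' t']] : exists y', [/\ sadj W E v y', y' != y1 & etouch g v y'].
  by apply: (second_edge fg (etouch_l (sadj_adj s1E) tg) s2E); rewrite eq_sym.
apply: ng; have := Es y' s'; rewrite !inE (negPf n') /= => /orP[/eqP e|/eqP e]; subst y'.
- apply: (two_edges s1E s' s3E n12 n13 n23 _ fF' fg u1 u2 tg t').
  by apply: cE; rewrite !inE eqxx ?orbT.
- apply: (two_edges s1E s' s2E n13 n12 _ _ fF' fg u1 u3 tg t'); first by rewrite eq_sym.
  by apply: cE; rewrite !inE eqxx ?orbT.
Qed.

(** A vertex with just one edge would have only one face. *)
Lemma rim_edges v : v \in C -> exists y1 y2, [/\ y1 != y2,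
  [/\ sadj W T v y1, sadj W T v y2, y1 \in C & y2 \in C],
  etouch F v y1, etouch F v y2 &
  forall y, sadj W T v y -> etouch F v y -> y = y1 \/ y = y2].
Proof.
move=> /[dup] vC /rimP[vW tv].
have not1 : ~ (forall y z, sadj W T v y -> sadj W T v z -> y = z).
  by move=> H; apply: nF; exact: face_at_leaf vW H fF ff0 tv (out vW).
have [y s] : exists y, sadj W T v y.
  by apply: contrapT => nE; apply: not1 => y z s; case: nE; exists y.
have [y1 s1 t1] := some_edge fF tv s.
have [y' [s' ny']] : exists y', sadj W T v y' /\ y' != y1.
  apply: contrapT => nE; apply: not1.
  have aux z : sadj W T v z -> z = y1.
    by move=> sz; apply/eqP; apply: contrapT => /negP nz; apply: nE; exists z.
  by move=> a b /aux -> /aux ->.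
have [y2 [s2 n2 t2]] := second_edge fF tv s' ny'.
exists y1, y2; split => //.
- by rewrite eq_sym.
- split=> //; apply/rimP; split.
  + exact: sadj_r s1.
  + exact: etouch_r (sadj_adj s1) t1.
  + exact: sadj_r s2.
  + exact: etouch_r (sadj_adj s2) t2.
- move=> z sz tz; have [->|n1] := eqVneq z y1; first by left.
  have [->|n2'] := eqVneq z y2; first by right.
  by exfalso; apply: (three_edges vC s1 s2 sz t1 t2 tz); rewrite eq_sym.
Qed.

Lemma rim_ne : exists v, v \in C.
Proof.
have [w wW] : exists w, w \in W.
  apply: contrapT => nE; apply: nF.
  have [p Fp _] := face_pt fF; have [q fq _] := face_pt ff0.
  apply: (face_joined fF ff0 Fp fq); apply: joined_line => t _.
  by case=> [[v vW _]|[u [v [s _]]]]; apply: nE; [exists v|exists u; exact: sadj_l s].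
by have [v vW tv] := face_vertex wW fF; exists v; apply/rimP.
Qed.

Lemma rim_card : (2 < #|C|)%N.
Proof.
have [v vC] := rim_ne; have [y1 [y2 [n12 [s1 s2 y1C y2C] _ _ _]]] := rim_edges vC.
have sub3 : ([set v; y1; y2] \subset C)%SET.
  by rewrite !finset.subUset !finset.sub1set vC y1C y2C.
apply: leq_trans (subset_leq_card sub3).
rewrite finset.setUC cardsU1 cards2 !inE negb_or (sadj_neq s1).
by rewrite ![y2 == _]eq_sym (sadj_neq s2) n12.
Qed.

(** In a subgraph that keeps the edges along F, the face f that contains f0 still reaches
all vertices. *)
Section Smaller.
Variables (W' : {set V}) (E' : {set {set V}}).
Hypotheses (CW : C \subset W') (WW : W' \subset W).
Hypothesis Edges : forall u v, u \in C -> v \in C -> sadj W T u v -> etouch F u v ->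
  edge u v \in E'.
Variable f : set (R * R).
Hypotheses (ff : face_of (draw W' E') f) (f0f : f0 `<=` f).

Lemma small_F : face_of (draw W' E') F.
Proof.
apply: (face_mono WW (finset.subsetT E') fF).
  move=> v vW nv tv; apply: (negP nv); apply: (fintype.subsetP CW); exact/rimP.
move=> u v s uW vW ns et; apply: (negP ns).
have /and4P[h1 h2 h3 _] := s; rewrite /sadj h1 uW vW /=.
by apply: (Edges _ _ s et); apply/rimP; split; [exact: sadj_l s|exact: etouch_l et
  |exact: sadj_r s|exact: etouch_r et].
Qed.
Lemma small_neq : F <> f.
Proof.
move=> e; have [p fp _] := face_pt ff0; apply: nF; apply: (face_meet fF ff0 _ fp).
by rewrite e; exact: f0f.
Qed.
Lemma small_touch v : v \in W' -> touch f v.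
Proof. by move=> /(fintype.subsetP WW) /out; exact: touch_mono. Qed.

Lemma small_connected b x1 x2 : x1 \in C -> x2 \in C -> x1 != b -> x2 != b ->
  connect (sadj (W' :\ b)%SET E') x1 x2.
Proof.
move=> x1C x2C n1 n2; have [x1W x2W] := (fintype.subsetP CW _ x1C, fintype.subsetP CW _ x2C).
apply: (cut_vertex small_F ff small_neq x1W x2W n1 n2).
- exact: rimF.
- exact: small_touch.
- exact: rimF.
- exact: small_touch.
Qed.

Lemma small_sub u v : u \in C -> v \in C -> sadj W T u v -> etouch F u v -> sadj W' E' u v.
Proof.
move=> uC vC s t; rewrite /sadj (sadj_adj s) (Edges uC vC s t) andbT /=.
by rewrite !(fintype.subsetP CW).
Qed.

(** A face at a vertex of degree 2 runs along both its edges, by [second_edge]. *)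
Lemma plain_rim c b : c \in C -> b \in C -> sadj W T c b -> etouch F c b ->
  (forall y, sadj W' E' c y -> sadj W T c y /\ etouch F c y) -> etouch f c b.
Proof.
move=> cC bC s t H; have [y1 [y2 [n12 [s1 s2 y1C y2C] t1 t2 only]]] := rim_edges cC.
have tc := small_touch (fintype.subsetP CW _ cC).
have S1 := small_sub cC y1C s1 t1; have S2 := small_sub cC y2C s2 t2.
have [e|e] := only b s t; rewrite e.
  have [y' [s' n' t']] := second_edge (y0 := y2) ff tc S1 n12.
  have [sy ty] := H y' s'.
  by have [<-//|e'] := only y' sy ty; rewrite e' eqxx in n'.
have n21 : y2 != y1 by rewrite eq_sym.
have [y' [s' n' t']] := second_edge ff tc S2 n21.
have [sy ty] := H y' s'.
by have [e'|<-//] := only y' sy ty; rewrite e' eqxx in n'.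
Qed.

(** F and f share both rim edges at b, and b d lies on a cycle with them. *)
Lemma third_edge b c1 c2 d : b \in C -> c1 \in C -> c2 \in C -> c1 != c2 ->
  sadj W T b c1 -> sadj W T b c2 -> etouch F b c1 -> etouch F b c2 ->
  etouch f b c1 -> etouch f b c2 ->
  sadj W' E' b d -> d != c1 -> d != c2 -> connect (sadj (W' :\ b)%SET E') d c1 -> False.
Proof.
move=> bC c1C c2C n12 s1 s2 t1 t2 u1 u2 sd n1 n2 c.
apply: small_neq; have S1 := small_sub bC c1C s1 t1; have S2 := small_sub bC c2C s2 t2.
by apply: (two_edges S1 S2 sd n12 _ _ c small_F ff t1 t2 u1 u2); rewrite eq_sym.
Qed.
End Smaller.

(** In the rim together with the chord a b, the rim neighbours of b have degree 2. So f
runs along both rim edges at b, and the chord is a third edge there. *)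
Lemma no_chord a b : a \in C -> b \in C -> sadj W T a b -> etouch F a b.
Proof.
move=> aC bC s; apply: contrapT => nt.
pose E' := ([set e : {set V} | [exists u, exists v, [&& e == edge u v, adj u v &
   `[< etouch F u v >]]]] :|: [set edge a b])%SET.
have EP u v : adj u v -> edge u v \in E' -> etouch F u v \/ edge u v = edge a b.
  move=> uv; rewrite !inE => /orP[/existsP[u' /existsP[v' /and3P[/eqP e uv' /asboolP t]]]|/eqP].
    by have [[-> ->]|[-> ->]] := edge_eq e; left => //; exact: etouch_sym.
  by right.
have Edges u v : u \in C -> v \in C -> sadj W T u v -> etouch F u v -> edge u v \in E'.
  move=> _ _ suv t; rewrite !inE; apply/orP; left; apply/existsP; exists u.
  by apply/existsP; exists v; rewrite eqxx (sadj_adj suv) /=; exact/asboolP.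
have CW : C \subset W by apply/fintype.subsetP => z; exact: rimW.
have [f ff f0f] := face_up (draw_mono CW (finset.subsetT E')) ff0.
have [c1 [c2 [n12 [s1 s2 c1C c2C] t1 t2 _]]] := rim_edges bC.
have ba := sadj_adj s; rewrite adj_sym in ba.
have nba c : sadj W T b c -> etouch F b c -> a != c.
  by move=> sc tc; apply/eqP => e; apply: nt; rewrite e; exact: etouch_sym (sadj_adj sc) tc.
have plain c : c \in C -> sadj W T b c -> etouch F b c -> etouch f b c.
  move=> cC sc tc; have cb : sadj W T c b by rewrite sadj_sym.
  have tcb := etouch_sym (sadj_adj sc) tc.
  apply: (etouch_sym (sadj_adj cb)).
  apply: (plain_rim (subxx C) CW Edges ff f0f cC bC cb tcb) => y sy.
  have [t|/edge_eq[[e1 e2]|[e1 e2]]] := EP _ _ (sadj_adj sy) (sadj_E sy).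
  - by split=> //; rewrite sadjT (sadj_adj sy) !rimW // (sadj_r sy).
  - by have := nba c sc tc; rewrite e1 eqxx.
  - by have := sadj_neq sc; rewrite e1 eqxx.
have nb c : sadj W T b c -> c != b by move=> sc; rewrite eq_sym; exact: sadj_neq sc.
have bE : sadj C E' b a by rewrite /sadj ba bC aC !inE edgeC eqxx orbT.
apply: (third_edge (subxx C) CW Edges ff f0f bC c1C c2C n12 s1 s2 t1 t2
   (plain _ c1C s1 t1) (plain _ c2C s2 t2) bE (nba _ s1 t1) (nba _ s2 t2)).
apply: (small_connected (subxx C) CW Edges ff f0f aC c1C); last exact: nb.
exact: sadj_neq s.
Qed.

(** A connected set D off the rim, attached to the rim by the edges c (delta c) for c in S
only. *)
Section Ear.
Variables (D : {set V}).
Hypotheses (DW : D \subset W) (DC : forall d, d \in D -> d \notin C).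
Hypothesis cD : forall d d', d \in D -> d' \in D -> connect (sadj D T) d d'.
Variables (S : {set V}) (delta : V -> V).
Hypotheses (SC : S \subset C) (dD : forall c, c \in S -> delta c \in D)
  (dadj : forall c, c \in S -> adj c (delta c)).

Let W' : {set V} := (C :|: D)%SET.
Let E' : {set {set V}} := [set e : {set V} | [|| e \subset C, e \subset D |
  [exists c in S, e == edge c (delta c)]]]%SET.

Let CW : C \subset W'. Proof. exact: finset.subsetUl. Qed.
Let WW : W' \subset W.
Proof. by rewrite finset.subUset DW andbT; apply/fintype.subsetP => z; exact: rimW. Qed.
Let Edges u v : u \in C -> v \in C -> sadj W T u v -> etouch F u v -> edge u v \in E'.
Proof. by move=> uC vC _ _; rewrite inE /edge finset.subUset !finset.sub1set uC vC. Qed.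

Lemma ear_neighbor c y : c \in C -> sadj W' E' c y ->
  (y \in C /\ (sadj W T c y /\ etouch F c y)) \/ (c \in S /\ y = delta c).
Proof.
move=> cC s; have := sadj_E s; rewrite inE /edge !finset.subUset !finset.sub1set.
have cS : sadj W T c y by apply: sadj_mono s => //; exact: finset.subsetT.
move=> /or3P[/andP[_ yC]|/andP[/DC/negP]//|/existsP[c' /andP[c'S /eqP/edge_eq]]].
  by left; split=> //; split=> //; exact: no_chord.
case=> [[-> ->]|[e1 e2]]; first by right.
by have := DC (dD c'S); rewrite -e1 cC.
Qed.

Variable f : set (R * R).
Hypotheses (ff : face_of (draw W' E') f) (f0f : f0 `<=` f).

(** The edge b (delta b) lies on a cycle that leaves the rim at a. *)
Lemma ear_core a b c1 c2 : a \in S -> b \in S -> a != b -> c1 \in C -> c2 \in C -> c1 != c2 ->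
  sadj W T b c1 -> sadj W T b c2 -> etouch f b c1 -> etouch f b c2 -> False.
Proof.
move=> aS bS ab c1C c2C n12 s1 s2 u1 u2.
have [aC bC] := (fintype.subsetP SC _ aS, fintype.subsetP SC _ bS).
have bd : b \notin D by apply/negP => /DC; rewrite bC.
have att c : c \in S -> sadj W' E' c (delta c).
  move=> cS; rewrite /sadj dadj // /W' !finset.in_setU (fintype.subsetP SC _ cS) dD //.
  rewrite orbT /= /E' finset.in_set.
  by apply/or3P; constructor 3; apply/existsP; exists c; rewrite cS eqxx.
have nd c : c \in C -> delta b != c.
  by move=> cC; apply/eqP => e; have := DC (dD bS); rewrite e cC.
apply: (third_edge CW WW Edges ff f0f bC c1C c2C n12 s1 s2 (no_chord bC c1C s1)
  (no_chord bC c2C s2) u1 u2 (att b bS) (nd _ c1C) (nd _ c2C)).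
apply: (@connect_trans _ _ (delta a)).
  apply: connect_sub (cD (dD bS) (dD aS)) => d d' /and4P[h1 h2 h3 _]; apply: connect1.
  rewrite /sadj h1 /W' !finset.in_setD1 !finset.in_setU h2 h3 !orbT !andbT /= finset.in_set.
  apply/and3P; split.
  - by apply: contra bd => /eqP <-.
  - by apply: contra bd => /eqP <-.
  - by rewrite /edge !finset.subUset !finset.sub1set h2 h3 orbT.
apply: (@connect_trans _ _ a).
  apply: connect1; have := att a aS; rewrite sadj_sym => /and4P[h1 h2 h3 h4].
  rewrite /sadj h1 h4 !finset.in_setD1 h2 h3 ab !andbT /=.
  by apply: contra bd => /eqP <-; exact: dD.
apply: (small_connected CW WW Edges ff f0f aC c1C) => //.
by rewrite eq_sym; exact: sadj_neq s1.
Qed.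

Lemma ear_plain c b : c \in C -> c \notin S -> b \in C -> sadj W T c b -> etouch f c b.
Proof.
move=> cC cS bC s; apply: (plain_rim CW WW Edges ff f0f cC bC s (no_chord cC bC s)) => y sy.
by have [[_ //]|[h _]] := ear_neighbor cC sy; rewrite h in cS.
Qed.

Lemma ear_att c b : c \in S -> b \in C -> sadj W T c b ->
  exists y, [/\ y \in C, sadj W T c y & etouch f c y].
Proof.
move=> cS bC s; have cC := fintype.subsetP SC _ cS.
have tc := small_touch WW f0f (fintype.subsetP CW _ cC).
have S1 := small_sub CW Edges cC bC s (no_chord cC bC s).
have nb : b != delta c by apply/eqP => e; have := DC (dD cS); rewrite -e bC.
have [y [sy ny ty]] := second_edge ff tc S1 nb.
have [[yC [sy' _]]|[_ e]] := ear_neighbor cC sy; first by exists y.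
by rewrite e eqxx in ny.
Qed.
End Ear.

(** With D attached at a and b only, the rim neighbours of b are not attached if a is not
one of them. Then f runs along both rim edges at b. *)
Lemma ear_adjacent (D : {set V}) a b da db : D \subset W ->
  (forall d, d \in D -> d \notin C) ->
  (forall d d', d \in D -> d' \in D -> connect (sadj D T) d d') ->
  a \in C -> b \in C -> a != b -> da \in D -> db \in D -> adj a da -> adj b db -> adj a b.
Proof.
move=> DW DC cD aC bC ab daD dbD ada bdb; apply/negPn/negP => nab.
pose S : {set V} := [set a; b]%SET; pose delta x := if x == a then da else db.
have SC : S \subset C by rewrite finset.subUset !finset.sub1set aC bC.
have SP c : c \in S -> c = a \/ c = b by rewrite !inE => /orP[/eqP|/eqP]; auto.
have dD c : c \in S -> delta c \in D by move=> _; rewrite /delta; case: ifP.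
have dadj c : c \in S -> adj c (delta c).
  by move=> /SP[->|->]; rewrite /delta ?eqxx // eq_sym (negPf ab).
have WW : (C :|: D)%SET \subset W.
  by rewrite finset.subUset DW andbT; apply/fintype.subsetP => z; exact: rimW.
have [f ff f0f] := face_up (draw_mono WW (finset.subsetT [set e : {set V} |
  [|| e \subset C, e \subset D | [exists c in S, e == edge c (delta c)]]]%SET)) ff0.
have [c1 [c2 [n12 [s1 s2 c1C c2C] t1 t2 _]]] := rim_edges bC.
have plain c : c \in C -> sadj W T b c -> etouch f b c.
  move=> cC sc; have cb : sadj W T c b by rewrite sadj_sym.
  apply: (etouch_sym (sadj_adj cb)); refine (ear_plain DW DC dD ff f0f cC _ bC cb).
  rewrite !inE negb_or; apply/andP; split; apply/eqP => e.
    by move: nab; rewrite -e adj_sym (sadj_adj sc).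
  by have := sadj_neq sc; rewrite e eqxx.
apply: (ear_core DW DC cD SC dD dadj ff f0f (a := a) _ _ ab c1C c2C n12 s1 s2
  (plain _ c1C s1) (plain _ c2C s2)); by rewrite !inE eqxx ?orbT.
Qed.

(** The rim would be the triangle a b c. At each of its vertices f runs along exactly one
of the two rim edges, which is impossible on an odd cycle. *)
Lemma ear_no_three (D : {set V}) a b c da db dc : D \subset W ->
  (forall d, d \in D -> d \notin C) ->
  (forall d d', d \in D -> d' \in D -> connect (sadj D T) d d') ->
  a \in C -> b \in C -> c \in C -> a != b -> a != c -> b != c ->
  da \in D -> db \in D -> dc \in D -> adj a da -> adj b db -> adj c dc -> False.
Proof.
move=> DW DC cD aC bC cC ab ac bc daD dbD dcD ada bdb cdc.
have Aab := ear_adjacent DW DC cD aC bC ab daD dbD ada bdb.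
have Aac := ear_adjacent DW DC cD aC cC ac daD dcD ada cdc.
have Abc := ear_adjacent DW DC cD bC cC bc dbD dcD bdb cdc.
pose S : {set V} := [set a; b; c]%SET.
pose delta x := if x == a then da else if x == b then db else dc.
have SP x : x \in S -> [\/ x = a, x = b | x = c].
  by rewrite !inE => /orP[/orP[]|] /eqP ->; [constructor 1|constructor 2|constructor 3].
have SC : S \subset C by apply/fintype.subsetP => x /SP[] ->.
have [aS bS cS] : [/\ a \in S, b \in S & c \in S] by rewrite !inE !eqxx ?orbT.
have dD x : x \in S -> delta x \in D by move=> _; rewrite /delta; case: ifP => // _; case: ifP.
have dadj x : x \in S -> adj x (delta x).
  move=> /SP[] ->; rewrite /delta ?eqxx //; first by rewrite eq_sym (negPf ab).
  by rewrite eq_sym (negPf ac) eq_sym (negPf bc).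
have WW : (C :|: D)%SET \subset W.
  by rewrite finset.subUset DW andbT; apply/fintype.subsetP => z; exact: rimW.
have [f ff f0f] := face_up (draw_mono WW (finset.subsetT [set e : {set V} |
  [|| e \subset C, e \subset D | [exists c in S, e == edge c (delta c)]]]%SET)) ff0.
have core := ear_core DW DC cD SC dD dadj ff f0f.
have sW x y : x \in C -> y \in C -> adj x y -> sadj W T x y.
  by move=> xC yC xy; rewrite sadjT xy !rimW.
(* f runs along one rim edge at each vertex of S by [ear_att], and not along both by [ear_core] *)
have one x y z : x \in S -> y \in S -> z \in S -> x != y -> x != z -> y != z ->
    adj x y -> adj x z -> (etouch f x y \/ etouch f x z) /\ ~ (etouch f x y /\ etouch f x z).
  move=> xS yS zS xy xz yz axy axz.
  have [xC yC zC] : [/\ x \in C, y \in C & z \in C] by rewrite !(fintype.subsetP SC).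
  have [sy sz] := (sW _ _ xC yC axy, sW _ _ xC zC axz).
  split; last by case=> ty tz; apply: (core y x y z) => //; rewrite eq_sym.
  have [w [wC sw tw]] := ear_att DW DC SC dD ff f0f xS yC sy.
  have [y1 [y2 [n12 _ _ _ only]]] := rim_edges xC.
  have := only _ sw (no_chord xC wC sw); have := only _ sy (no_chord xC yC sy).
  have := only _ sz (no_chord xC zC sz).
  move=> [ez|ez] [ey|ey] [ew|ew]; subst; auto; by rewrite eqxx in yz.
have rev x y : adj x y -> etouch f x y -> etouch f y x by exact: etouch_sym.
have [Aba Aca Acb] : [/\ adj b a, adj c a & adj c b] by rewrite ![_ b a]adj_sym ![_ c _]adj_sym.
have [k1 x1] := one a b c aS bS cS ab ac bc Aab Aac.
have [k2 x2] := one b a c bS aS cS (negbT (etrans (eq_sym _ _) (negPf ab))) bc ac Aba Abc.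
have [k3 x3] := one c a b cS aS bS (negbT (etrans (eq_sym _ _) (negPf ac)))
  (negbT (etrans (eq_sym _ _) (negPf bc))) ab Aca Acb.
have h1 := rev _ _ Aab; have h2 := rev _ _ Aac; have h3 := rev _ _ Abc.
have h4 := rev _ _ Aba; have h5 := rev _ _ Aca; have h6 := rev _ _ Acb.
tauto.
Qed.
End InnerFace.
End Outerplane.

(** * Three colours for outerplane graphs *)

Section OuterColoring.
Variables (R : realType) (G : plane_graph R).
Notation V := (vertex G).
Implicit Types (u v w x y : V) (W A B Q J I : {set V}) (E : {set {set V}}) (F : set (R * R)).
Local Notation T := (@finset.setTfor {set V}).

Definition clique (Q : {set V}) := forall a b, a \in Q -> b \in Q -> a != b -> adj a b.

Definition outer W f0 := face_of (draw W T) f0 /\ forall v, v \in W -> touch f0 v.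

Definition transversal W f0 (I : {set V}) := [/\ I \subset W,
  forall a b, a \in I -> b \in I -> ~~ adj a b &
  forall F, face_of (draw W T) F -> F <> f0 ->
    exists v, [/\ v \in I, touch F v & forall w, w \in I -> touch F w -> w = v]].

(** Prescribing I on a clique with at most two vertices lets the solutions for the two
parts of a separation along such a clique be put together. *)
Definition extendable W f0 := forall Q J : {set V}, Q \subset W -> clique Q ->
  (#|Q| <= 2)%N -> J \subset Q -> (#|J| <= 1)%N ->
  exists2 I, transversal W f0 I & (I :&: Q)%SET = J.

Lemma outer_sub W A f0 : A \subset W -> outer W f0 -> exists2 fA, outer A fA & f0 `<=` fA.
Proof.
move=> AW [ff0 out]; have [fA ffA sA] := face_up (draw_mono AW (subxx T)) ff0.
exists fA => //; split=> // v vA; apply: (touch_mono sA); apply: out.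
exact: (fintype.subsetP AW).
Qed.

Lemma clique_connected Q : clique Q -> (#|Q| <= 2)%N -> connected (draw Q T).
Proof.
move=> cQ; rewrite leq_eqVlt => /orP[/cards2P[x [y [xy QE]]]|].
  rewrite QE; apply: draw_edge_connected; last by rewrite finset.in_setT.
  by apply: cQ => //; rewrite QE !inE eqxx ?orbT.
rewrite ltnS leq_eqVlt => /orP[/cards1P[x ->]|]; first exact: draw_set1_connected.
by rewrite ltnS leqn0 cards_eq0 => /eqP ->; exact: draw_set0_connected.
Qed.

Lemma face_in_part W A F : A \subset W -> face_of (draw W T) F ->
  (forall v, v \in W -> v \notin A -> ~ touch F v) -> face_of (draw A T) F.
Proof.
move=> AW fF H; apply: (face_mono AW (subxx T) fF) => // u v s uA vA ns.
by exfalso; apply: (negP ns); rewrite sadjT uA vA (sadj_adj s).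
Qed.

Lemma face_super_neq W f0 fA F : face_of (draw W T) f0 -> f0 `<=` fA -> face_of (draw W T) F ->
  F <> f0 -> F <> fA.
Proof.
move=> ff0 sA fF nF e; have [p fp _] := face_pt ff0.
by apply: nF; apply: (face_meet fF ff0 _ fp); rewrite e; exact: sA.
Qed.

(** A face that reaches both parts beyond the clique is f0, by [separation]; any other face
belongs to one of the parts. *)
Lemma transversal_glue W A B f0 fA fB Q J : W = (A :|: B)%SET ->
  (forall a b, sadj W T a b -> (a \in A) && (b \in A) || (a \in B) && (b \in B)) ->
  clique (A :&: B)%SET -> (#|(A :&: B)%SET| <= 2)%N ->
  outer W f0 -> f0 `<=` fA -> f0 `<=` fB -> extendable A fA -> extendable B fB ->
  Q \subset A -> clique Q -> (#|Q| <= 2)%N -> J \subset Q -> (#|J| <= 1)%N ->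
  exists2 I, transversal W f0 I & (I :&: Q)%SET = J.
Proof.
move=> WE split cN N2 [ff0 out] sA sB extA extB QA cQ Q2 JQ J1.
have [IA [IAA indA trA] IAQ] := extA Q J QA cQ Q2 JQ J1.
have [|IB [IBB indB trB] IBN] :=
    extB (A :&: B)%SET (IA :&: (A :&: B))%SET (finset.subsetIr _ _) cN N2 (finset.subsetIr _ _).
  apply/card_le1_eqP => a b; rewrite !finset.in_setI => /andP[aI aN] /andP[bI bN].
  apply/eqP/negPn/negP => ab; apply: (negP (indA a b aI bI)).
  by apply: cN; rewrite ?inE // eq_sym.
have [AW BW] : A \subset W /\ B \subset W.
  by rewrite WE; split; [exact: finset.subsetUl|exact: finset.subsetUr].
have inA a : a \in (IA :|: IB)%SET -> a \in A -> a \in IA.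
  rewrite finset.in_setU => /orP[//|aB] aA.
  have : a \in (IB :&: (A :&: B))%SET by rewrite !finset.in_setI aB aA (fintype.subsetP IBB).
  by rewrite IBN finset.in_setI => /andP[].
have inB a : a \in (IA :|: IB)%SET -> a \in B -> a \in IB.
  rewrite finset.in_setU => /orP[aA|//] aB.
  have : a \in (IA :&: (A :&: B))%SET by rewrite !finset.in_setI aA aB (fintype.subsetP IAA).
  by rewrite -IBN finset.in_setI => /andP[].
have IW : (IA :|: IB)%SET \subset W.
  by rewrite finset.subUset (fintype.subset_trans IAA AW) (fintype.subset_trans IBB BW).
exists (IA :|: IB)%SET; last first.
  rewrite -IAQ; apply/setP => z; rewrite !finset.in_setI; case zQ: (z \in Q); rewrite ?andbF //.
  rewrite !andbT; apply/idP/idP => [zI|zI]; last by rewrite finset.in_setU zI.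
  by apply: inA zI _; exact: (fintype.subsetP QA).
split=> //.
  move=> a b aI bI; apply/negP => ab.
  have s : sadj W T a b by rewrite sadjT ab !(fintype.subsetP IW).
  have /orP[/andP[aA bA]|/andP[aB bB]] := split a b s.
    by apply: (negP (indA a b _ _) ab); exact: inA.
  by apply: (negP (indB a b _ _) ab); exact: inB.
move=> F fF nF.
have [[x1 [x1W x1B t1]]|noA] := pselect (exists x, [/\ x \in W, x \notin B & touch F x]).
  have fA' : face_of (draw A T) F.
    apply: (face_in_part AW fF) => x2 x2W x2A t2; apply: nF.
    apply: (separation WE split (clique_connected cN N2) fF ff0 x1B x2A t1 _ t2); exact: out.
  have [v [vI tv uv]] := trA F fA' (face_super_neq ff0 sA fF nF).
  exists v; split=> //; first by rewrite finset.in_setU vI.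
  move=> w wI tw; apply: uv => //; apply: inA => //.
  apply/negPn/negP => wA; apply: nF.
  apply: (separation WE split (clique_connected cN N2) fF ff0 x1B wA t1 _ tw); apply: out => //.
  exact: (fintype.subsetP IW).
have tB w : w \in W -> touch F w -> w \in B.
  by move=> wW tw; apply/negPn/negP => wB; apply: noA; exists w.
have fB' : face_of (draw B T) F.
  by apply: (face_in_part BW fF) => x xW xB tx; move: (tB x xW tx); apply/negP.
have [v [vI tv uv]] := trB F fB' (face_super_neq ff0 sB fF nF).
exists v; split=> //; first by rewrite finset.in_setU vI orbT.
move=> w wI tw; apply: uv => //; apply: inB => //; apply: tB => //.
exact: (fintype.subsetP IW).
Qed.

(** Every edge then has F on one side and f0 on the other. *)
Lemma full_rim W f0 F F' : outer W f0 -> face_of (draw W T) F -> F <> f0 -> W \subset rim W F ->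
  face_of (draw W T) F' -> F' <> f0 -> F' = F.
Proof.
move=> [ff0 out] fF nF WC fF' nF'.
have [v0 v0C] := rim_ne ff0 fF nF.
have [v vW tv] := face_vertex (rimW v0C) fF'.
have vC := fintype.subsetP WC v vW.
have [y1 [y2 [n12 [s1 s2 y1C y2C] t1 t2 only]]] := rim_edges ff0 out fF nF vC.
have nbr y : sadj W T v y -> y = y1 \/ y = y2.
  move=> s; apply: only => //; apply: (no_chord ff0 out fF nF vC _ s).
  exact: (fintype.subsetP WC _ (sadj_r s)).
have n21 : y2 != y1 by rewrite eq_sym.
have u1 : etouch f0 v y1.
  have [y [s n t]] := second_edge ff0 (out v vW) s1 n12.
  by have [<-//|e] := nbr y s; rewrite e eqxx in n.
have u2 : etouch f0 v y2.
  have [y [s n t]] := second_edge ff0 (out v vW) s2 n21.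
  by have [e|<-//] := nbr y s; rewrite e eqxx in n.
have [y s t] := some_edge fF' tv s1.
have [e|e] := nbr y s; subst y.
  have [//|e|//] := edge_two_faces s fF ff0 fF' t1 u1 t.
  by case: nF'.
have [//|e|//] := edge_two_faces s fF ff0 fF' t2 u2 t.
by case: nF'.
Qed.

(** By induction on W. If f0 is the only face, J itself will do. Otherwise let F be another
face. If its rim is all of W, then F and f0 are the only faces and any vertex will do.
Else a component D of the rest is attached to the rim along a clique N with at most two
vertices, and the graph is separated into D with N and the complement of D. *)
Lemma outer_extendable W f0 : outer W f0 -> extendable W f0.
Proof.
have [n] := ubnP #|W|; elim: n W f0 => // n IH W f0 Wn oW Q J QW cQ Q2 JQ J1.
have [ff0 out] := oW.
have indep1 (I : {set V}) : (#|I| <= 1)%N -> forall a b, a \in I -> b \in I -> ~~ adj a b.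
  by move=> /card_le1_eqP I1 a b aI bI; rewrite (I1 a b aI bI) adj_irr.
have JW : J \subset W by exact: fintype.subset_trans JQ QW.
have JJ : (J :&: Q)%SET = J by apply/finset.setIidPl.
have [[F [fF nF]]|noF] := pselect (exists F, face_of (draw W T) F /\ F <> f0); last first.
  exists J => //; split=> //; first exact: indep1.
  by move=> F fF nF; case: noF; exists F.
have C3 := rim_card ff0 out fF nF.
have [WC|] := boolP (W \subset rim W F).
  have tF v : v \in W -> touch F v by move=> /(fintype.subsetP WC)/rimF.
  have single v : v \in W -> transversal W f0 [set v]%SET.
    move=> vW; split; first by rewrite finset.sub1set.
      by apply: indep1; rewrite cards1.
    move=> F' fF' nF'; rewrite (full_rim oW fF nF WC fF' nF'); exists v.
    split; [by rewrite inE|exact: tF|by move=> w; rewrite inE => /eqP].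
  have [J0|[j jJ]] := set_0Vmem J.
    have [v vC vQ] : exists2 v, v \in rim W F & v \notin Q.
      apply/subsetPn; apply: contraTN C3 => /subset_leq_card h.
      by rewrite -leqNgt (leq_trans h).
    exists [set v]%SET; first by apply: single; exact: rimW vC.
    rewrite J0; apply/setP => z; rewrite !inE; apply/negP => /andP[/eqP ->].
    by apply/negP.
  have JE : J = [set j]%SET.
    apply/setP => z; rewrite inE; apply/idP/eqP => [zJ|->//].
    by have /card_le1_eqP := J1; apply.
  exists J => //; rewrite JE; apply: single; exact: (fintype.subsetP JW).
move=> /subsetPn[w wW wC].
pose H := (W :\: rim W F)%SET.
pose D := [set x in H | connect (sadj H T) w x]%SET.
pose N := [set c in rim W F | [exists d in D, adj c d]]%SET.
have wH : w \in H by rewrite finset.in_setD wC wW.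
have DP x : (x \in D) = (x \in H) && connect (sadj H T) w x by rewrite finset.in_set.
have wD : w \in D by rewrite DP wH connect0.
have DW : D \subset W.
  by apply/fintype.subsetP => x; rewrite DP => /andP[]; rewrite finset.in_setD => /andP[].
have DC d : d \in D -> d \notin rim W F.
  by rewrite DP => /andP[]; rewrite finset.in_setD => /andP[].
have Dstep d e : d \in D -> sadj H T d e -> e \in D.
  rewrite !DP => /andP[_ wd] s; rewrite (sadj_r s) /=.
  by apply: connect_trans wd _; exact: connect1.
have Dw d : d \in D -> connect (sadj D T) w d.
  rewrite DP => /andP[dH /connectP[p + ->]].
  elim: p (w) wD {wH dH wW wC} => [|y p IHp] z zD /=; first by rewrite connect0.
  move=> /andP[s pp]; have yD := Dstep _ _ zD s.
  apply: (@connect_trans _ _ y); last exact: IHp.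
  by apply: connect1; rewrite sadjT zD yD (sadj_adj s).
have cD d d' : d \in D -> d' \in D -> connect (sadj D T) d d'.
  by move=> dD d'D; apply: connect_trans (Dw d' d'D); apply: connect_subC; exact: Dw.
have NP c : c \in N -> c \in rim W F /\ exists2 d, d \in D & adj c d.
  by rewrite finset.in_set => /andP[cC /existsP[d /andP[dD cd]]]; split=> //; exists d.
have cN : clique N.
  move=> a b /NP[aC [da daD ada]] /NP[bC [db dbD bdb]] ab.
  exact: (ear_adjacent ff0 out fF nF DW DC cD aC bC ab daD dbD).
have N2 : (#|N| <= 2)%N.
  rewrite leqNgt; apply/negP => /card_gt2P[a [b [c [[aN bN cN'] [ab bc ca]]]]].
  have [aC [da daD ada]] := NP a aN; have [bC [db dbD bdb]] := NP b bN.
  have [cC [dc dcD cdc]] := NP c cN'.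
  by apply: (ear_no_three ff0 out fF nF DW DC cD aC bC cC ab _ bc daD dbD dcD) => //;
    rewrite eq_sym.
pose A := (D :|: N)%SET; pose B := (W :\: D)%SET.
have NW : N \subset W by apply/fintype.subsetP => z /NP[/rimW].
have ND z : z \in N -> z \notin D by move=> /NP[zC _]; apply/negP => /DC; rewrite zC.
have WE : W = (A :|: B)%SET.
  apply/setP => z; rewrite !finset.in_setU finset.in_setD; case zD: (z \in D) => /=.
    by rewrite (fintype.subsetP DW _ zD).
  by case zN: (z \in N) => //=; rewrite (fintype.subsetP NW _ zN).
have ABN : (A :&: B)%SET = N.
  apply/setP => z; rewrite finset.in_setI finset.in_setU finset.in_setD.
  case zN: (z \in N); first by rewrite orbT (ND z zN) (fintype.subsetP NW _ zN).
  by rewrite orbF; case: (z \in D).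
have nb a b : sadj W T a b -> a \in D -> b \in A.
  move=> s aD; rewrite finset.in_setU; have [bC|bC] := boolP (b \in rim W F).
    apply/orP; right; rewrite finset.in_set bC; apply/existsP; exists a.
    by rewrite aD adj_sym (sadj_adj s).
  apply/orP; left; apply: Dstep (aD) _; rewrite sadjT (sadj_adj s) !finset.in_setD bC.
  by rewrite (sadj_l s) (sadj_r s) DC.
have DA : D \subset A by exact: finset.subsetUl.
have split a b : sadj W T a b -> (a \in A) && (b \in A) || (a \in B) && (b \in B).
  move=> s; have [aD|aD] := boolP (a \in D).
    by rewrite (fintype.subsetP DA a aD) (nb a b).
  have [bD|bD] := boolP (b \in D).
    by rewrite (fintype.subsetP DA b bD) andbT (nb b a) // sadj_sym.
  by rewrite !finset.in_setD aD bD (sadj_l s) (sadj_r s) orbT.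
have [AW BW] : A \subset W /\ B \subset W.
  by split; [rewrite finset.subUset DW NW|exact: finset.subsetDl].
have An : (#|A| < n)%N.
  apply: leq_trans (proper_card _) Wn; apply/properP; split=> //.
  have [c cC cN'] : exists2 c, c \in rim W F & c \notin N.
    apply/subsetPn; apply: contraTN C3 => /subset_leq_card h.
    by rewrite -leqNgt (leq_trans h).
  exists c; first exact: rimW cC.
  by rewrite finset.in_setU negb_or cN' andbT; apply/negP => /DC; rewrite cC.
have Bn : (#|B| < n)%N.
  apply: leq_trans (proper_card _) Wn; apply/properP; split=> //.
  by exists w => //; rewrite finset.in_setD wD.
have [fA oA sA] := outer_sub AW oW; have [fB oB sB] := outer_sub BW oW.
have extA := IH A fA An oA; have extB := IH B fB Bn oB.
have [QB|] := boolP (Q \subset B).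
  apply: (transversal_glue _ _ _ _ oW sB sA extB extA QB) => //.
  - by rewrite finset.setUC.
  - by move=> a b /split; rewrite orbC.
  - by rewrite finset.setIC ABN.
  - by rewrite finset.setIC ABN.
move=> /subsetPn[q qQ qB].
have qD : q \in D by move: qB; rewrite finset.in_setD (fintype.subsetP QW q qQ) andbT negbK.
have QA : Q \subset A.
  apply/fintype.subsetP => z zQ; have [->|zq] := eqVneq z q; first exact: (fintype.subsetP DA).
  apply: (nb q z) => //; rewrite sadjT !(fintype.subsetP QW) // !andbT.
  by apply: cQ => //; rewrite eq_sym.
by apply: (transversal_glue WE split _ _ oW sA sB extA extB QA) => //; rewrite ABN.
Qed.

(** Delete an edge u v and colour the rest. If u and v get the same colour, exchange the
colours on the component of u, which does not contain v. *)
Lemma bridges_bipartite W E :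
  (forall u v, sadj W E u v -> ~~ connect (sadj W (E :\ edge u v)%SET) u v) ->
  exists c : V -> bool, forall u v, sadj W E u v -> c u != c v.
Proof.
have [n] := ubnP #|E|; elim: n E => // n IH E En H.
have [[u [v s]]|nE] := pselect (exists u v, sadj W E u v); last first.
  by exists (fun _ => true) => u v s; case: nE; exists u, v.
pose E' := (E :\ edge u v)%SET.
have [||c Hc] := IH E'.
- by rewrite (cardsD1 (edge u v) E) (sadj_E s) in En; rewrite /E' -ltnS.
- move=> a b sab; apply/negP => cab.
  have : sadj W E a b by apply: sadj_mono sab => //; exact: finset.subsetDl.
  move=> /H/negP; apply; apply: connect_mono cab => //.
  by apply: finset.setSD; exact: finset.subsetDl.
have nuv := H u v s.
have [e|ne] := eqVneq (c u) (c v); last first.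
  exists c => a b /(sadj_delE u v)[|[-> ->]|[-> ->]] //; first exact: Hc.
  by rewrite eq_sym.
exists (fun w => c w (+) connect (sadj W E') u w) => a b /(sadj_delE u v)[sab|[-> ->]|[-> ->]].
- suff -> : connect (sadj W E') u a = connect (sadj W E') u b.
    by have := Hc a b sab; case: (c a); case: (c b); case: (connect _ _ _).
  apply/idP/idP => h; apply: connect_trans h _; apply: connect1 => //.
  by rewrite sadj_sym.
- by rewrite connect0 (negPf nuv) e; case: (c v).
- by rewrite connect0 (negPf nuv) e; case: (c v).
Qed.

Definition umax W F (c : V -> nat) := exists2 v, v \in W /\ touch F v &
  forall w, w \in W -> touch F w -> w != v -> (c w < c v)%N.

(** In the applications f0 is the hole left by vertices of colour 4. *)
Definition capped W f0 := exists c : V -> nat, [/\ forall v, (1 <= c v <= 4)%N,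
  forall u v, sadj W T u v -> c u != c v,
  forall v, v \in W -> touch f0 v -> (c v <= 3)%N &
  forall F, face_of (draw W T) F -> F <> f0 -> umax W F c].

(** A face that remains after the deletion of I and is not the one containing f0 would be
a face of the whole graph without a vertex in I. So there is only one face. *)
Lemma transversal_bridges W f0 I u v : outer W f0 -> transversal W f0 I ->
  sadj (W :\: I)%SET T u v -> ~~ connect (sadj (W :\: I)%SET (T :\ edge u v)%SET) u v.
Proof.
move=> [ff0 out] [IW ind tr] s; apply/negP => c.
have UW : (W :\: I)%SET \subset W by exact: finset.subsetDl.
have [f' ff' sf] := face_up (draw_mono UW (subxx T)) ff0.
(* a face with a vertex of I inside it meets f0, since f0 touches that vertex *)
have one F : face_of (draw (W :\: I)%SET T) F -> F = f'.
  move=> fF; apply: contrapT => nF.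
  have [fW nt] : face_of (draw W T) F /\ (forall u, u \in W -> u \notin (W :\: I)%SET -> ~ touch F u).
    apply: (face_down UW fF) => w wW wU Fw; apply: nF.
    have [e e0 He] := face_open (draw_closed _ _) fF Fw.
    have [p fp wp] := (closureE _ _).1 (out w wW) e e0.
    exact: (face_meet fF ff' (He _ wp) (sf _ fp)).
  have [|w [wI tw _]] := tr F fW.
    move=> e; have [p fp _] := face_pt ff0; apply: nF.
    by apply: (face_meet fF ff' _ (sf _ fp)); rewrite e.
  by apply: (nt w) => //; rewrite ?finset.in_setD ?wI //; exact: (fintype.subsetP IW).
have [F1 [F2 [f1 f2 n12 _ _]]] := nonbridge s c.
by apply: n12; rewrite (one _ f1) (one _ f2).
Qed.

Lemma outer_capped W f0 : outer W f0 -> capped W f0.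
Proof.
move=> oW; have [|||||I tI _] := @outer_extendable W f0 oW finset.set0 finset.set0.
- exact: finset.sub0set.
- by move=> a b; rewrite inE.
- by rewrite cards0.
- exact: subxx.
- by rewrite cards0.
have [c Hc] := bridges_bipartite (fun u v => @transversal_bridges W f0 I u v oW tI).
have [IW ind tr] := tI.
exists (fun v => if v \in I then 3%N else (c v).+1); split.
- by move=> v; case: ifP => //; case: (c v).
- move=> u v s; case: ifP => uI; case: ifP => vI.
  + by have := ind u v uI vI; rewrite (sadj_adj s).
  + by case: (c v).
  + by case: (c u).
  + have /Hc : sadj (W :\: I)%SET T u v.
      by rewrite sadjT !finset.in_setD uI vI (sadj_l s) (sadj_r s) (sadj_adj s).
    by case: (c u); case: (c v).
- by move=> v _ _; case: ifP => //; case: (c v).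
- move=> F fF nF; have [v [vI tv uv]] := tr F fF nF.
  exists v; first by split=> //; exact: (fintype.subsetP IW).
  move=> w wW tw wv; rewrite vI; case: ifP => wI; last by case: (c w).
  by rewrite (uv w wI tw) eqxx in wv.
Qed.
End OuterColoring.

(** * Subcubic graphs *)

Section Subcubic.
Variables (R : realType) (G : plane_graph R).
Notation V := (vertex G).
Implicit Types (u v w x y : V) (W A B X Y : {set V}) (E : {set {set V}}) (F : set (R * R)).
Local Notation pos := (@pos R G).
Local Notation curve := (@curve R G).
Local Notation T := (@finset.setTfor {set V}).

(** All faces at v merge into this face when v is deleted. *)
Definition hole W v := joined (draw (W :\ v)%SET T) (pos v).

Lemma hole_out W v : ~ draw (W :\ v)%SET T (pos v).
Proof. by apply: draw_out; rewrite finset.in_setD1 eqxx. Qed.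
Lemma hole_face W v : face_of (draw (W :\ v)%SET T) (hole W v).
Proof. by apply: joined_face; exact: hole_out. Qed.
Lemma hole_pos W v : hole W v (pos v).
Proof. by apply: joined_refl; exact: hole_out. Qed.

Lemma hole_sup W W' v F : face_of (draw W' T) F -> (W :\ v)%SET \subset W' -> touch F v ->
  F `<=` hole W v.
Proof.
move=> fF WW t; apply: (touch_sub (draw_closed _ _) _ fF t); last exact: hole_out.
exact: draw_mono.
Qed.

Lemma hole_nbr W u v : adj v u -> touch (hole W v) u.
Proof.
move=> vu; have ns : ~~ sadj (W :\ v)%SET T v u by rewrite sadjT finset.in_setD1 eqxx andbF.
have [p [c pv pu] [Kp [_ tu]]] := edge_face vu ns.
suff -> : hole W v = joined (draw (W :\ v)%SET T) p by [].
apply: same_connected_component; apply: half_edge vu _ c pu.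
by rewrite finset.in_setD1 eqxx.
Qed.

Lemma face_del W F v : v \in W -> face_of (draw W T) F -> ~ touch F v ->
  face_of (draw (W :\ v)%SET T) F /\ F <> hole W v.
Proof.
move=> vW fF nt; split; first exact: face_delV.
move=> e; apply: (face_in fF (x := pos v)); last exact: draw_pos.
by rewrite e; exact: hole_pos.
Qed.

Lemma umax_ext W W' F c c' : W' \subset W -> (forall v, v \in W -> touch F v -> v \in W') ->
  (forall v, v \in W' -> c' v = c v) -> umax W' F c -> umax W F c'.
Proof.
move=> WW H cc [v [vW tv] uv]; exists v; first by split=> //; exact: (fintype.subsetP WW).
move=> w wW tw wv; have wW' := H w wW tw.
by rewrite !cc //; exact: uv.
Qed.

(** All faces at v lie in the hole of v, where the other colours are at most 3. *)
Lemma color_hole W v : v \in W -> capped (W :\ v)%SET (hole W v) -> exists c : V -> nat,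
  [/\ forall u, (1 <= c u <= 4)%N, forall u w, sadj W T u w -> c u != c w,
   forall F, face_of (draw W T) F -> umax W F c, c v = 4%N &
   forall F u, face_of (draw W T) F -> touch F v -> u \in W -> u != v -> touch F u ->
     (c u <= 3)%N].
Proof.
move=> vW [c [c14 cp c3 cm]]; pose c' u := if u == v then 4%N else c u.
have low F u : face_of (draw W T) F -> touch F v -> u \in W -> u != v -> touch F u ->
    (c' u <= 3)%N.
  move=> fF tv uW uv tu; rewrite /c' (negPf uv); apply: c3.
    by rewrite finset.in_setD1 uv.
  by apply: touch_mono tu; apply: hole_sup fF _ tv; exact: finset.subsetDl.
have nbr u : u \in W -> adj v u -> (c' u <= 3)%N.
  move=> uW vu; have uv : u != v by apply: contraTneq vu => ->; rewrite adj_irr.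
  rewrite /c' (negPf uv); apply: c3; first by rewrite finset.in_setD1 uv.
  exact: hole_nbr.
have cv : c' v = 4%N by rewrite /c' eqxx.
exists c'; split=> //.
- by move=> u; rewrite /c'; case: ifP.
- have key u w : sadj W T u w -> u = v -> c' u != c' w.
    move=> s e; rewrite e in s *; rewrite cv; apply/eqP => cw.
    by have := nbr w (sadj_r s) (sadj_adj s); rewrite -cw.
  move=> u w s; have [/(key u w s)//|uv] := eqVneq u v.
  have [wv|wv] := eqVneq w v; first by rewrite eq_sym; apply: key => //; rewrite sadj_sym.
  rewrite /c' (negPf uv) (negPf wv); apply: cp.
  by rewrite sadjT !finset.in_setD1 uv wv (sadj_adj s) (sadj_l s) (sadj_r s).
- move=> F fF; have [tv|ntv] := pselect (touch F v).
    exists v; [exact: (conj vW tv)|move=> w wW tw wv; rewrite cv ltnS].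
    exact: low fF tv wW wv tw.
  have [f' nf] := face_del vW fF ntv.
  apply: umax_ext (cm F f' nf); first exact: finset.subsetDl.
    move=> w wW tw; rewrite finset.in_setD1 wW andbT.
    by apply/eqP => e; apply: ntv; rewrite -e.
  by move=> w; rewrite finset.in_setD1 /c' => /andP[/negPf ->].
Qed.

Lemma two_others x v : (degree x <= 3)%N -> adj x v ->
  exists y1 y2, forall y, adj x y -> [\/ y = v, y = y1 | y = y2].
Proof.
move=> d xv; pose N := ([set y | adj x y] :\ v)%SET.
have NP y : adj x y -> y != v -> y \in N by rewrite !inE => -> ->.
have dN : #|[set y | adj x y]%SET| = degree x by rewrite cardsE.
have N2 : (#|N| <= 2)%N.
  by move: d; rewrite -dN (cardsD1 v) inE xv.
have sub2 y1 y2 : N \subset [set y1; y2]%SET -> exists y1 y2, forall y,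
    adj x y -> [\/ y = v, y = y1 | y = y2].
  move=> /fintype.subsetP H; exists y1, y2 => y xy.
  have [->|yv] := eqVneq y v; first by constructor 1.
  have := H y (NP y xy yv); rewrite !inE => /orP[/eqP ->|/eqP ->];
  by [constructor 2|constructor 3].
move: N2; rewrite leq_eqVlt => /orP[/cards2P[y1 [y2 [_ NE]]]|].
  by apply: (sub2 y1 y2); rewrite NE.
rewrite ltnS leq_eqVlt => /orP[/cards1P[y1 NE]|].
  by apply: (sub2 y1 y1); rewrite NE; apply/fintype.subsetP => z; rewrite !inE => ->.
rewrite ltnS leqn0 cards_eq0 => /eqP NE.
by apply: (sub2 v v); rewrite NE finset.sub0set.
Qed.

Lemma free_color a b : exists2 k, (1 <= k <= 3)%N & (k != a) && (k != b).
Proof.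
case: (eqVneq 1%N a) => [<-|h1]; case: (eqVneq 1%N b) => [<-|h1'].
- by exists 2%N.
- by case: (eqVneq 2%N b) => [<-|h2]; [exists 3%N|exists 2%N].
- by case: (eqVneq 2%N a) => [<-|h2]; [exists 3%N|exists 2%N => //; rewrite h2].
- by exists 1%N => //; rewrite h1 h1'.
Qed.

(** The vertex v gets colour 4, which settles all faces at v. As v is not on f0, every face
at x other than f0 touches v, since x has degree at most 3. The deletion of v and x merges
f0 with the faces at v, so all vertices on these have colours up to 3; and only two
neighbours restrict the choice of such a colour for x. *)
Lemma capped_edge W f0 x v : (forall u : V, degree u <= 3)%N -> face_of (draw W T) f0 ->
  x \in W -> v \in W -> adj x v -> touch f0 x -> ~ touch f0 v ->
  capped (W :\ v :\ x)%SET (hole (W :\ v)%SET x) -> capped W f0.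
Proof.
move=> d3 ff0 xW vW xv tx nv [c [c14 cp c3 cm]].
have vx : v != x by apply: contraTneq xv => ->; rewrite adj_irr.
have xWv : x \in (W :\ v)%SET by rewrite finset.in_setD1 eq_sym vx.
have [y1 [y2 nb]] := two_others (d3 x) xv.
have [k k13 /andP[k1 k2]] := free_color (c y1) (c y2).
pose c' u := if u == v then 4%N else if u == x then k else c u.
have cv : c' v = 4%N by rewrite /c' eqxx.
have cx : c' x = k by rewrite /c' eq_sym (negPf vx) eqxx.
have cE u : u != v -> u != x -> c' u = c u by rewrite /c' => /negPf -> /negPf ->.
have memW2 u : u \in W -> u != v -> u != x -> u \in (W :\ v :\ x)%SET.
  by move=> uW uv ux; rewrite !finset.in_setD1 ux uv.
have k3 : (k <= 3)%N by case/andP: k13.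
(* x is a neighbour of v and lies on f0, so both faces are merged in the hole of x *)
have sv : hole W v `<=` hole (W :\ v)%SET x.
  apply: (hole_sup (hole_face W v)); first exact: finset.subsetDl.
  by apply: hole_nbr; rewrite adj_sym.
have [ff0v _] := face_del vW ff0 nv.
have s0 : f0 `<=` hole (W :\ v)%SET x.
  by apply: (hole_sup ff0v _ tx); exact: finset.subsetDl.
have low f u : f `<=` hole (W :\ v)%SET x -> u \in W -> touch f u -> u != v -> (c' u <= 3)%N.
  move=> sf uW tu uv; have [->|ux] := eqVneq u x; first by rewrite cx.
  rewrite (cE u uv ux); exact: c3 (memW2 u uW uv ux) (touch_mono sf tu).
have nbv u : u \in W -> adj v u -> (c' u <= 3)%N.
  move=> uW vu; apply: (low _ u sv uW (hole_nbr W vu)).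
  by apply: contraTneq vu => ->; rewrite adj_irr.
exists c'; split.
- move=> u; rewrite /c'; case: ifP => [_|_]; first by [].
  case: ifP => [_|_]; last exact: c14.
  by case/andP: k13 => -> /leq_trans ->.
- have keyv u w : sadj W T u w -> u = v -> c' u != c' w.
    move=> s e; rewrite e in s *; rewrite cv; apply/eqP => cw.
    by have := nbv w (sadj_r s) (sadj_adj s); rewrite -cw.
  have keyx u w : sadj W T u w -> u = x -> w != v -> c' u != c' w.
    move=> s e wv; rewrite e in s *; have wx : w != x by rewrite eq_sym (sadj_neq s).
    rewrite cx cE //; have [ew|->//|->//] := nb w (sadj_adj s).
    by rewrite ew eqxx in wv.
  move=> u w s; have s' : sadj W T w u by rewrite sadj_sym.
  have [uv|uv] := eqVneq u v; first exact: keyv.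
  have [wv|wv] := eqVneq w v; first by rewrite eq_sym; exact: keyv.
  have [ux|ux] := eqVneq u x; first exact: keyx.
  have [wx|wx] := eqVneq w x; first by rewrite eq_sym; exact: keyx.
  rewrite !cE //; apply: cp; rewrite sadjT (sadj_adj s) !memW2 ?(sadj_l s) ?(sadj_r s) //.
- move=> u uW tu; apply: (low _ u s0 uW tu).
  by apply/eqP => e; apply: nv; rewrite -e.
- move=> F fF nF; have [tv|ntv] := pselect (touch F v).
    exists v; [exact: (conj vW tv)|move=> w wW tw wv; rewrite cv ltnS].
    apply: (low F w _ wW tw wv); apply: subset_trans sv.
    by apply: (hole_sup fF _ tv); exact: finset.subsetDl.
  have ntx : ~ touch F x.
    move=> tFx; apply: nF.
    have sxv : sadj W T x v by rewrite sadjT xv xW vW.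
    have nbx y : sadj W T x y -> [\/ y = v, y = y1 | y = y2] by move=> /sadj_adj/nb.
    exact: (faces_at_deg3 sxv nbx fF ff0 tFx tx ntv nv).
  have [f1 _] := face_del vW fF ntv; have [f2 n2] := face_del xWv f1 ntx.
  have WW : (W :\ v :\ x)%SET \subset W.
    by apply: fintype.subset_trans (finset.subsetDl _ _); exact: finset.subsetDl.
  apply: (umax_ext WW _ _ (cm F f2 n2)).
    move=> w wW tw; apply: (memW2 _ wW); apply/eqP => e; [apply: ntv|apply: ntx];
    by rewrite -e; exact: tw.
  by move=> w; rewrite !finset.in_setD1 => /and3P[wx wv _]; exact: cE.
Qed.

(** The set A of the vertices on f0 is a union of components. Let Phi be a face of A that
contains other vertices, Y the part of the graph inside Phi and X the rest. Seen from Y,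
the part X lies in one face Psi. Faces touching both X and Y lie in Phi and Psi, and by
Janiszewski's theorem there is just one, which sees all that Phi and Psi see. So X and Y
can be coloured on their own, up to providing a single 4 for this face. *)
Lemma capped_split W f0 b : face_of (draw W T) f0 -> b \in W -> ~ touch f0 b ->
  (forall x v, x \in W -> v \in W -> adj x v -> touch f0 x -> touch f0 v) ->
  (forall X f, (#|X| < #|W|)%N -> face_of (draw X T) f -> capped X f) -> capped W f0.
Proof.
move=> ff0 bW nb closed IH.
pose A := [set a in W | `[< touch f0 a >]]%SET.
have AP a : (a \in A) = (a \in W) && `[< touch f0 a >] by rewrite finset.in_set.
have Aadj x y : x \in W -> y \in W -> adj x y -> (x \in A) = (y \in A).
  move=> xW yW xy; rewrite !AP xW yW /=; apply/asboolP/asboolP; first exact: closed.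
  by apply: closed => //; rewrite adj_sym.
have AW : A \subset W by apply/fintype.subsetP => a; rewrite AP => /andP[].
have [a0 a0A] : exists a, a \in A.
  have [a aW ta] := face_vertex bW ff0; exists a; rewrite AP aW; exact/asboolP.
have bA : b \notin A by rewrite AP negb_and; apply/orP; right; apply/asboolPn.
pose KA := draw A T; pose Phi := joined KA (pos b).
have nKA v : v \notin A -> ~ KA (pos v) by exact: draw_out.
have fPhiA : face_of KA Phi by apply: joined_face; exact: nKA.
(* no edge leaves A, so the other edges do not meet the drawing of A *)
have off x y p : x \in W -> y \in W -> adj x y -> x \notin A -> curve x y p ->
    joined KA (pos x) p.
  move=> xW yW xy xA c; have yA : y \notin A by rewrite -(Aadj x y).
  apply: (joined_conn (curve_connected xy) _ (pos_curve_l xy) c) => z cz Kz.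
  have ns : ~~ sadj A T x y by rewrite sadjT (negPf xA) andbF.
  by have [e|e] := curve_sep xy ns cz Kz; move: Kz; rewrite e; exact: nKA.
pose Y := [set y in W | `[< Phi (pos y) >]]%SET.
have YP y : reflect (y \in W /\ Phi (pos y)) (y \in Y).
  by rewrite finset.in_set; apply: (iffP andP) => -[h /asboolP t]; split => //; exact/asboolP.
pose X := (W :\: Y)%SET.
have YA y : y \in Y -> y \notin A.
  move=> /YP[_ py]; apply/negP => yA; apply: (face_in fPhiA py); exact: draw_pos.
have bY : b \in Y by apply/YP; split=> //; apply: joined_refl; exact: nKA.
have YW : Y \subset W by apply/fintype.subsetP => y /YP[].
have XW : X \subset W by exact: finset.subsetDl.
have AX : A \subset X.
  apply/fintype.subsetP => a aA; rewrite finset.in_setD (fintype.subsetP AW a aA) andbT.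
  by apply/negP => /YA; rewrite aA.
have a0X := fintype.subsetP AX _ a0A; have a0W := fintype.subsetP AW _ a0A.
have XY z : z \in W -> (z \in X) = (z \notin Y).
  by move=> zW; rewrite finset.in_setD zW andbT.
have Yadj x y : x \in W -> y \in W -> adj x y -> y \in Y -> x \in Y.
  move=> xW yW xy yY; have yx : adj y x by rewrite adj_sym.
  apply/YP; split=> //; have [_ py] := YP _ yY.
  by apply: joined_trans py _; apply: (off y x) => //; [exact: YA|exact: pos_curve_r].
have WE : W = (X :|: Y)%SET.
  apply/setP => z; rewrite finset.in_setU; have [zW|zW] := boolP (z \in W).
    by rewrite XY //; case: (z \in Y).
  rewrite finset.in_setD (negPf zW) andbF; apply/esym/negP => zY.
  by rewrite (fintype.subsetP YW) in zW.
have split u v : sadj W T u v -> (u \in X) && (v \in X) || (u \in Y) && (v \in Y).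
  move=> s; have [uW vW] := (sadj_l s, sadj_r s); have uv := sadj_adj s.
  have vu : adj v u by rewrite adj_sym.
  rewrite !XY //; have [uY|uY] := boolP (u \in Y); have [vY|vY] := boolP (v \in Y) => //.
    by rewrite (Yadj v u) in vY.
  by rewrite (Yadj u v) in uY.
have KU := draw_sepU WE split.
have XY0 : (X :&: Y)%SET = finset.set0.
  by apply/setP => z; rewrite finset.in_setI finset.in_setD finset.in_set0; case: (z \in Y); rewrite ?andbF.
have KI p : draw X T p -> ~ draw Y T p.
  move=> h1 h2; have := draw_sepI h1 h2; rewrite XY0 => -[[v]|[u [v [s _]]]].
    by rewrite finset.in_set0.
  by have := sadj_l s; rewrite finset.in_set0.
have cardX : (#|X| < #|W|)%N.
  apply: proper_card; apply/properP; split=> //; exists b => //.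
  by rewrite finset.in_setD bY.
have cardY : (#|Y| < #|W|)%N.
  apply: proper_card; apply/properP; split=> //; exists a0 => //.
  by apply/negP => /YA; rewrite a0A.
have notA v : v \in W -> v \notin A -> ~ touch f0 v.
  by move=> vW; rewrite AP vW => /asboolP.
have ff0A : face_of KA f0 by exact: face_in_part AW ff0 notA.
have ff0X : face_of (draw X T) f0.
  apply: (face_in_part XW ff0) => v vW vX; apply: notA => //.
  by apply: contra vX; exact: (fintype.subsetP AX).
have nPhi0 : Phi <> f0.
  move=> e; apply: (face_in ff0 (x := pos b)); last exact: draw_pos.
  by rewrite -e; apply: joined_refl; exact: nKA.
have PhiX p : Phi p -> ~ draw X T p.
  move=> ph; case=> [[x xX e]|[x [y [s c]]]].
    have xW := fintype.subsetP XW x xX.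
    by move: xX; rewrite XY // => /YP[]; split=> //; rewrite -e.
  have [xX yX] := (sadj_l s, sadj_r s); have xy := sadj_adj s.
  have [xW yW] := (fintype.subsetP XW x xX, fintype.subsetP XW y yX).
  have [xA|xA] := boolP (x \in A).
    apply: (face_in fPhiA ph); apply: (@draw_curve _ _ _ _ x y) => //.
    by rewrite sadjT xy xA -(Aadj x y).
  have xp := off x y p xW yW xy xA c.
  move: xX; rewrite XY // => /YP[]; split=> //.
  by rewrite (face_eq fPhiA ph); exact: joined_sym.
have KAX : KA `<=` draw X T by exact: draw_mono.
have fPhi : face_of (draw X T) Phi.
  have pb : Phi (pos b) by apply: joined_refl; exact: nKA.
  exists (pos b); first exact: PhiX.
  apply/seteqP; split=> p; last exact: joined_sub.
  by move=> ph; apply: joined_conn (face_connected fPhiA) PhiX pb ph.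
have KYW : draw Y T `<=` draw W T by exact: draw_mono.
have [Psi fPsi sPsi] := face_up KYW ff0.
have nKY v : v \in W -> v \notin Y -> ~ draw Y T (pos v) by move=> _; exact: draw_out.
have PsiA a : a \in A -> Psi (pos a).
  move=> aA; have aX := fintype.subsetP AX a aA; have aW := fintype.subsetP AW a aA.
  have nKa : ~ draw Y T (pos a) by apply: nKY => //; rewrite -XY.
  have ta : touch f0 a by move: aA; rewrite AP => /andP[_ /asboolP].
  have s := touch_sub (draw_closed _ _) KYW ff0 ta nKa.
  have [p fp _] := face_pt ff0.
  by rewrite (face_meet fPsi (joined_face nKa) (sPsi _ fp) (s _ fp)); exact: joined_refl.
have KYPhi p : draw Y T p -> Phi p.
  case=> [[y /YP[_ py] ->]|[y [z [s c]]]] //.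
  have [yY zY] := (sadj_l s, sadj_r s); have [yW py] := YP _ yY.
  have [zW _] := YP _ zY.
  by apply: joined_trans py _; apply: (off y z) => //; [exact: sadj_adj s|exact: YA].
have PsiX x : x \in X -> Psi (pos x).
  move=> xX; have xW := fintype.subsetP XW x xX.
  have [|xA] := boolP (x \in A); first exact: PsiA.
  have nx : ~ Phi (pos x) by move=> px; move: xX; rewrite XY // => /YP[].
  have fx : face_of KA (joined KA (pos x)) by apply: joined_face; exact: nKA.
  have xx : joined KA (pos x) (pos x) by apply: joined_refl; exact: nKA.
  have [a aA ta] := face_vertex a0A fx.
  have [e e0 He] := face_open (draw_closed _ _) fPsi (PsiA a aA).
  have [r xr ar] := (closureE _ _).1 ta e e0.
  rewrite (face_eq fPsi (He r ar)); apply: (joined_conn (face_connected fx) _ xr xx) => z xz Kz.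
  by apply: nx; rewrite (face_meet fPhiA fx (KYPhi z Kz) xz).
(* near a vertex of X that Phi touches, the points of Phi are also in Psi, hence in F *)
have mixed F x1 y1 : face_of (draw W T) F -> x1 \in X -> y1 \in Y -> touch F x1 -> touch F y1 ->
    [/\ F `<=` Phi, F `<=` Psi, forall x, x \in X -> touch Phi x -> touch F x &
      forall y, y \in Y -> touch Psi y -> touch F y].
  move=> fF x1X y1Y tx ty.
  have KXW : draw X T `<=` draw W T by exact: draw_mono.
  have x1W := fintype.subsetP XW x1 x1X.
  have ny : ~ draw X T (pos y1) by apply: draw_out; rewrite finset.in_setD y1Y.
  have nx : ~ draw Y T (pos x1) by apply: (nKY _ x1W); rewrite -(XY _ x1W).
  have FPhi : F `<=` Phi.
    have [_ py1] := YP _ y1Y.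
    by rewrite (face_eq fPhi py1); exact: touch_sub (draw_closed _ _) KXW fF ty ny.
  have FPsi : F `<=` Psi.
    by rewrite (face_eq fPsi (PsiX _ x1X)); exact: touch_sub (draw_closed _ _) KYW fF tx nx.
  have [p Fp _] := face_pt fF.
  have FI r : Phi r -> Psi r -> F r.
    move=> hr sr; rewrite (face_eq fF Fp) KU; apply: janiszewski.
    - exact: draw_compact.
    - exact: draw_compact.
    - suff -> : draw X T `&` draw Y T = set0 by exact: connected0.
      by rewrite -subset0 => z [/KI].
    - by rewrite -(face_eq fPhi (FPhi _ Fp)).
    - by rewrite -(face_eq fPsi (FPsi _ Fp)).
  split; [exact: FPhi|exact: FPsi| |].
    move=> x xX t; apply/closureE => e e0.
    have [e' e'0 He] := face_open (draw_closed _ _) fPsi (PsiX x xX).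
    have m0 : 0 < Num.min e e' by rewrite lt_min e0.
    have [r Pr br] := (closureE _ _).1 t _ m0.
    exists r; last by apply: le_ball br; rewrite ge_min lexx.
    by apply: (FI _ Pr); apply: He; apply: le_ball br; rewrite ge_min lexx orbT.
  move=> y yY t; apply/closureE => e e0.
  have [_ py] := YP _ yY; have [e' e'0 He] := face_open (draw_closed _ _) fPhi py.
  have m0 : 0 < Num.min e e' by rewrite lt_min e0.
  have [r Pr br] := (closureE _ _).1 t _ m0.
  exists r; last by apply: le_ball br; rewrite ge_min lexx.
  by apply: (FI _ _ Pr); apply: He; apply: le_ball br; rewrite ge_min lexx orbT.
have [cX [X14 Xp X3 Xm]] := IH X f0 cardX ff0X.
(* If X has no 4 on Phi, a vertex y0 of Y on Psi gets this colour. *)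
pose P := exists2 x0, x0 \in X & touch Phi x0 /\ cX x0 = 4%N.
have [cY [Y14 Yp Ym YPsi]] : exists cY : V -> nat, [/\ forall v, (1 <= cY v <= 4)%N,
    forall u v, sadj Y T u v -> cY u != cY v,
    forall F, face_of (draw Y T) F -> F <> Psi -> umax Y F cY &
    (P -> forall y, y \in Y -> touch Psi y -> (cY y <= 3)%N) /\
    (~ P -> exists y0, [/\ y0 \in Y, touch Psi y0, cY y0 = 4%N &
       forall y, y \in Y -> touch Psi y -> y != y0 -> (cY y <= 3)%N])].
  have [hP|hP] := pselect P.
    by have [cY [h1 h2 h3 h4]] := IH Y Psi cardY fPsi; exists cY; split.
  have [y0 y0Y ty0] := face_vertex bY fPsi.
  have cardY0 : (#|(Y :\ y0)%SET| < #|W|)%N.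
    by apply: leq_ltn_trans cardY; apply: subset_leq_card; exact: finset.subsetDl.
  have [cY [h1 h2 h3 h4 h5]] := color_hole y0Y (IH _ _ cardY0 (hole_face Y y0)).
  exists cY; split; [exact: h1|exact: h2|by move=> F fF _; exact: h3|split=> [/hP[]|_]].
  exists y0; split; [exact: y0Y|exact: ty0|exact: h4|].
  by move=> y yY ty n; exact: h5 fPsi ty0 yY n ty.
pose c v := if v \in Y then cY v else cX v.
have cXE x : x \in X -> c x = cX x by rewrite /c finset.in_setD => /andP[/negPf ->].
have cYE y : y \in Y -> c y = cY y by rewrite /c => ->.
exists c; split.
- by move=> v; rewrite /c; case: ifP.
- move=> u v s; have /orP[/andP[uX vX]|/andP[uY vY]] := split u v s.
    by rewrite !cXE //; apply: Xp; rewrite sadjT (sadj_adj s) uX vX.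
  by rewrite !cYE //; apply: Yp; rewrite sadjT (sadj_adj s) uY vY.
- move=> v vW tv; have vA : v \in A by rewrite AP vW; exact/asboolP.
  have vX := fintype.subsetP AX v vA; rewrite (cXE v vX); exact: X3 vX tv.
- move=> F fF nF.
  have [[y1 y1Y ty1]|nY] := pselect (exists2 y, y \in Y & touch F y); last first.
    have out v : v \in W -> touch F v -> v \in X.
      move=> vW tv; rewrite (XY _ vW); apply/negP => vY; apply: nY.
      by exists v; [exact: vY|exact: tv].
    have fX : face_of (draw X T) F.
      by apply: (face_in_part XW fF) => v vW vX tv; move: vX; rewrite out.
    exact: umax_ext XW out cXE (Xm F fX nF).
  have [[x1 x1X tx1]|nX] := pselect (exists2 x, x \in X & touch F x); last first.
    have out v : v \in W -> touch F v -> v \in Y.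
      move=> vW tv; apply/negPn/negP => vY; apply: nX.
      by exists v; [rewrite (XY _ vW)|exact: tv].
    have fY : face_of (draw Y T) F.
      by apply: (face_in_part YW fF) => v vW vY tv; move: vY; rewrite out.
    have nPsi : F <> Psi.
      move=> e; apply: (face_in fF (x := pos a0)); last exact: draw_pos.
      by rewrite e; exact: PsiA.
    exact: umax_ext YW out cYE (Ym F fY nPsi).
  have [sPhi sPsi' tX tY] := mixed F x1 y1 fF x1X y1Y tx1 ty1.
  have [hP|hP] := pselect P.
    have [x0 x0X [tx0 cx0]] := hP; exists x0.
      by split; [exact: (fintype.subsetP XW)|exact: tX].
    have [x2 [x2X tx2] u2] := Xm Phi fPhi nPhi0.
    have e02 : x0 = x2.
      apply/eqP/negPn/negP => n; have := u2 x0 x0X tx0 n; rewrite cx0 ltnNge.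
      by case/andP: (X14 x2) => _ ->.
    move=> w wW tw wx; rewrite (cXE x0 x0X) cx0; have [wY|wY] := boolP (w \in Y).
      by rewrite (cYE w wY) ltnS; exact: YPsi.1 hP w wY (touch_mono sPsi' tw).
    have wX : w \in X by rewrite (XY _ wW).
    rewrite (cXE w wX) -cx0 e02; apply: (u2 w wX (touch_mono sPhi tw)).
    by rewrite -e02.
  have [y0 [y0Y ty0 cy0 u0]] := YPsi.2 hP; exists y0.
    by split; [exact: (fintype.subsetP YW)|exact: tY].
  move=> w wW tw wy; rewrite (cYE y0 y0Y) cy0 ltnS; have [wY|wY] := boolP (w \in Y).
    by rewrite (cYE w wY); exact: u0 w wY (touch_mono sPsi' tw) wy.
  have wX : w \in X by rewrite (XY _ wW).
  rewrite (cXE w wX); have /andP[_] := X14 w; rewrite leq_eqVlt => /orP[/eqP e|//].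
  by exfalso; apply: hP; exists w; [exact: wX|split; [exact: touch_mono sPhi tw|exact: e]].
Qed.

(** Either an edge leaves the boundary of f0, or some vertex is off f0 without such an
edge, or all vertices are on f0. *)
Lemma subcubic_capped W f0 : (forall u : V, degree u <= 3)%N -> face_of (draw W T) f0 -> capped W f0.
Proof.
move=> d3; have [n] := ubnP #|W|; elim: n W f0 => // n IH W f0 Wn ff0.
have [[x [v [xW vW xv [tx nv]]]]|nE] := pselect (exists x v, [/\ x \in W, v \in W, adj x v &
  touch f0 x /\ ~ touch f0 v]).
  apply: (capped_edge d3 ff0 xW vW xv tx nv); apply: IH; last exact: hole_face.
  rewrite (cardsD1 v) vW ltnS in Wn; apply: leq_trans Wn.
  by rewrite add1n ltnS; apply: subset_leq_card; exact: finset.subsetDl.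
have [[b [bW nb]]|nb] := pselect (exists b, b \in W /\ ~ touch f0 b).
  apply: (capped_split ff0 bW nb).
    move=> x v xW vW xv tx; apply: contrapT => nv; apply: nE.
    by exists x, v; split; [exact: xW|exact: vW|exact: xv|exact: (conj tx nv)].
  by move=> X f XW; apply: IH; exact: leq_trans XW Wn.
apply: outer_capped; split=> // v vW; apply: contrapT => nv.
by apply: nb; exists v.
Qed.

Lemma drawingE : drawing G = draw (@finset.setTfor V) T.
Proof.
apply/seteqP; split=> p.
  case=> [[v _ <-]|[u [v [uv c]]]]; first by left; exists v.
  by right; exists u, v; rewrite sadjT uv !finset.in_setT.
case=> [[v _ ->]|[u [v [s c]]]]; first by left; exists v.
by right; exists u, v; split=> //; exact: sadj_adj s.
Qed.

Lemma fum_of_capped v : capped (@finset.setTfor V :\ v)%SET (hole (@finset.setTfor V) v) ->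
  fum_colorable G 4.
Proof.
move=> H; have [c [c14 cp cm _ _]] := color_hole (finset.in_setT v) H.
exists (fun v => (c v)%:Z); last by move=> u; rewrite !lez_nat.
split=> [u w uw|F m fF [[u uF cu] mx]].
  by rewrite eqz_nat; apply: cp; rewrite sadjT uw !finset.in_setT.
have [w [_ tw] uw] : umax (@finset.setTfor V) F c by apply: cm; rewrite -drawingE.
have mw : (c w)%:Z = m.
  apply/eqP; rewrite eq_le mx //= -cu lez_nat; have [->//|nu] := eqVneq u w.
  by apply: ltnW; apply: uw => //; exact: finset.in_setT.
exists w; split=> // w' [iw' cw']; apply/eqP; rewrite eq_sym; apply/negPn/negP => n.
have := uw w' (finset.in_setT _) iw' n.
have -> : c w' = c w by apply/eqP; rewrite -eqz_nat cw' mw.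
by rewrite ltnn.
Qed.

Lemma fum_empty : (forall v : V, False) -> fum_colorable G 4.
Proof.
move=> no; exists (fun _ => 1%:Z); last by move=> v; case: (no v).
by split=> [u|F m _ [[u]]]; case: (no u).
Qed.
End Subcubic.

Theorem theorem2 (R : realType) (G : plane_graph R) :
  subcubic G \/ outerplane G -> (chi_fum G <= 4)%N.
Proof.
move=> H; suff : fum_colorable G 4.
  by rewrite /chi_fum; case: ex_minnP => m _ mn h; apply: mn; exact/asboolP.
have [[v0 _]|no] := pselect (exists v : vertex G, True); last first.
  by apply: fum_empty => v; apply: no; exists v.
case: H => [cub|[F [[fF _] out]]].
  by apply: (fum_of_capped (v := v0)); apply: subcubic_capped => //; exact: hole_face.
rewrite /face drawingE in fF.
apply: (fum_of_capped (v := v0)); apply: outer_capped; split; first exact: hole_face.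
move=> u _; apply: (touch_mono _ (out u)).
by apply: (hole_sup fF _ (out v0)); exact: finset.subsetDl.
Qed.
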